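(* Let $q\in\mathbb C$, $0<|q|<1$, let $\kappa=(\kappa_0,\kappa_t,\kappa_1,\kappa_\infty)\in(\mathbb C^* )^4$, $t_0\in\mathbb C^*$ satisfy the non-resonance conditions, and assume $\kappa_0=\kappa_t\kappa_1\kappa_\infty$. Let $c\in\mathbb C$, $\nu\in\mathbb C^*$ and consider RHP II with the upper-triangular (reducible) connection matrix $$C(z)=\begin{pmatrix}\theta_q\big(\frac{z}{\kappa_tt_0},\frac z{\kappa_1}\big)&c\,\theta_q\big(\frac z{\nu t_0},\frac{z\nu}{\kappa_0\kappa_\infty}\big)\\ 0&\theta_q\big(\frac{z\kappa_t}{t_0},z\kappa_1\big)\end{pmatrix}\in\mathfrak C(\kappa,t_0)$$ and an admissible family of curves $(\gamma^{(m)})_{m\in\mathbb Z}$. Then for all $m,n\in\mathbb Z$, with $t_m=q^mt_0$: (a) the solution $\Psi^{(m,n)}(z)$ of RHP II exists if and only if there exists a solution $Y^{(m,n)}(z)$ of RHP III with weight $w(z,t_m)$, and the two are related by $$Y^{(m,n)}(z)=\begin{cases} D_1^{-1}\Psi^{(m,n)}(z)F_\infty^{(m)}(z)^{-1}D_1 & z\in D_+^{(m)}, \\ D_1^{-1}\Psi^{(m,n)}(z)F_0^{(m)}(z)D_2 & z\in D_-^{(m)}; \end{cases}$$ (b) if $n<0$, RHP II and RHP III have no solution; (c) if $n=0$, RHP III is solvable, with solution $Y^{(m,0)}(z)=\begin{pmatrix}1&-\mathcal C^{(m)}[w(\cdot,t_m)](z)\\ 0&1\end{pmatrix}$; (d)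 if $n>0$, RHP III is solvable if and only if the Hankel determinant $\Delta_n(t_m)=\det(\mu_{i+j})_{0\le i,j\le n-1}$ is nonzero, in which case $$Y^{(m,n)}(z)=\frac1{\Delta_n(t_m)}\begin{pmatrix} p_n(z;t_m) & -\mathcal C^{(m)}[p_n(\cdot;t_m)w(\cdot,t_m)](z) \\ p_{n-1}(z;t_m) & -\mathcal C^{(m)}[p_{n-1}(\cdot;t_m)w(\cdot,t_m)](z) \end{pmatrix},$$ where the polynomials $p_l$ satisfy $\frac1{2\pi i}\oint_{\gamma^{(m)}}p_l(z;t_m)p_n(z;t_m)w(z,t_m)\,dz=\Delta_n(t_m)\Delta_{n+1}(t_m)\delta_{l,n}$ for $l,n\in\mathbb N$.
   Context: **Notation.** $(z;q)_\infty=\prod_{k\ge0}(1-q^kz)$, $(z_1,\dots,z_n;q)_\infty=\prod_j(z_j;q)_\infty$, $\theta_q(z)=(z;q)_\infty(q/z;q)_\infty$, $\theta_q(z_1,\dots,z_n)=\prod_j\theta_q(z_j)$, $\sigma_3=\mathrm{diag}(1,-1)$, $q^{\mathbb Z}=\{q^n:n\in\mathbb Z\}$, $\mathbb N=\{0,1,2,\dots\}$. **Non-resonance conditions.** $\kappa_0^2,\kappa_t^2,\kappa_1^2,\kappa_\infty^2\notin q^{\mathbb Z}$ and $(\kappa_t\kappa_1)^{\pm1},(\kappa_t/\kappa_1)^{\pm1}\notin t_0q^{\mathbb Z}$. **Connection matrices.** $\mathfrak C(\kappa,t_0)$ is the set of $2\times2$ matrix functions $C(z)$ analytic on $\mathbb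 C^*$ with $C(qz)=t_0z^{-2}\kappa_0^{\sigma_3}C(z)\kappa_\infty^{-\sigma_3}$ and $\det C(z)=c'\,\theta_q(\kappa_tz/t_0,\kappa_t^{-1}z/t_0,\kappa_1z,\kappa_1^{-1}z)$ for some $c'\in\mathbb C^*$. **Admissible curves.** A family $(\gamma^{(m)})_{m\in\mathbb Z}$ of positively oriented Jordan curves in $\mathbb C^*$, with $D_-^{(m)}$ the inside and $D_+^{(m)}$ the outside of $\gamma^{(m)}$, is admissible if for all $m$: $q^kx\in D_-^{(m)}$ for every integer $k>0$ and $q^kx\in D_+^{(m)}$ for every integer $k\le0$, for each $x\in\{\kappa_tt_m,\kappa_t^{-1}t_m,\kappa_1,\kappa_1^{-1}\}$; and $D_-^{(m+1)}\subseteq D_-^{(m)}$. **RHP II.** For $m,n\in\mathbb Z$ find $\Psi^{(m,n)}(z)$, analytic on $\mathbb C\setminus\gamma^{(m)}$, with continuous boundary values $\Psi_\pm^{(m,n)}$ on $\gamma^{(m)}$ from $D_\pm^{(m)}$ satisfying $\Psi_+^{(m,n)}(z)=\Psi_-^{(m,n)}(z)z^mC(z)$, and $\Psi^{(m,n)}(z)=(I+\mathcal O(z^{-1}))z^{n\sigma_3}$ as $z\to\infty$. Solutions are unique when they exist. **RHP III.** For $m,n\in\mathbb Z$ find $Y^{(m,n)}(z)$, analytic on $\mathbb C\setminus\gamma^{(m)}$, with continuous boundary values from $D_\pm^{(m)}$ satisfying $Y_+^{(m,n)}(z)=Y_-^{(m,n)}(z)\begin{pmatrix}1&w(z,t_m)\\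 0&1\end{pmatrix}$ on $\gamma^{(m)}$, and $Y^{(m,n)}(z)=(I+\mathcal O(z^{-1}))z^{n\sigma_3}$ as $z\to\infty$, where $$w(z,t)=\frac{c\,\theta_q\big(\frac z{\nu t},\frac{z\nu}{\kappa_0\kappa_\infty}\big)}{\big(\frac z{\kappa_tt},\frac z{\kappa_1};q\big)_\infty\big(\frac{qt}{\kappa_tz},\frac q{\kappa_1z};q\big)_\infty}.$$ **Transformation matrices.** $F_\infty^{(m)}(z)=\mathrm{diag}\big((\tfrac{q\kappa_tt_m}z,\tfrac{q\kappa_1}z;q)_\infty,(\tfrac{qt_m}{\kappa_tz},\tfrac q{\kappa_1z};q)_\infty\big)$, $F_0^{(m)}(z)=\mathrm{diag}\big((\tfrac z{\kappa_tt_m},\tfrac z{\kappa_1};q)_\infty,(\tfrac{z\kappa_t}{t_m},z\kappa_1;q)_\infty\big)$, $D_1=\mathrm{diag}(\nu^m,\kappa_t^m)$, $D_2=(-1)^mq^{m(m+1)/2}t_0^m\,\mathrm{diag}(\nu^m\kappa_t^m,1)$. **Moments, polynomials, Cauchy operator.** $\mu_k=\frac1{2\pi i}\oint_{\gamma^{(m)}}z^kw(z,t_m)\,dz$; $\Delta_n(t_m)=\det(\mu_{i+j})_{i,j=0}^{n-1}$ ($\Delta_0=1$); $p_n(z;t_m)$ is the determinant of the $(n+1)\times(n+1)$ matrix whose first $n$ rows are $(\mu_i,\mu_{i+1},\dots,\mu_{i+n})$, $i=0,\dots,n-1$, and whose last row is $(1,z,\dots,z^n)$ ($p_0=1$). $\mathcal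 C^{(m)}[h](z)=\frac1{2\pi i}\oint_{\gamma^{(m)}}\frac{h(x)}{x-z}dx$ for $h\in L^2(\gamma^{(m)})$. *)

(* Defs.v *)
From HB Require Import structures.
From mathcomp Require Import all_boot all_order all_algebra.
From mathcomp Require Import complex.
From mathcomp Require Import all_classical all_reals all_analysis.

Set Implicit Arguments.
Unset Strict Implicit.
Unset Printing Implicit Defensive.

Import Order.TTheory GRing.Theory Num.Theory.
Import numFieldNormedType.Exports.

Local Open Scope classical_set_scope.
Local Open Scope ring_scope.
Local Open Scope complex_scope.

(* Naming R[i] as a numClosedFieldType makes the norm topology of numeric
   fields (limits, derivatives, bounded sets) available on it. The norm `|z|
   is itself an element of C, and a%:C is the real number a seen in C. *)
Definition Cplx (R : realType) : numClosedFieldType := R[i].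

Section Definitions.
Context {R : realType}.
Local Notation C := (Cplx R).
Local Notation M2 := ('M[C]_2).

Definition qpoch (q z : C) : C := lim (\prod_(k < n) (1 - q ^+ k * z) @[n --> \oo]).

Definition qpochs (q : C) (s : seq C) : C := \prod_(z <- s) qpoch q z.

Definition theta (q z : C) : C := qpoch q z * qpoch q (q / z).

Definition thetas (q : C) (s : seq C) : C := \prod_(z <- s) theta q z.

Definition qpowers (q : C) : set C := [set x | exists n : int, x = q ^ n].

Definition mat2 (a b c d : C) : M2 :=
  \matrix_(i < 2, j < 2) nth 0 (nth [::] [:: [:: a; b]; [:: c; d]] i) j.

Definition diag2 (a d : C) : M2 := mat2 a 0 0 d.

(* z^(n sigma_3) *)
Definition sigma3_exp (z : C) (n : int) : M2 := diag2 (z ^ n) (z ^ (- n)).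

(* f is complex differentiable at every point of D; D is open in all uses. *)
Definition holomorphic_on (D : set C) (f : C -> C) : Prop :=
  forall z, D z -> derivable f z 1.

Definition mx_holomorphic_on (D : set C) (F : C -> M2) : Prop :=
  forall i j, holomorphic_on D (fun z => F z i j).

(** Closed curves, parametrised by [0, 1] *)

Definition trace (g : R -> C) : set C := g @` `[0, 1].

Definition jordan_curve (g : R -> C) : Prop :=
  [/\ {within `[0, 1], continuous g}, g 0 = g 1 & {in `[0, 1[ &, injective g}].

Definition rectifiable (g : R -> C) : Prop :=
  bounded_variation 0 1 (fun t => complex.Re (g t)) /\
  bounded_variation 0 1 (fun t => complex.Im (g t)).

(* The contour integral of f along g is the Riemann-Stieltjes integral of
   f (g t) d(g t) over [0, 1]. A tagged partition is a pair (s, tau) where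
   0 :: s lists the subdivision points (so s ends with 1) and tau k is the tag
   of the k-th subinterval; the limit is taken as the mesh tends to 0. *)
Definition stieltjes_sum (g : R -> C) (f : C -> C) (P : seq R * (nat -> R)) : C :=
  \sum_(k < size P.1) f (g (P.2 k)) * (g P.1`_k - g (0 :: P.1)`_k).

Definition tagged_partition (P : seq R * (nat -> R)) : Prop :=
  itv_partition 0 1 P.1 /\
  forall k, (k < size P.1)%N -> (0 :: P.1)`_k <= P.2 k <= P.1`_k.

Definition mesh_to_0 : set_system (seq R * (nat -> R)) :=
  filter_from [set d : R | 0 < d]
    (fun d => [set P | tagged_partition P /\
       forall k, (k < size P.1)%N -> P.1`_k - (0 :: P.1)`_k < d]).

Definition contour_integral (g : R -> C) (f : C -> C) : C :=
  lim (stieltjes_sum g f @ mesh_to_0).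

(* (1 / (2 pi i)) times the contour integral *)
Definition ointegral (g : R -> C) (f : C -> C) : C :=
  ((2 * pi)%:C * 'i%C)^-1 * contour_integral g f.

(* D_- and D_+ : the unions of the bounded, respectively unbounded, connected
   components of the complement of the curve. *)
Definition inside (g : R -> C) : set C :=
  [set z | ~ trace g z /\ bounded_set (connected_component (~` trace g) z)].

Definition outside (g : R -> C) : set C :=
  [set z | ~ trace g z /\ ~ bounded_set (connected_component (~` trace g) z)].

Definition winding_number (g : R -> C) (z : C) : C :=
  ointegral g (fun x => (x - z)^-1).

Definition positively_oriented (g : R -> C) : Prop :=
  forall z, inside g z -> winding_number g z = 1.

Definition admissible (q kt k1 t0 : C) (gamma : int -> R -> C) : Prop :=
  forall m : int,
  [/\ [/\ jordan_curve (gamma m), rectifiable (gamma m),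
          positively_oriented (gamma m) & ~ trace (gamma m) 0],
      (forall x, x \in [:: kt * (q ^ m * t0); kt^-1 * (q ^ m * t0); k1; k1^-1] ->
         (forall k : int, 0 < k -> inside (gamma m) (q ^ k * x)) /\
         (forall k : int, k <= 0 -> outside (gamma m) (q ^ k * x)))
    & inside (gamma (m + 1)) `<=` inside (gamma m)].

(** Connection matrices and Riemann-Hilbert problems *)

Definition connection_matrices (q k0 kt k1 kinf t0 : C) : set (C -> M2) :=
  [set A : C -> M2 |
   [/\ mx_holomorphic_on [set z | z != 0] A,
       (forall z, z != 0 ->
          A (q * z) =
          (t0 * z ^- 2) *: (sigma3_exp k0 1 *m A z *m sigma3_exp kinf (- 1)))
     & exists2 c' : C, c' != 0 & forall z, z != 0 ->
          \det (A z) =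
          c' * thetas q [:: kt * z / t0; kt^-1 * z / t0; k1 * z; k1^-1 * z]]].

Definition nonresonant (q k0 kt k1 kinf t0 : C) : Prop :=
  (forall x, x \in [:: k0; kt; k1; kinf] -> ~ qpowers q (x ^+ 2)) /\
  (forall x, x \in [:: kt * k1; (kt * k1)^-1; kt / k1; (kt / k1)^-1] ->
     ~ exists2 y, qpowers q y & x = t0 * y).

(* Yb is continuous on the curve and is the limit of Y from within D. *)
Definition boundary_values (g : R -> C) (D : set C) (Y Yb : C -> M2) : Prop :=
  forall i j,
    {within trace g, continuous (fun z => Yb z i j)} /\
    forall s, trace g s ->
      (fun z => Y z i j) @ within D (nbhs s) --> Yb s i j.

(* Y(z) = (I + O(1/z)) z^(n sigma_3) as z tends to infinity *)
Definition asymptotic_at_infinity (n : int) (Y : C -> M2) : Prop :=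
  exists (E : C -> M2) (K r : R), forall z : C, r%:C < `|z| ->
    Y z = (1%:M + E z) *m sigma3_exp z n /\
    forall i j, `|E z i j| <= K%:C / `|z|.

Definition RHP (g : R -> C) (J : C -> M2) (n : int) (Y : C -> M2) : Prop :=
  [/\ mx_holomorphic_on (~` trace g) Y,
      (exists Yp Ym : C -> M2,
         [/\ boundary_values g (outside g) Y Yp,
             boundary_values g (inside g) Y Ym
           & forall z, trace g z -> Yp z = Ym z *m J z])
    & asymptotic_at_infinity n Y].

Definition RHP_II (g : R -> C) (A : C -> M2) (m n : int) : (C -> M2) -> Prop :=
  RHP g (fun z => z ^ m *: A z) n.

Definition RHP_III (g : R -> C) (w : C -> C) (n : int) : (C -> M2) -> Prop :=
  RHP g (fun z => mat2 1 (w z) 0 1) n.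

(* Y0 solves the problem P, and any other solution agrees with Y0 off the
   curve (values on the curve itself are immaterial). *)
Definition is_the_solution (g : R -> C) (P : (C -> M2) -> Prop) (Y0 : C -> M2) :
    Prop :=
  P Y0 /\ forall Y, P Y -> forall z, ~ trace g z -> Y z = Y0 z.

(** The reducible case *)

Definition reducible_connection (q k0 kt k1 kinf t0 c nu : C) (z : C) : M2 :=
  mat2 (thetas q [:: z / (kt * t0); z / k1])
       (c * thetas q [:: z / (nu * t0); z * nu / (k0 * kinf)])
       0
       (thetas q [:: z * kt / t0; z * k1]).

Definition weight (q k0 kt k1 kinf c nu : C) (t z : C) : C :=
  c * thetas q [:: z / (nu * t); z * nu / (k0 * kinf)] /
  (qpochs q [:: z / (kt * t); z / k1] *
   qpochs q [:: q * t / (kt * z); q / (k1 * z)]).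

Definition Finf (q kt k1 : C) (t z : C) : M2 :=
  diag2 (qpochs q [:: q * kt * t / z; q * k1 / z])
        (qpochs q [:: q * t / (kt * z); q / (k1 * z)]).

Definition F0 (q kt k1 : C) (t z : C) : M2 :=
  diag2 (qpochs q [:: z / (kt * t); z / k1])
        (qpochs q [:: z * kt / t; z * k1]).

Definition D1 (kt nu : C) (m : int) : M2 := diag2 (nu ^ m) (kt ^ m).

(* The integer m (m + 1) is even, so the division by 2 is exact. *)
Definition D2 (q kt t0 nu : C) (m : int) : M2 :=
  ((-1) ^ m * q ^ (m * (m + 1) %/ 2)%Z * t0 ^ m) *:
    diag2 (nu ^ m * kt ^ m) 1.

Definition moment (g : R -> C) (w : C -> C) (k : nat) : C :=
  ointegral g (fun z => z ^+ k * w z).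

Definition hankel_det (g : R -> C) (w : C -> C) (n : nat) : C :=
  \det (\matrix_(i < n, j < n) moment g w (i + j)).

Definition orth_poly (g : R -> C) (w : C -> C) (n : nat) (z : C) : C :=
  \det (\matrix_(i < n.+1, j < n.+1)
          if (i < n)%N then moment g w (i + j) else z ^+ j).

Definition cauchy_op (g : R -> C) (h : C -> C) (z : C) : C :=
  ointegral g (fun x => h x / (x - z)).

End Definitions.

(* Main.v *)
Require Import Defs.
From HB Require Import structures.
From mathcomp Require Import all_boot all_order all_algebra.
From mathcomp Require Import complex ring lra zify.
From mathcomp Require Import all_classical all_reals all_analysis.

Set Implicit Arguments.
Unset Strict Implicit.
Unset Printing Implicit Defensive.

Import Order.TTheory GRing.Theory Num.Theory.
Import numFieldNormedType.Exports.

Local Open Scope classical_set_scope.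
Local Open Scope ring_scope.
Local Open Scope complex_scope.

(** The q-Pochhammer factors whose zeros lie outside (inside) the curve split
    each theta function of the connection matrix, so conjugating by F_0 inside
    and F_infty outside turns the jump z^m C(z) into a unipotent one whose
    entry is w(z, t_m); the factors D_1, D_2 absorb the constants coming from
    the quasi-periodicity of theta under z -> q^m z.

    The rest rests on removability of rectifiable curves: a function that is
    continuous on C and holomorphic off such a curve has vanishing integrals
    over squares, and if it tends to 0 at infinity it is 0. Applied to the
    determinant u v' - v u' of two rows of solutions, which has no jump, this
    gives uniqueness and, for n < 0, non-existence. A polynomial p yields the
    row (p, - C[p w]) with the right jump, and its second entry is O(z^(-n-1))
    exactly when p is orthogonal to 1, ..., z^(n-1). Hence p_n and p_(n-1) give
    the two rows when the Hankel determinant is nonzero, while a kernel vector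
    of a singular Hankel matrix gives a row that decays too fast to coexist
    with a solution. *)

(** Two obstacles shape the analysis. The curves are merely rectifiable, so metric facts about them
    are drawn from one inequality, cabs (g t - g s) <= V t - V s with V a real function
    ([dominated]): it yields existence and bounds of Stieltjes integrals, and V, used as a
    coordinate on the trace, bounds the number of grid squares that meet the trace. Secondly,
    boundary values of a Cauchy transform require difference quotients of the density h that
    converge jointly in both points, whereas complex differentiability at a point controls only
    quotients based at that point. Strict differentiability ([sdiff setT]) is therefore carried
    through sums, products, inverses and compositions, starting from explicit difference quotients
    of the finite q-products. The weight is then strictly differentiable along the trace, and its
    Cauchy transform is a function continuous at the trace plus h times the winding number, which is
    0 outside and 1 inside. *)

Section Modulus.
Context {R : realType}.
Local Notation C := (Cplx R).
Implicit Types x y z : C.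

(** The norm of [Cplx R] takes values in C, whose order is partial; this real-valued modulus makes
    linear real arithmetic available. *)
Definition cabs z : R := ComplexField.Normc.normc z.

Lemma cabsE z : `|z| = (cabs z)%:C.
Proof. by []. Qed.

Lemma cabs_ge0 z : 0 <= cabs z.
Proof. by rewrite -lecR -cabsE normr_ge0. Qed.

Lemma cabsM x y : cabs (x * y) = cabs x * cabs y.
Proof. exact: ComplexField.Normc.normcM. Qed.

Lemma cabsD x y : cabs (x + y) <= cabs x + cabs y.
Proof. by rewrite -lecR rmorphD -!cabsE ler_normD. Qed.

Lemma cabs0 : cabs 0 = 0.
Proof. by apply: complexI; rewrite -cabsE normr0. Qed.

Lemma cabs1 : cabs 1 = 1.
Proof. by apply: complexI; rewrite -cabsE normr1. Qed.

Lemma cabsN x : cabs (- x) = cabs x.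
Proof. by apply: complexI; rewrite -!cabsE normrN. Qed.

Lemma cabs_distC x y : cabs (x - y) = cabs (y - x).
Proof. by rewrite -cabsN opprB. Qed.

Lemma cabsB x y : cabs (x - y) <= cabs x + cabs y.
Proof. by rewrite -(cabsN y) cabsD. Qed.

Lemma cabs_eq0 x : (cabs x == 0) = (x == 0).
Proof. by rewrite -[RHS]normr_eq0 cabsE -(inj_eq (@complexI _)). Qed.

Lemma cabs_gt0 x : (0 < cabs x) = (x != 0).
Proof. by rewrite lt_neqAle cabs_ge0 andbT eq_sym cabs_eq0. Qed.

Lemma cabsV x : cabs x^-1 = (cabs x)^-1.
Proof. exact: ComplexField.Normc.normcV. Qed.

Lemma cabsX x n : cabs (x ^+ n) = cabs x ^+ n.
Proof. by elim: n => [|n IH]; rewrite ?expr0 ?cabs1 // !exprS cabsM IH. Qed.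

Lemma cabs_exprz x (n : int) : cabs (x ^ n) = cabs x ^ n.
Proof. by case: n => n; rewrite ?NegzE -?exprnN ?cabsV ?cabsX // -exprnP cabsX. Qed.

Lemma cabs_real (a : R) : cabs a%:C = `|a|.
Proof.
by apply: complexI; rewrite -cabsE normc_def /= expr0n addr0 sqrtr_sqr.
Qed.

Lemma cabs_i : cabs 'i = 1.
Proof.
by apply: complexI; rewrite -cabsE normc_def /= expr0n add0r expr1n sqrtr1.
Qed.

Lemma cabs_sum I (r : seq I) (P : pred I) (F : I -> C) :
  cabs (\sum_(i <- r | P i) F i) <= \sum_(i <- r | P i) cabs (F i).
Proof.
elim/big_ind2: _ => // [|x y a b h1 h2]; first by rewrite cabs0.
by apply: le_trans (cabsD _ _) _; rewrite lerD.
Qed.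

Lemma cabs_rev x y : cabs x - cabs y <= cabs (x - y).
Proof. by rewrite lerBlDr (le_trans _ (cabsD _ _)) // subrK. Qed.

Lemma cabs_tri x y z : cabs (x - z) <= cabs (x - y) + cabs (y - z).
Proof. by rewrite (le_trans _ (cabsD _ _)) // addrA subrK. Qed.

Lemma Re_le_cabs z : `|complex.Re z| <= cabs z.
Proof.
rewrite -lecR -cabsE normc_def lecR -sqrtr_sqr ler_wsqrtr // lerDl.
exact: sqr_ge0.
Qed.

Lemma Im_le_cabs z : `|complex.Im z| <= cabs z.
Proof.
rewrite -lecR -cabsE normc_def lecR -sqrtr_sqr ler_wsqrtr // lerDr.
exact: sqr_ge0.
Qed.

Lemma cabs_le_ReIm z : cabs z <= `|complex.Re z| + `|complex.Im z|.
Proof.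
rewrite {1}[z]complexE (le_trans (cabsD _ _)) // cabsM cabs_i mul1r.
by rewrite !cabs_real.
Qed.

Lemma ReB x y : complex.Re (x - y) = complex.Re x - complex.Re y.
Proof. by case: x y => [a b] [a' b']. Qed.

Lemma ImB x y : complex.Im (x - y) = complex.Im x - complex.Im y.
Proof. by case: x y => [a b] [a' b']. Qed.

(** * Epsilon-delta forms of limits, continuity and differentiability in C *)

Lemma nbhsCP (s : C) (P : set C) :
  nbhs s P <-> exists2 d : R, 0 < d & forall x, cabs (x - s) < d -> P x.
Proof.
split.
  move=> /nbhs_ballP[/= e e0 eP].
  have er : (complex.Re e)%:C = e by rewrite RRe_real // gtr0_real.
  exists (complex.Re e); first by rewrite -ltcR er.
  move=> x xs; apply: eP; rewrite -ball_normE /ball_ /= distrC cabsE -er ltcR.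
  by [].
move=> [d d0 dP]; apply/nbhs_ballP; exists d%:C => /=; first by rewrite ltcR.
by move=> x; rewrite -ball_normE /ball_ /= distrC cabsE ltcR => /dP.
Qed.

Lemma cvgCP T (F : set_system T) {FF : Filter F} (f : T -> C) (l : C) :
  f @ F --> l <->
  forall e : R, 0 < e -> \forall x \near F, cabs (f x - l) < e.
Proof.
split=> [fl e e0|fl].
  have /fl : nbhs l [set y : C | cabs (y - l) < e] by apply/nbhsCP; exists e.
  by [].
by move=> A /nbhsCP[d d0 dA]; near=> x; apply: dA; near: x; apply: fl.
Unshelve. all: by end_near.
Qed.

Lemma continuousCP (f : C -> C) s :
  {for s, continuous f} <->
  forall e : R, 0 < e ->
    exists2 d : R, 0 < d & forall x, cabs (x - s) < d -> cabs (f x - f s) < e.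
Proof.
split=> [/cvgCP fs e /fs /nbhsCP //|fs].
by apply/(cvgCP (F := nbhs s)) => e /fs h; apply/nbhsCP.
Qed.

Lemma openCP (P : set C) :
  (forall x, P x -> exists2 d : R, 0 < d & forall y, cabs (y - x) < d -> P y) <->
  open P.
Proof.
split=> [h|oP x Px].
  by rewrite openE => x /h /nbhsCP.
by apply/nbhsCP; move: oP; rewrite openE; apply.
Qed.

(** The inequality is multiplied out, so that x = z is allowed and the estimate can be compared with
    the one of strict differentiability. *)
Lemma derivableCP (f : C -> C) (z : C) :
  derivable f z 1 <->
  exists d : C, forall e : R, 0 < e -> exists2 r : R, 0 < r &
    forall x, cabs (x - z) < r -> cabs (f x - f z - d * (x - z)) <= e * cabs (x - z).
Proof.
split.
  move=> /cvg_ex[/= d /cvgCP H]; exists d => e /H.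
  rewrite nearE /= => /nbhsCP[r r0 rP]; exists r => // x xr.
  have [->|xz] := eqVneq x z; first by rewrite !subrr mulr0 subrr !cabs0 mulr0.
  have := rP (x - z); rewrite subr0 => /(_ xr); rewrite subr_eq0 => /(_ xz).
  rewrite /GRing.scale /= mulr1 subrK => /ltW h.
  have -> : f x - f z - d * (x - z) =
      ((x - z)^-1 * (f x - f z) - d) * (x - z).
    by rewrite mulrBl mulrAC mulVf ?subr_eq0 // mul1r.
  by rewrite cabsM ler_wpM2r // cabs_ge0.
move=> [d H]; apply/cvg_ex; exists d; apply/cvgCP => e e0.
have e20 : 0 < e / 2 by rewrite divr_gt0.
have [r r0 rP] := H _ e20.
rewrite nearE /=; apply/nbhsCP; exists r => // x; rewrite subr0 => xr x0.
rewrite /GRing.scale /= mulr1.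
have := rP (x + z); rewrite addrK => /(_ xr) h.
have -> : x^-1 * (f (x + z) - f z) - d = x^-1 * (f (x + z) - f z - d * x).
  by rewrite [in RHS]mulrBr [x^-1 * (d * x)]mulrCA mulVf // mulr1.
rewrite cabsM cabsV (@le_lt_trans _ _ (e / 2)) //.
  by rewrite mulrC ler_pdivrMr // cabs_gt0.
lra.
Qed.

(** Completeness is inherited from R: real and imaginary parts are 1-Lipschitz, so both are Cauchy
    along F. *)
Lemma cvgC_cauchy T (F : set_system T) {FF : ProperFilter F} (f : T -> C) :
  (forall e : R, 0 < e -> exists2 A, F A &
     forall x y : T, A x -> A y -> cabs (f x - f y) < e) ->
  exists l : C, f @ F --> l.
Proof.
move=> H.
have aux (p : C -> R) : (forall x y, `|p x - p y| <= cabs (x - y)) ->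
    exists l : R, (p \o f) @ F --> l.
  move=> pl; apply/cvg_ex; apply/cauchy_cvgP; apply/cauchy_exP => e /H[A FA Ae].
  have [x Ax] := filter_ex FA; exists (p (f x)).
  change (F [set y | ball (p (f x)) e (p (f y))]).
  apply: (filterS _ FA) => y Ay /=; rewrite -ball_normE /ball_ /=.
  by rewrite (le_lt_trans (pl _ _)) // Ae.
have [a /cvgrPdist_lt fa] : exists l : R, (@complex.Re R \o f) @ F --> l.
  by apply: aux => x y; rewrite -ReB Re_le_cabs.
have [b /cvgrPdist_lt fb] : exists l : R, (@complex.Im R \o f) @ F --> l.
  by apply: aux => x y; rewrite -ImB Im_le_cabs.
exists (a +i* b)%C; apply/cvgCP => e e0.
have e20 : 0 < e / 2 by rewrite divr_gt0.
near=> x.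
rewrite (le_lt_trans (cabs_le_ReIm _)) // ReB ImB /= (splitr e).
rewrite ltrD // distrC; near: x; [exact: fa|exact: fb].
Unshelve. all: by end_near.
Qed.

Lemma cvgC_lim T (F : set_system T) {FF : ProperFilter F} (f : T -> C) (l : C) :
  f @ F --> l -> lim (f @ F) = l.
Proof. exact/cvg_lim. Qed.

Lemma cvgC_lin T (F : set_system T) {FF : Filter F} (f h : T -> C) (a l l' : C) :
  f @ F --> l -> h @ F --> l' -> (fun t => a * f t + h t) @ F --> a * l + l'.
Proof.
move=> /cvgCP fl /cvgCP hl; apply/cvgCP => e e0.
have k0 : 0 < cabs a + 1 by rewrite ltr_wpDl // cabs_ge0.
apply: filterS2 (fl _ (divr_gt0 e0 (mulr_gt0 (ltr0n R 2) k0))) (hl _ (divr_gt0 e0 (ltr0n R 2))) => t.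
rewrite invfM mulrA ltr_pdivlMr // => h1 h2.
have -> : a * f t + h t - (a * l + l') = a * (f t - l) + (h t - l') by ring.
rewrite (le_lt_trans (cabsD _ _)) // (splitr e) ltr_leD // ?(ltW h2) //.
rewrite cabsM (le_lt_trans _ h1) // mulrC ler_wpM2l ?cabs_ge0 //; lra.
Qed.

Lemma cvgC_add T (F : set_system T) {FF : Filter F} (f h : T -> C) (l l' : C) :
  f @ F --> l -> h @ F --> l' -> (fun t => f t + h t) @ F --> l + l'.
Proof.
move=> fl hl; rewrite -[l]mul1r.
rewrite (_ : (fun t => f t + h t) = (fun t => 1 * f t + h t)); last first.
  by apply/funext => t; rewrite mul1r.
exact: cvgC_lin.
Qed.

Lemma cvgC_scale T (F : set_system T) {FF : Filter F} (f : T -> C) (a l : C) :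
  f @ F --> l -> (fun t => a * f t) @ F --> a * l.
Proof.
move=> fl; rewrite -[a * l]addr0.
rewrite (_ : (fun t => a * f t) = (fun t => a * f t + 0)); last first.
  by apply/funext => t; rewrite addr0.
have c0 : (fun _ : T => (0 : C)) @ F --> (0 : C).
  by apply/cvgCP => e e0; apply: (filterS _ filterT) => t _; rewrite subrr cabs0.
exact: (cvgC_lin fl c0).
Qed.

Lemma cvgC_mul T (F : set_system T) {FF : Filter F} (f h : T -> C) (l l' : C) :
  f @ F --> l -> h @ F --> l' -> (fun t => f t * h t) @ F --> l * l'.
Proof.
move=> /cvgCP fl /cvgCP hl; apply/cvgCP => e e0.
have k0 : 0 < cabs l + 1 by rewrite ltr_wpDl // cabs_ge0.
have k1 : 0 < cabs l' + 1 by rewrite ltr_wpDl // cabs_ge0.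
have e20 : 0 < e / 2 by lra.
apply: filterS3 (fl _ (divr_gt0 e20 k1)) (hl _ (divr_gt0 e20 k0)) (fl _ ltr01) => t.
rewrite (ltr_pdivlMr _ _ k0) (ltr_pdivlMr _ _ k1) => h1 h2 h3.
have -> : f t * h t - l * l' = f t * (h t - l') + l' * (f t - l) by ring.
rewrite (le_lt_trans (cabsD _ _)) // (splitr e) !cabsM ler_ltD //.
  apply/ltW/le_lt_trans/h2; rewrite mulrC ler_wpM2l ?cabs_ge0 //.
  have := cabs_rev (f t) l; lra.
apply/le_lt_trans/h1; rewrite mulrC ler_wpM2l ?cabs_ge0 //; lra.
Qed.

Lemma cabs_le_lim T (F : set_system T) {FF : ProperFilter F} (f : T -> C) (l : C)
    (K : R) :
  f @ F --> l -> (\forall x \near F, cabs (f x) <= K) -> cabs l <= K.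
Proof.
move=> /cvgCP fl fK; apply/ler_addgt0Pr => e /fl he.
have [x [xK xe]] := filter_ex (filterI fK he).
rewrite -[l](subrK (f x)) (le_trans (cabsD _ _)) // addrC lerD // cabs_distC.
exact: ltW.
Qed.

(** Compactness of [0, 1] as a principle about scales: what holds for small d locally uniformly in t
    holds for small d uniformly in t. With P left abstract it produces moduli of continuity,
    positive distances and upper bounds. *)
Lemma tube01 (P : R -> R -> Prop) :
  (forall t, t \in `[0, 1] -> exists2 r : R, 0 < r & forall d t', 0 < d < r ->
     t' \in `[0, 1] -> `|t' - t| < r -> P d t') ->
  exists2 r : R, 0 < r & forall d t, 0 < d < r -> t \in `[0, 1] -> P d t.
Proof.
move=> H.
have /compact_near_coveringP := @segment_compact R 0 1.
move=> /(_ R (0^'+) (fun d t => t \in `[0, 1] -> P d t)) [].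
  move=> t t01; have [r r0 rP] := H t t01.
  exists ([set t' | `|t' - t| < r], [set d | 0 < d < r]) => /=.
    split; last first.
      by exists r => //= d; rewrite /ball_ /= sub0r normrN => dr d0; rewrite d0 (le_lt_trans (ler_norm d)).
    by apply/nbhs_ballP; exists r => // y; rewrite -ball_normE /ball_ /= distrC.
  by move=> [t' d] /= [h1 h2] h3; exact: rP.
move=> r r0 rP; exists r => // d t /andP[d0 dr] t01.
apply: (rP d) => //=; first by rewrite sub0r normrN gtr0_norm.
Qed.

Lemma within01P (F : R -> C) :
  {within `[0, 1], continuous F} <->
  forall t, t \in `[0, 1] -> forall e : R, 0 < e -> exists2 r : R, 0 < r &
    forall s, s \in `[0, 1] -> `|s - t| < r -> cabs (F s - F t) < e.
Proof.
split=> [/subspace_continuousP Fc t t01 e e0|H].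
  have /cvgCP/(_ _ e0)[r /= r0 rP] := Fc t t01.
  by exists r => // s s01 st; apply: rP => //; rewrite /ball_ /= distrC.
apply/subspace_continuousP => t t01; apply/cvgCP => e /(H t t01)[r r0 rP].
exists r => //= s; rewrite /ball_ /= distrC => st s01; exact: rP.
Qed.

Lemma withinCP (A : set C) (F : C -> C) :
  {within A, continuous F} <->
  forall t, A t -> forall e : R, 0 < e -> exists2 r : R, 0 < r &
    forall s, A s -> cabs (s - t) < r -> cabs (F s - F t) < e.
Proof.
split=> [/subspace_continuousP Fc t t01 e e0|H].
  have /cvgCP/(_ _ e0) := Fc t t01.
  rewrite nearE /= => /nbhsCP[r r0 rP].
  by exists r => // s s01 st; apply: rP.
apply/subspace_continuousP => t t01; apply/cvgCP => e /(H t t01)[r r0 rP].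
by rewrite nearE /=; apply/nbhsCP; exists r => // s st As; exact: rP.
Qed.

Lemma cvg_withinCP (A : set C) (F : C -> C) (s l : C) :
  F @ within A (nbhs s) --> l <->
  forall e : R, 0 < e -> exists2 r : R, 0 < r &
    forall z, A z -> cabs (z - s) < r -> cabs (F z - l) < e.
Proof.
split=> [/cvgCP Fc e e0|H].
  have := Fc e e0; rewrite nearE /= => /nbhsCP[r r0 rP].
  by exists r => // z Az zs; apply: rP.
apply/cvgCP => e /H[r r0 rP].
by rewrite nearE /=; apply/nbhsCP; exists r => // z zs Az; exact: rP.
Qed.

Lemma unif_continuous01 (F : R -> C) :
  {within `[0, 1], continuous F} ->
  forall e : R, 0 < e -> exists2 d : R, 0 < d & forall s t, s \in `[0, 1] ->
    t \in `[0, 1] -> `|s - t| < d -> cabs (F s - F t) < e.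
Proof.
move=> /within01P Fc e e0.
have e20 : 0 < e / 2 by rewrite divr_gt0.
have [r r0 rP] : exists2 r : R, 0 < r & forall d t, 0 < d < r -> t \in `[0, 1] ->
    forall s, s \in `[0, 1] -> `|s - t| < d -> cabs (F s - F t) < e.
  apply: tube01 => t t01.
  have [r r0 rP] := Fc t t01 _ e20.
  exists (r / 2); first by rewrite divr_gt0.
  move=> d t' /andP[d0 dr] t'01 t't s s01 st'.
  rewrite (le_lt_trans (cabs_tri _ (F t) _)) // (splitr e) ltrD //.
    apply: rP => //=.
    by rewrite (le_lt_trans (ler_distD t' _ _)) // [r]splitr ltrD // (lt_trans st').
  rewrite cabs_distC; apply: rP => //=; by rewrite (lt_trans t't) //; lra.
exists (r / 2); first by rewrite divr_gt0.
move=> s t s01 t01 st; apply: (rP (r / 2)) => //; lra.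
Qed.
End Modulus.

(** * Riemann-Stieltjes integrals along curves of bounded variation *)

Section Stieltjes.
Context {R : realType}.
Local Notation C := (Cplx R).

Definition clamp (u v x : R) : R := Num.max u (Num.min x v).

(** The increment of h over the intersection of [u, v] and [x, y], and 0 if these do not overlap.
    Summing it over pairs of cells takes the place of a common refinement of two partitions. *)
Definition overlap (Z : zmodType) (h : R -> Z) (u v x y : R) : Z :=
  h (clamp u v y) - h (clamp u v x).

Lemma overlapC (Z : zmodType) (h : R -> Z) u v x y : u <= v -> x <= y ->
  overlap h u v x y = overlap h x y u v.
Proof.
move=> uv xy; rewrite /overlap /clamp.
have [yu|uy] := leP y u.
  have xu := le_trans xy yu; have yv := le_trans yu uv.
  have xv := le_trans xu uv.
  rewrite (min_idPl yv) (min_idPl xv) (minC v) (min_idPl yv).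
  by rewrite (max_idPl yu) (max_idPl xu) !subrr.
have [vx|xv] := leP v x.
  have vy := le_trans vx xy; have ux := le_trans uv vx.
  by rewrite (min_idPr vy) (min_idPl vy) (max_idPl vx) (max_idPl ux) !subrr.
congr (h _ - h _); last exact: maxC.
rewrite [LHS](max_idPr _) ?[RHS](max_idPr _) 1?minC //.
  by rewrite le_min xy ltW.
by rewrite le_min uv ltW.
Qed.

Lemma overlap0 (Z : zmodType) (h : R -> Z) u v x y : u <= v -> x <= y ->
  (y <= u) || (v <= x) -> overlap h u v x y = 0.
Proof.
move=> uv xy /orP[yu|vx]; rewrite /overlap /clamp.
  have xu := le_trans xy yu; have yv := le_trans yu uv.
  have xv := le_trans xu uv.
  by rewrite !(min_idPl _) // (max_idPl yu) (max_idPl xu) subrr.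
by rewrite (min_idPr vx) (min_idPr (le_trans vx xy)) (max_idPr uv) subrr.
Qed.

Definition subdivision n (s : nat -> R) :=
  [/\ s 0%N = 0, s n = 1 & forall k, (k < n)%N -> s k <= s k.+1].

Lemma subdivision_mono n s : subdivision n s ->
  forall j k, (j <= k <= n)%N -> s j <= s k.
Proof.
move=> [_ _ h] j k /andP[]; elim: k => [|k IH]; first by rewrite leqn0 => /eqP ->.
rewrite leq_eqVlt => /orP[/eqP -> //|jk kn].
by rewrite (le_trans (IH _ (ltnW kn))) // h.
Qed.

Lemma subdivision01 n s k : subdivision n s -> (k <= n)%N -> 0 <= s k <= 1.
Proof.
move=> sn kn; case: (sn) => s0 s1 _.
by rewrite -s0 -s1 !(subdivision_mono sn) // ?leqnn ?kn // leq0n kn.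
Qed.

Lemma sum_overlap (Z : zmodType) (h : R -> Z) n s u v : subdivision n s ->
  0 <= u -> u <= v -> v <= 1 ->
  \sum_(l < n) overlap h u v (s l) (s l.+1) = h v - h u.
Proof.
move=> [s0 s1 _] u0 uv v1.
rewrite -(big_mkord xpredT (fun l => overlap h u v (s l) (s l.+1))).
rewrite /overlap (telescope_sumr (fun l => h (clamp u v (s l)))) // s0 s1 /clamp.
rewrite (min_idPr v1) (max_idPr uv).
by rewrite (max_idPl _) // ge_min u0.
Qed.

Lemma subdivision_telescope (Z : zmodType) (h : R -> Z) n s : subdivision n s ->
  h 1 - h 0 = \sum_(k < n) (h (s k.+1) - h (s k)).
Proof.
move=> [s0 s1 _]; rewrite -(big_mkord xpredT (fun k => h (s k.+1) - h (s k))).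
by rewrite (telescope_sumr (fun k => h (s k))) // s0 s1.
Qed.

(** V stands for a total variation function; any majorant of this kind will do, and a segment takes
    V t = t * cabs d. *)
Definition dominated (g : R -> C) (V : R -> R) :=
  forall s t, 0 <= s -> s <= t -> t <= 1 -> cabs (g t - g s) <= V t - V s.

Lemma clamp_le u v x y : x <= y -> clamp u v x <= clamp u v y.
Proof.
by move=> xy; rewrite /clamp ge_max !le_max lexx /= le_min !ge_min xy lexx !orbT.
Qed.

Lemma clamp01 u v x : 0 <= u -> u <= v -> v <= 1 -> 0 <= clamp u v x <= 1.
Proof.
move=> u0 uv v1; rewrite /clamp le_max u0 /= ge_max (le_trans uv v1) /=.
by rewrite ge_min v1 orbT.
Qed.

Lemma overlap_dom g V u v x y : dominated g V -> 0 <= u -> u <= v -> v <= 1 ->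
  x <= y -> cabs (overlap g u v x y) <= overlap V u v x y.
Proof.
move=> gV u0 uv v1 xy; apply: gV; last 2 first.
- exact: clamp_le.
- by case/andP: (clamp01 y u0 uv v1).
by case/andP: (clamp01 x u0 uv v1).
Qed.

Definition tagged n (s tau : nat -> R) (d : R) :=
  forall k, (k < n)%N -> [/\ s k <= tau k, tau k <= s k.+1 & s k.+1 - s k < d].

Definition rsum (g F : R -> C) n (s tau : nat -> R) : C :=
  \sum_(k < n) F (tau k) * (g (s k.+1) - g (s k)).

(** Both sums are written over pairs of cells, one from each partition. A pair without overlap
    contributes 0; in an overlapping pair the two tags are less than d + d apart, so the values of F
    differ by at most e. The overlaps of V add up to V 1 - V 0. *)
Lemma rsum_close g V F n s tau n' s' tau' d e : dominated g V -> 0 <= e ->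
  subdivision n s -> subdivision n' s' -> tagged n s tau d -> tagged n' s' tau' d ->
  (forall x y, x \in `[0, 1] -> y \in `[0, 1] -> `|x - y| < d + d ->
     cabs (F x - F y) <= e) ->
  cabs (rsum g F n s tau - rsum g F n' s' tau') <= e * (V 1 - V 0).
Proof.
move=> gV e0 sn sn' tn tn' Fe.
have -> : rsum g F n s tau =
    \sum_(k < n) \sum_(l < n') F (tau k) * overlap g (s k) (s k.+1) (s' l) (s' l.+1).
  apply: eq_bigr => k _; rewrite -mulr_sumr; congr (_ * _).
  case: (sn) => _ _ h; rewrite (sum_overlap _ sn') ?h //.
    by case/andP: (subdivision01 sn (ltnW (ltn_ord k))).
  by case/andP: (subdivision01 sn (ltn_ord k)).
have -> : rsum g F n' s' tau' =
    \sum_(k < n) \sum_(l < n') F (tau' l) * overlap g (s k) (s k.+1) (s' l) (s' l.+1).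
  rewrite exchange_big; apply: eq_bigr => k _; rewrite -mulr_sumr; congr (_ * _).
  case: (sn') => _ _ h'; case: (sn) => _ _ h.
  under eq_bigr => l _ do rewrite overlapC ?h ?h' //.
  rewrite (sum_overlap _ sn) ?h' //.
    by case/andP: (subdivision01 sn' (ltnW (ltn_ord k))).
  by case/andP: (subdivision01 sn' (ltn_ord k)).
rewrite -sumrB.
under eq_bigr => k _ do rewrite -sumrB.
rewrite (le_trans (cabs_sum _ _ _)) //.
have -> : V 1 - V 0 =
    \sum_(k < n) \sum_(l < n') overlap V (s k) (s k.+1) (s' l) (s' l.+1).
  case: (sn) => s0 s1 h; rewrite -{1}s1 -{1}s0.
  rewrite -(telescope_sumr (fun k => V (s k)) (leq0n n)) // big_mkord.
  apply: eq_bigr => k _; rewrite (sum_overlap _ sn') ?h //.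
    by case/andP: (subdivision01 sn (ltnW (ltn_ord k))).
  by case/andP: (subdivision01 sn (ltn_ord k)).
rewrite mulr_sumr ler_sum // => k _.
rewrite (le_trans (cabs_sum _ _ _)) // mulr_sumr ler_sum // => l _.
case: (sn') => _ _ h'; case: (sn) => _ _ h.
have [a1 a2 a3] := tn k (ltn_ord k); have [b1 b2 b3] := tn' l (ltn_ord l).
have /andP[c1 c2] := subdivision01 sn (ltnW (ltn_ord k)).
have /andP[c3 c4] := subdivision01 sn (ltn_ord k).
have /andP[c5 c6] := subdivision01 sn' (ltnW (ltn_ord l)).
have /andP[c7 c8] := subdivision01 sn' (ltn_ord l).
have [/overlap0 ov|] := boolP ((s' l.+1 <= s k) || (s k.+1 <= s' l)).
  by rewrite !ov ?h ?h' // !mulr0 subrr cabs0.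
rewrite negb_or -!ltNge => /andP[d1 d2].
rewrite -mulrBl cabsM ler_pM ?cabs_ge0 //.
  apply: Fe; rewrite ?in_itv /=; last by rewrite ltr_norml; apply/andP; split; lra.
    by apply/andP; split; lra.
  by apply/andP; split; lra.
by apply: overlap_dom => //; rewrite ?h ?h'.
Qed.

Lemma rsum_bound g V F n s tau M d : dominated g V ->
  subdivision n s -> tagged n s tau d ->
  (forall x, x \in `[0, 1] -> cabs (F x) <= M) ->
  cabs (rsum g F n s tau) <= M * (V 1 - V 0).
Proof.
move=> gV sn tn FM; rewrite (le_trans (cabs_sum _ _ _)) //.
case: (sn) => _ _ h; rewrite (subdivision_telescope V sn) mulr_sumr.
apply: ler_sum => k _.
have [a1 a2 a3] := tn k (ltn_ord k).
have /andP[c1 c2] := subdivision01 sn (ltnW (ltn_ord k)).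
have /andP[c3 c4] := subdivision01 sn (ltn_ord k).
rewrite cabsM ler_pM ?cabs_ge0 //.
  by apply: FM; rewrite in_itv /=; apply/andP; split; lra.
by apply: gV; rewrite ?h.
Qed.

Lemma tagged_subdivision (P : seq R * (nat -> R)) : tagged_partition P ->
  subdivision (size P.1) (fun k => (0 :: P.1)`_k).
Proof.
case: P => s tau [/= [sp /eqP sl] _]; split => //=.
  by rewrite -[RHS]sl (last_nth 0).
by move=> k ks; move/(pathP 0): sp => /(_ k ks) /ltW.
Qed.

Lemma stieltjes_rsum (g : R -> C) f P :
  stieltjes_sum g f P = rsum g (f \o g) (size P.1) (fun k => (0 :: P.1)`_k) P.2.
Proof. by []. Qed.

(** There are n + 1 equal cells with left end points as tags. This sequence witnesses that
    [mesh_to_0] is proper, and integrals are computed along it. *)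
Definition uniform_partition (n : nat) : seq R * (nat -> R) :=
  (mkseq (fun k => k.+1%:R / n.+1%:R) n.+1, fun k => k%:R / n.+1%:R).

Lemma nth_uniform_partition n k : (k <= n.+1)%N ->
  (0 :: (uniform_partition n).1)`_k = k%:R / n.+1%:R.
Proof.
by case: k => [|k] kn; rewrite ?mul0r //= nth_mkseq.
Qed.

Lemma uniform_partitionP n (d : R) : n.+1%:R^-1 < d ->
  tagged_partition (uniform_partition n) /\
  forall k, (k < size (uniform_partition n).1)%N ->
    (uniform_partition n).1`_k - (0 :: (uniform_partition n).1)`_k < d.
Proof.
move=> nd; have n0 : 0 < n.+1%:R :> R by rewrite ltr0n.
split=> [|k]; rewrite ?size_mkseq; last first.
  move=> kn; rewrite nth_uniform_partition ?(ltnW kn) // nth_mkseq //.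
  by rewrite -mulrBl -natr1 addrC addKr mul1r.
split; last first.
  move=> k; rewrite size_mkseq => kn.
  rewrite nth_uniform_partition ?(ltnW kn) // nth_mkseq // lexx /=.
  by rewrite ler_pM2r ?invr_gt0 // ler_nat.
split.
  apply/(pathP 0) => k; rewrite size_mkseq => kn.
  rewrite nth_uniform_partition ?(ltnW kn) // nth_mkseq //.
  by rewrite ltr_pM2r ?invr_gt0 // ltr_nat.
apply/eqP; rewrite (last_nth 0) size_mkseq nth_uniform_partition //.
by rewrite divff // gt_eqF.
Qed.

Lemma ex_inv_lt (d : R) : 0 < d -> exists N, forall n, (N <= n)%N -> n.+1%:R^-1 < d.
Proof.
move=> d0; have [N] := near_infty_natSinv_lt (PosNum d0).
by move=> _ NP; exists N => n; apply: NP.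
Qed.

Global Instance mesh_to_0_filter : ProperFilter (@mesh_to_0 R).
Proof.
apply: filter_from_proper.
  apply: filter_from_filter; first by exists 1 => /=.
  move=> d d' /= d0 d'0; exists (Num.min d d') => /=; first by rewrite lt_min d0.
  by move=> P [tP mP]; split; split => // k /mP; rewrite lt_min => /andP[].
move=> d /= d0; have [N /(_ N (leqnn _)) Nd] := ex_inv_lt d0.
by exists (uniform_partition N); apply: uniform_partitionP.
Qed.

(** The convergence is recorded, not just the value: [contour_integral] is a [lim], meaningful only
    when the limit exists. *)
Definition is_int (g : R -> C) (f : C -> C) (I : C) :=
  stieltjes_sum g f @ @mesh_to_0 R --> I.

Lemma is_int_eq g f I : is_int g f I -> contour_integral g f = I.
Proof. by move=> h; apply: cvgC_lim. Qed.

Lemma near_mesh (d : R) : 0 < d ->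
  \forall P \near @mesh_to_0 R, subdivision (size P.1) (fun k => (0 :: P.1)`_k) /\
     tagged (size P.1) (fun k => (0 :: P.1)`_k) P.2 d.
Proof.
move=> d0; exists d => // P [tP mP]; split; first exact: tagged_subdivision.
by move=> k kP; case: tP => _ /(_ k kP) /andP[h1 h2]; split => //; exact: mP.
Qed.

(* Parametrisations for which continuous functions are integrable. *)
Definition good_curve (g : R -> C) :=
  {within `[0, 1], continuous g} /\ exists V, dominated g V.

Lemma is_int_ex g f : good_curve g -> {within `[0, 1], continuous (f \o g)} ->
  exists I, is_int g f I.
Proof.
move=> [_ [V gV]] fc; apply: cvgC_cauchy => e e0.
have VV : 0 <= V 1 - V 0 by rewrite (le_trans _ (gV _ _ _ _ _)) ?cabs_ge0.
(* The [+ 1] keeps the divisor positive when V has no increase. *)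
have V1 : 0 < V 1 - V 0 + 1 by lra.
have [d d0 dP] := unif_continuous01 fc (divr_gt0 e0 V1).
(* Tags of overlapping cells from two partitions differ by less than twice the mesh. *)
have d20 : 0 < d / 2 by lra.
eexists; first exact: (near_mesh d20).
move=> P P' /= [sP tP] [sP' tP']; rewrite !stieltjes_rsum.
apply: (@le_lt_trans _ _ (e / (V 1 - V 0 + 1) * (V 1 - V 0))).
  apply: (rsum_close gV (d := d / 2)) => //; first by rewrite divr_ge0 // ltW.
  by move=> x y x01 y01; rewrite -splitr => xy; apply/ltW/dP.
by rewrite mulrAC ltr_pdivrMr // ltr_pM2l //; lra.
Qed.

Lemma is_int_lin g f h I J (a : C) : is_int g f I -> is_int g h J ->
  is_int g (fun x => a * f x + h x) (a * I + J).
Proof.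
move=> fI hJ; rewrite /is_int.
have -> : stieltjes_sum g (fun x => a * f x + h x) =
    (fun P => a * stieltjes_sum g f P + stieltjes_sum g h P).
  apply/funext => P; rewrite /stieltjes_sum mulr_sumr -big_split.
  by apply: eq_bigr => k _; rewrite mulrDl mulrA.
exact: (cvgC_lin fI hJ).
Qed.

Lemma is_int_bound g V f I M : dominated g V -> is_int g f I ->
  (forall x, trace g x -> cabs (f x) <= M) -> cabs I <= M * (V 1 - V 0).
Proof.
move=> gV fI fM; apply: (cabs_le_lim fI).
apply: filterS (near_mesh ltr01) => P [sP tP].
by rewrite stieltjes_rsum; apply: (rsum_bound gV sP tP) => x x01; apply: fM; exists x.
Qed.

Lemma is_int_ext g f h I : (forall x, trace g x -> f x = h x) -> is_int g f I ->
  is_int g h I.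
Proof.
move=> fh; rewrite /is_int => fI.
apply: cvg_trans fI; apply: near_eq_cvg.
apply: filterS (near_mesh ltr01) => P [sP tP].
apply: eq_bigr => k _; congr (_ * _).
have [a1 a2 a3] := tP k (ltn_ord k).
have /andP[c1 c2] := subdivision01 sP (ltnW (ltn_ord k)).
have /andP[c3 c4] := subdivision01 sP (ltn_ord k).
rewrite fh //; exists (P.2 k) => //=; rewrite in_itv /=; apply/andP; split; lra.
Qed.

Lemma is_int_uniform g f I : is_int g f I ->
  (fun n => stieltjes_sum g f (uniform_partition n)) @ \oo --> I.
Proof.
move=> /cvgCP h; apply/cvgCP => e /h [d d0 dP].
have [N NP] := ex_inv_lt d0; exists N => // n /= Nn.
by apply: (dP (uniform_partition n)); apply: uniform_partitionP; exact: NP.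
Qed.

End Stieltjes.

(** * Strict complex differentiability and its calculus *)

Section StrictDifferentiability.
Context {R : realType}.
Local Notation C := (Cplx R).

(** Only the second point, the base of the difference quotient, is confined to S. *)
Definition pairs_near (S : set C) (z : C) : set_system (C * C) :=
  filter_from [set r : R | 0 < r]
    (fun r => [set p | [/\ cabs (p.1 - z) < r, cabs (p.2 - z) < r & S p.2]]).

Global Instance pairs_near_filter S z : Filter (pairs_near S z).
Proof.
apply: filter_from_filter; first by exists 1 => /=.
move=> r r' /= r0 r'0; exists (Num.min r r') => /=; first by rewrite lt_min r0.
by move=> p [] /=; rewrite !lt_min => /andP[? ?] /andP[? ?] ?.
Qed.

(* For S = {z} this is complex differentiability at z, and for S = setT it is
   strict differentiability. *)
Definition sdiff (S : set C) (f : C -> C) (z : C) : Prop :=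
  exists (phi : C * C -> C) (d : C),
    (\forall p \near pairs_near S z, f p.1 - f p.2 = phi p * (p.1 - p.2)) /\
    phi @ pairs_near S z --> d.

(** The quotient function phi turns the rules of calculus into algebra and limit rules; this
    inequality is the form that estimates produce and consume. On the diagonal phi is given the
    value d. *)
Lemma sdiffP S f z : sdiff S f z <->
  exists d : C, forall e : R, 0 < e -> exists2 r : R, 0 < r & forall x y,
    cabs (x - z) < r -> cabs (y - z) < r -> S y ->
    cabs (f x - f y - d * (x - y)) <= e * cabs (x - y).
Proof.
split=> [[phi [d [fphi /cvgCP phid]]]|[d H]].
  exists d => e /phid phie; have [r r0 rP] := filterI fphi phie.
  exists r => // x y xr yr Sy; have [/= -> h] := rP (x, y) (And3 xr yr Sy).
  by rewrite -mulrBl cabsM ler_wpM2r ?cabs_ge0 // ltW.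
exists (fun p => if p.1 == p.2 then d else (f p.1 - f p.2) / (p.1 - p.2)), d.
split.
  exists 1 => //= -[x y] _ /=; have [->|xy] := eqVneq x y.
    by rewrite !subrr mulr0.
  by rewrite divfK // subr_eq0.
apply/cvgCP => e e0; have e20 : 0 < e / 2 by lra.
have [r r0 rP] := H _ e20.
suff aux (x y : C) : cabs (x - z) < r -> cabs (y - z) < r -> S y ->
    cabs ((if x == y then d else (f x - f y) / (x - y)) - d) < e.
  by exists r => //= p [xr yr Sy]; exact: aux.
move=> xr yr Sy.
case: eqP => [_|/eqP xy]; first by rewrite subrr cabs0.
have xy0 : x - y != 0 by rewrite subr_eq0.
have -> : (f x - f y) / (x - y) - d = (f x - f y - d * (x - y)) / (x - y).
  by rewrite [in RHS]mulrBl mulfK.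
rewrite cabsM cabsV (@le_lt_trans _ _ (e / 2)) //; last by lra.
by rewrite ler_pdivrMr ?cabs_gt0 //; exact: rP.
Qed.

Lemma sdiff_sub S S' f z : S' `<=` S -> sdiff S f z -> sdiff S' f z.
Proof.
move=> SS /sdiffP[d H]; apply/sdiffP; exists d => e /H[r r0 rP].
by exists r => // x y xr yr /SS; exact: rP.
Qed.

Lemma derivable_sdiff (f : C -> C) (z : C) : derivable f z 1 <-> sdiff [set z] f z.
Proof.
rewrite derivableCP sdiffP; split=> -[d H]; exists d => e /H[r r0 rP]; exists r => //.
  by move=> x y xr yr ->; exact: rP.
by move=> x xr; apply: rP => //; rewrite subrr cabs0.
Qed.

Lemma strict_derivable (f : C -> C) (z : C) : sdiff setT f z -> derivable f z 1.
Proof. by move=> h; apply/derivable_sdiff; apply: (sdiff_sub _ h). Qed.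

Lemma sdiff_continuous S f z : S z -> sdiff S f z -> {for z, continuous f}.
Proof.
move=> Sz /sdiffP[d /(_ 1 ltr01)[r r0 rP]]; apply/continuousCP => e e0.
have k0 : 0 < cabs d + 1 by rewrite ltr_wpDl // cabs_ge0.
exists (Num.min r (e / (cabs d + 1))) => [|x].
  by rewrite lt_min r0 divr_gt0.
rewrite lt_min => /andP[xr]; rewrite ltr_pdivlMr // => xe.
have := rP x z xr; rewrite subrr cabs0 => /(_ r0 Sz) h.
rewrite -[f x - f z](subrK (d * (x - z))) (le_lt_trans (cabsD _ _)) //.
by rewrite (le_lt_trans (lerD h (lexx _))) // cabsM; lra.
Qed.

Lemma continuous_pairs_near1 S (f : C -> C) (z : C) : {for z, continuous f} ->
  (fun p => f p.1) @ pairs_near S z --> f z.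
Proof.
move=> /continuousCP fc; apply/cvgCP => e /fc[r r0 rP].
by exists r => // p [/= pr _ _]; exact: rP.
Qed.

Lemma continuous_pairs_near2 S (f : C -> C) (z : C) : {for z, continuous f} ->
  (fun p => f p.2) @ pairs_near S z --> f z.
Proof.
move=> /continuousCP fc; apply/cvgCP => e /fc[r r0 rP].
by exists r => // p [/= _ pr _]; exact: rP.
Qed.

Lemma sdiff_cst S (c : C) z : sdiff S (fun=> c) z.
Proof.
apply/sdiffP; exists 0 => e e0; exists 1 => // x y _ _ _.
by rewrite subrr mul0r subrr cabs0 mulr_ge0 ?cabs_ge0 // ltW.
Qed.

Lemma sdiff_id S z : sdiff S id z.
Proof.
apply/sdiffP; exists 1 => e e0; exists 1 => // x y _ _ _.
by rewrite mul1r subrr cabs0 mulr_ge0 ?cabs_ge0 // ltW.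
Qed.

Lemma sdiffD S f h z : sdiff S f z -> sdiff S h z -> sdiff S (fun x => f x + h x) z.
Proof.
move=> [phi [d [fphi phid]]] [psi [d' [hpsi psid]]].
exists (fun p => phi p + psi p), (d + d'); split; last exact: (cvgC_add phid psid).
apply: filterS2 fphi hpsi => p e1 e2; rewrite mulrDl -e1 -e2; ring.
Qed.

Lemma sdiffM S f h z : S z -> sdiff S f z -> sdiff S h z ->
  sdiff S (fun x => f x * h x) z.
Proof.
move=> Sz fd hd; have fc := sdiff_continuous Sz fd.
have hc := sdiff_continuous Sz hd.
case: fd hd => [phi [d [fphi phid]]] [psi [d' [hpsi psid]]].
exists (fun p => phi p * h p.1 + f p.2 * psi p), (d * h z + f z * d'); split.
  apply: filterS2 fphi hpsi => p e1 e2.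
  by rewrite mulrDl mulrAC -e1 -(mulrA (f p.2)) -e2; ring.
exact: (cvgC_add (cvgC_mul phid (continuous_pairs_near1 S hc))
                 (cvgC_mul (continuous_pairs_near2 S fc) psid)).
Qed.

Lemma cvgC_inv T (F : set_system T) {FF : Filter F} (f : T -> C) (l : C) :
  l != 0 -> f @ F --> l -> (fun t => (f t)^-1) @ F --> l^-1.
Proof.
move=> l0 /cvgCP fl; apply/cvgCP => e e0.
have cl : 0 < cabs l by rewrite cabs_gt0.
have k0 : 0 < e * (cabs l / 2 * cabs l) by rewrite !mulr_gt0.
have cl2 : 0 < cabs l / 2 by lra.
apply: filterS2 (fl _ k0) (fl _ cl2) => t h1 h2.
have h3 : cabs l / 2 < cabs (f t).
  have := cabs_rev l (f t); rewrite cabs_distC; lra.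
have f0 : f t != 0 by rewrite -cabs_gt0; lra.
have -> : (f t)^-1 - l^-1 = (l - f t) / (f t * l).
  by field; rewrite f0 l0.
rewrite cabsM cabsV cabsM ltr_pdivrMr ?mulr_gt0 //; last by lra.
rewrite cabs_distC (lt_le_trans h1) // ler_pM2l // ler_pM2r //; exact: ltW.
Qed.

Lemma continuous_neq0 (f : C -> C) z : {for z, continuous f} -> f z != 0 ->
  exists2 r : R, 0 < r & forall x, cabs (x - z) < r -> f x != 0.
Proof.
move=> /continuousCP fc; rewrite -cabs_gt0 => /fc[r r0 rP]; exists r => // x /rP h.
rewrite -cabs_gt0; have := cabs_rev (f z) (f x); rewrite cabs_distC; lra.
Qed.

Lemma sdiffV S f z : S z -> sdiff S f z -> f z != 0 -> sdiff S (fun x => (f x)^-1) z.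
Proof.
move=> Sz fd fz0; have fc := sdiff_continuous Sz fd.
case: fd => [phi [d [fphi phid]]].
exists (fun p => - phi p * ((f p.1)^-1 * (f p.2)^-1)), (-d * ((f z)^-1 * (f z)^-1)).
have [r r0 rP] := continuous_neq0 fc fz0.
split.
  have nz : \forall p \near pairs_near S z, f p.1 != 0 /\ f p.2 != 0.
    by exists r => // p [/= h1 h2 _]; split; exact: rP.
  apply: filterS2 fphi nz => p e1 [n1 n2].
  have -> : - phi p * ((f p.1)^-1 * (f p.2)^-1) * (p.1 - p.2) =
      - (f p.1 - f p.2) * ((f p.1)^-1 * (f p.2)^-1) by rewrite e1; ring.
  by field; rewrite n1 n2.
have phid' : (fun p => - phi p) @ pairs_near S z --> - d.
  rewrite -mulN1r (_ : (fun p => _) = (fun p => -1 * phi p)).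
    exact: (cvgC_scale phid).
  by apply/funext => p; rewrite mulN1r.
exact: (cvgC_mul phid' (cvgC_mul (cvgC_inv fz0 (continuous_pairs_near1 S fc))
  (cvgC_inv fz0 (continuous_pairs_near2 S fc)))).
Qed.

(** For a general S the image u p.2 of the base point is only known to be close to u z, hence [setT]
    for the outer function. *)
Lemma sdiff_comp S f u z : S z -> sdiff S u z -> sdiff setT f (u z) ->
  sdiff S (fun x => f (u x)) z.
Proof.
move=> Sz ud; have /continuousCP uc := sdiff_continuous Sz ud.
case: ud => [phi [d [uphi phid]]] [psi [d' [fpsi psid]]].
have lift A : pairs_near setT (u z) A ->
    pairs_near S z [set p | A (u p.1, u p.2)].
  move=> [r /uc[r' r'0 r'P] rA]; exists r' => // p [/= h1 h2 _].
  by apply: rA; split; rewrite //=; exact: r'P.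
exists (fun p => psi (u p.1, u p.2) * phi p), (d' * d); split.
  by apply: filterS2 uphi (lift _ fpsi) => p /= e1 e2; rewrite e2 e1 mulrA.
have psid' : (fun p => psi (u p.1, u p.2)) @ pairs_near S z --> d'.
  by move=> A /psid; exact: lift.
exact: (cvgC_mul psid' phid).
Qed.

Lemma sdiff_near S f h z : sdiff S f z ->
  (exists2 r : R, 0 < r & forall x, cabs (x - z) < r -> h x = f x) -> sdiff S h z.
Proof.
move=> [phi [d [fphi phid]]] [r r0 rP]; exists phi, d; split => //.
have hf : \forall p \near pairs_near S z, h p.1 = f p.1 /\ h p.2 = f p.2.
  by exists r => // p [/= h1 h2 _]; split; exact: rP.
by apply: filterS2 fphi hf => p e1 [-> ->].
Qed.

Lemma sdiffZ S (c : C) f z : S z -> sdiff S f z -> sdiff S (fun x => c * f x) z.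
Proof. by move=> Sz h; apply: sdiffM => //; exact: sdiff_cst. Qed.

Lemma sdiffN S f z : S z -> sdiff S f z -> sdiff S (fun x => - f x) z.
Proof.
move=> Sz /(sdiffZ (-1) Sz) h; apply: (sdiff_near h).
by exists 1 => // x _; rewrite mulN1r.
Qed.

Lemma sdiffB S f h z : S z -> sdiff S f z -> sdiff S h z ->
  sdiff S (fun x => f x - h x) z.
Proof. by move=> Sz fd hd; apply: sdiffD => //; exact: sdiffN. Qed.

Lemma sdiff_horner S (p : {poly C}) z : S z -> sdiff S (horner p) z.
Proof.
move=> Sz; elim/poly_ind: p => [|p c IH].
  by apply: (sdiff_near (sdiff_cst S 0 z)); exists 1 => // x _; rewrite horner0.
apply: (sdiff_near (sdiffD (sdiffM Sz IH (sdiff_id S z)) (sdiff_cst S c z))).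
by exists 1 => // x _; rewrite hornerMXaddC.
Qed.

Lemma sdiff_continuousT f z : sdiff setT f z -> {for z, continuous f}.
Proof. exact: (@sdiff_continuous setT). Qed.

Lemma derivable_continuousC (f : C -> C) (z : C) : derivable f z 1 ->
  {for z, continuous f}.
Proof. by move=> /derivable_sdiff; apply: (@sdiff_continuous [set z]). Qed.

End StrictDifferentiability.

(** * Integrals over segments and squares; Goursat's theorem *)

Section Squares.
Context {R : realType}.
Local Notation C := (Cplx R).
Local Notation I := ('i%C : C).
Implicit Types f h : C -> C.

Lemma continuous_comp01 (g : R -> C) (f : C -> C) : {within `[0, 1], continuous g} ->
  (forall x, trace g x -> {for x, continuous f}) ->
  {within `[0, 1], continuous (f \o g)}.
Proof.
move=> /within01P gc fc; apply/within01P => t t01 e e0.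
have gt : trace g (g t) by exists t.
have /continuousCP/(_ e e0)[r r0 rP] := fc _ gt.
have [r' r'0 r'P] := gc t t01 r r0.
by exists r' => // s s01 st; apply: rP; exact: r'P.
Qed.

Lemma is_int_cont (g : R -> C) (f : C -> C) : good_curve g ->
  (forall x, trace g x -> {for x, continuous f}) ->
  is_int g f (contour_integral g f).
Proof.
move=> gg fc; have [J fJ] := is_int_ex gg (continuous_comp01 gg.1 fc).
by rewrite (is_int_eq fJ).
Qed.

Definition seg (a d : C) (t : R) : C := a + t%:C * d.

Lemma seg_dominated a d : dominated (seg a d) (fun t => t * cabs d).
Proof.
move=> s t _ st _; rewrite /seg.
have -> : a + t%:C * d - (a + s%:C * d) = (t - s)%:C * d by rewrite rmorphB; ring.
by rewrite cabsM cabs_real ger0_norm ?subr_ge0 // mulrBl.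
Qed.

Lemma seg_continuous a d : {within `[0, 1], continuous (seg a d)}.
Proof.
apply/within01P => t t01 e e0.
have k0 : 0 < cabs d + 1 by rewrite ltr_wpDl // cabs_ge0.
exists (e / (cabs d + 1)); first by rewrite divr_gt0.
move=> s s01; rewrite ltr_pdivlMr // => h.
have -> : seg a d s - seg a d t = (s - t)%:C * d by rewrite /seg rmorphB; ring.
rewrite cabsM cabs_real (le_lt_trans _ h) // ler_wpM2l //; lra.
Qed.

Lemma seg_good a d : good_curve (seg a d).
Proof. by split; [exact: seg_continuous|exists (fun t => t * cabs d); exact: seg_dominated]. Qed.

Definition sint (f : C -> C) (a d : C) : C := contour_integral (seg a d) f.

Definition usum (f : C -> C) (a d : C) (n : nat) : C :=
  \sum_(k < n) f (a + k%:R / n%:R * d) * (d / n%:R).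

Lemma stieltjes_seg a d f n :
  stieltjes_sum (seg a d) f (uniform_partition n) = usum f a d n.+1.
Proof.
rewrite /stieltjes_sum size_mkseq; apply: eq_bigr => k _.
rewrite nth_uniform_partition ?(ltnW (ltn_ord k)) // nth_mkseq //=.
rewrite /seg; congr (f _ * _); first by rewrite rmorphM fmorphV !rmorph_nat.
rewrite !rmorphM !fmorphV !rmorph_nat -natr1; ring.
Qed.

Lemma sint_usum f a d : (forall x, trace (seg a d) x -> {for x, continuous f}) ->
  (fun n => usum f a d n.+1) @ \oo --> sint f a d.
Proof.
move=> /(is_int_cont (seg_good a d))/is_int_uniform.
by under eq_fun do rewrite stieltjes_seg.
Qed.

Lemma usum_split f a d n : (0 < n)%N ->
  usum f a d (n + n) = usum f a (d / 2) n + usum f (a + d / 2) (d / 2) n.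
Proof.
move=> n0; have nn0 : n%:R != 0 :> C by rewrite pnatr_eq0 -lt0n.
have e1 : d / (n + n)%:R = d / 2 / n%:R by rewrite addnn -mul2n natrM invfM mulrA.
have e2 k : k%:R / (n + n)%:R * d = k%:R / n%:R * (d / 2) :> C.
  by rewrite addnn -mul2n natrM invfM; ring.
rewrite /usum big_split_ord; congr (_ + _); apply: eq_bigr => k _ /=.
  by rewrite e1 e2.
rewrite e1 e2; congr (f _ * _); rewrite natrD mulrDl divff //; ring.
Qed.

Lemma cvgC_unique (u : nat -> C) (l l' : C) : u @ \oo --> l -> u @ \oo --> l' -> l = l'.
Proof. by move=> h h'; rewrite -(cvgC_lim h) -(cvgC_lim h'). Qed.

Lemma cvgC_subseq (u : nat -> C) (s : nat -> nat) (l : C) : u @ \oo --> l ->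
  (forall n, (n <= s n)%N) -> (fun n => u (s n)) @ \oo --> l.
Proof.
move=> /cvgCP ul sn; apply/cvgCP => e /ul[N _ NP]; exists N => // n /= Nn.
by apply: NP => /=; exact: leq_trans (sn n).
Qed.

Lemma sint_split f a d : continuous f ->
  sint f a d = sint f a (d / 2) + sint f (a + d / 2) (d / 2).
Proof.
move=> fc.
(* The index 2n + 1 gives a sum with 2(n + 1) cells, which divides evenly at the midpoint. *)
have h := cvgC_subseq (s := fun n => (n + n).+1) (sint_usum (a := a) (d := d) (fun x _ => fc x)).
apply: (@cvgC_unique _ _ _ (h _)).
  by move=> n; rewrite ltnW // ltnS leq_addr.
rewrite (_ : (fun n => usum f a d (n + n).+2) =
    (fun n => usum f a (d / 2) n.+1 + usum f (a + d / 2) (d / 2) n.+1)).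
  exact: (cvgC_add (sint_usum (fun x _ => fc x)) (sint_usum (fun x _ => fc x))).
by apply/funext => n; rewrite -usum_split // addSn addnS.
Qed.

Lemma sint_lin_on (f h k : C -> C) a d (c : C) :
  (forall x, trace (seg a d) x -> [/\ {for x, continuous f}, {for x, continuous h} &
     k x = c * f x + h x]) ->
  sint k a d = c * sint f a d + sint h a d.
Proof.
move=> H; apply: is_int_eq.
have fI : is_int (seg a d) f (sint f a d).
  by apply: is_int_cont (seg_good a d) _ => x /H[].
have hI : is_int (seg a d) h (sint h a d).
  by apply: is_int_cont (seg_good a d) _ => x /H[].
apply: (@is_int_ext _ _ (fun x => c * f x + h x)); first by move=> x /H[].
exact: (is_int_lin fI hI).
Qed.

Lemma sint_lin f h a d (c : C) : continuous f -> continuous h ->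
  sint (fun x => c * f x + h x) a d = c * sint f a d + sint h a d.
Proof.
by move=> fc hc; apply: sint_lin_on => x _; split; [exact: fc|exact: hc|].
Qed.

Lemma sint_bound f a d M : (forall x, trace (seg a d) x -> {for x, continuous f}) ->
  (forall x, trace (seg a d) x -> cabs (f x) <= M) ->
  cabs (sint f a d) <= M * cabs d.
Proof.
move=> fc fM.
have := is_int_bound (@seg_dominated a d) (is_int_cont (seg_good a d) fc) fM.
by rewrite mul1r mul0r subr0.
Qed.

Lemma continuous_cstC (c x : C) : {for x, continuous (fun _ : C => c)}.
Proof. by apply/continuousCP => e e0; exists 1 => // y _; rewrite subrr cabs0. Qed.

Lemma sint_cst (c a d : C) : sint (fun=> c) a d = c * d.
Proof.
have h1 := @sint_usum (fun=> c) a d (fun x _ => @continuous_cstC c x).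
apply: (cvgC_unique h1).
rewrite (_ : (fun n => _) = (fun=> c * d)); first exact: cvg_cst.
apply/funext => n; rewrite /usum sumr_const card_ord -mulrnAr -[d / _ *+ _]mulr_natr.
by rewrite divfK // pnatr_eq0.
Qed.

Lemma sint_shift f (b a d : C) : continuous f ->
  sint f (a + b) d = sint (fun x => f (x + b)) a d.
Proof.
move=> fc; have fc' : continuous (fun x => f (x + b)).
  move=> x; apply/continuousCP => e e0.
  have /continuousCP/(_ e e0)[r r0 rP] := fc (x + b).
  by exists r => // y yx; apply: rP; rewrite opprD addrACA subrr addr0.
apply: (cvgC_unique (sint_usum (fun x _ => fc x))).
have := sint_usum (a := a) (d := d) (fun x _ => fc' x).
rewrite (_ : (fun n => usum (fun x => f (x + b)) a d n.+1) = (fun n => usum f (a + b) d n.+1)) //.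
by apply/funext => n; apply: eq_bigr => k _; rewrite addrAC.
Qed.

Definition square (a : C) (s : R) (z : C) :=
  (complex.Re a <= complex.Re z <= complex.Re a + s) &&
  (complex.Im a <= complex.Im z <= complex.Im a + s).

(** Counterclockwise integral over the boundary of [square a s], whose lower left corner is a; the
    top and left edges are parametrised against this orientation, hence the minus signs. *)
Definition bdint (f : C -> C) (a : C) (s : R) : C :=
  sint f a s%:C + sint f (a + s%:C) (I * s%:C) - sint f (a + I * s%:C) s%:C
  - sint f a (I * s%:C).

(** Every inner edge is run through twice, in opposite directions. *)
Lemma bdint_split f a s : continuous f ->
  bdint f a s = bdint f a (s / 2) + bdint f (a + (s / 2)%:C) (s / 2) +
    bdint f (a + I * (s / 2)%:C) (s / 2) +
    bdint f (a + (s / 2)%:C + I * (s / 2)%:C) (s / 2).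
Proof.
move=> fc; rewrite /bdint.
have e : (s / 2)%:C = s%:C / 2 :> C by rewrite rmorphM fmorphV rmorph_nat.
rewrite !e; set d := s%:C.
rewrite (sint_split a d) // (sint_split (a + d) (I * d)) //.
rewrite (sint_split (a + I * d) d) // (sint_split a (I * d)) //.
have e1 : I * d / 2 = I * (d / 2) by ring.
rewrite !e1.
have -> : a + d / 2 + d / 2 = a + d by field.
have -> : a + I * (d / 2) + I * (d / 2) = a + I * d by field.
have -> : a + I * (d / 2) + d / 2 = a + d / 2 + I * (d / 2) by ring.
have -> : a + d / 2 + I * (d / 2) + I * (d / 2) = a + I * d + d / 2 by field.
have -> : a + d / 2 + I * (d / 2) + d / 2 = a + d + I * (d / 2) by field.
move: (sint _ _ _) (sint _ _ _) (sint _ _ _) (sint _ _ _) => x1 x2 x3 x4.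
move: (sint _ _ _) (sint _ _ _) (sint _ _ _) (sint _ _ _) => x5 x6 x7 x8.
move: (sint _ _ _) (sint _ _ _) (sint _ _ _) (sint _ _ _) => y1 y2 y3 y4.
ring.
Qed.

Lemma bdint_lin f h a s (c : C) : continuous f -> continuous h ->
  bdint (fun x => c * f x + h x) a s = c * bdint f a s + bdint h a s.
Proof. by move=> fc hc; rewrite /bdint !(sint_lin _ _ c fc hc); ring. Qed.

Lemma bdint_cst (c a : C) s : bdint (fun=> c) a s = 0.
Proof. by rewrite /bdint !sint_cst; ring. Qed.

Lemma bdint_id a s : bdint id a s = 0.
Proof.
have ci : continuous (id : C -> C) by move=> x; exact: cvg_id.
have cc (b : C) : continuous (fun _ : C => b) by move=> x; exact: (@continuous_cstC b x).
have sh b d : sint id (a + b) d = sint id a d + b * d.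
  rewrite (sint_shift b a d ci) -(sint_cst b a d) -[sint id a d]mul1r.
  rewrite -(sint_lin a d 1 ci (cc b)).
  suff -> : (fun x : C => 1 * id x + b) = (fun x => id (x + b)) by [].
  by apply/funext => x; rewrite mul1r.
rewrite /bdint !sh; ring.
Qed.

Lemma ReD (x y : C) : complex.Re (x + y) = complex.Re x + complex.Re y.
Proof. by case: x y => [? ?] [? ?]. Qed.
Lemma ImD (x y : C) : complex.Im (x + y) = complex.Im x + complex.Im y.
Proof. by case: x y => [? ?] [? ?]. Qed.
Lemma ReRM (s : R) (y : C) : complex.Re (s%:C * y) = s * complex.Re y.
Proof. by case: y => [? ?]; rewrite /= mul0r subr0. Qed.
Lemma ImRM (s : R) (y : C) : complex.Im (s%:C * y) = s * complex.Im y.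
Proof. by case: y => [? ?]; rewrite /= mul0r addr0. Qed.
Lemma Re_iM (s : R) : complex.Re (I * s%:C) = 0.
Proof. by rewrite /= mul0r mul1r subr0. Qed.
Lemma Im_iM (s : R) : complex.Im (I * s%:C) = s.
Proof. by rewrite /= mul0r mul1r add0r. Qed.

Lemma trace_seg_square a s : 0 <= s -> forall x,
  [\/ trace (seg a s%:C) x, trace (seg (a + s%:C) (I * s%:C)) x,
      trace (seg (a + I * s%:C) s%:C) x | trace (seg a (I * s%:C)) x] ->
  square a s x.
Proof.
move=> s0 x H.
have aux (t : R) : t \in `[0, 1] -> 0 <= t * s /\ t * s <= s.
  rewrite in_itv /= => /andP[t0 t1]; rewrite mulr_ge0 //; split => //.
  by rewrite ler_piMl.
case: H => -[t /= /aux[h1 h2] <-];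
rewrite /square /seg !(ReD, ImD, ReRM, ImRM, Re_iM, Im_iM) /= ?mulr0;
by apply/andP; split; apply/andP; split; lra.
Qed.

Lemma bdint_bound f a s M : 0 <= s ->
  (forall x, [\/ trace (seg a s%:C) x, trace (seg (a + s%:C) (I * s%:C)) x,
      trace (seg (a + I * s%:C) s%:C) x | trace (seg a (I * s%:C)) x] ->
   {for x, continuous f} /\ cabs (f x) <= M) ->
  cabs (bdint f a s) <= 4 * M * s.
Proof.
move=> s0 H.
have e1 : cabs s%:C = s by rewrite cabs_real ger0_norm.
have e2 : cabs (I * s%:C) = s by rewrite cabsM cabs_i mul1r.
have b1 : cabs (sint f a s%:C) <= M * s.
  by rewrite -{2}e1; apply: sint_bound => x hx; case: (H x) => //; constructor 1.
have b2 : cabs (sint f (a + s%:C) (I * s%:C)) <= M * s.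
  by rewrite -{3}e2; apply: sint_bound => x hx; case: (H x) => //; constructor 2.
have b3 : cabs (sint f (a + I * s%:C) s%:C) <= M * s.
  by rewrite -{3}e1; apply: sint_bound => x hx; case: (H x) => //; constructor 3.
have b4 : cabs (sint f a (I * s%:C)) <= M * s.
  by rewrite -{2}e2; apply: sint_bound => x hx; case: (H x) => //; constructor 4.
rewrite /bdint (le_trans (cabsB _ _)) //.
have := cabsB (sint f a s%:C + sint f (a + s%:C) (I * s%:C)) (sint f (a + I * s%:C) s%:C).
have := cabsD (sint f a s%:C) (sint f (a + s%:C) (I * s%:C)).
lra.
Qed.

(** The constant f z0 has integral 0 and may be subtracted, so only the oscillation of f enters. *)
Lemma bdint_osc f a s e z0 : continuous f -> 0 <= s ->
  (forall z, square a s z -> cabs (f z - f z0) <= e) ->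
  cabs (bdint f a s) <= 4 * e * s.
Proof.
move=> fc s0 H.
have cc (b : C) : continuous (fun _ : C => b) by move=> x; exact: (@continuous_cstC b x).
have -> : bdint f a s = bdint (fun x => 1 * f x + - f z0) a s.
  by rewrite (bdint_lin a s 1 fc (cc _)) bdint_cst mul1r addr0.
apply: bdint_bound => // x /(trace_seg_square s0) sx; split; last by rewrite mul1r; exact: H.
apply/continuousCP => e' e'0; have /continuousCP/(_ e' e'0)[r r0 rP] := fc x.
by exists r => // y /rP; rewrite !mul1r opprD opprK addrACA addNr addr0.
Qed.

Lemma cabs_square a s x y : square a s x -> square a s y -> cabs (x - y) <= 2 * s.
Proof.
move=> /andP[/andP[h1 h2] /andP[h3 h4]] /andP[/andP[k1 k2] /andP[k3 k4]].
rewrite (le_trans (cabs_le_ReIm _)) // ReB ImB mulrDl mul1r lerD // ler_norml;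
by apply/andP; split; lra.
Qed.

(** Affine functions have integral 0 over a square and may be subtracted. The constant 8 is 4, from
    the four edges, times 2, from the bound 2 * s for distances within the square. *)
Lemma bdint_diff f a s (d z0 : C) e : continuous f -> 0 <= s -> 0 <= e -> square a s z0 ->
  (forall z, square a s z -> cabs (f z - f z0 - d * (z - z0)) <= e * cabs (z - z0)) ->
  cabs (bdint f a s) <= 8 * e * s ^+ 2.
Proof.
move=> fc s0 e0 sz0 H.
have ci : continuous (id : C -> C) by move=> x; exact: cvg_id.
have -> : bdint f a s = bdint (fun x => - d * x + f x) a s.
  by rewrite (bdint_lin a s (- d) ci fc) bdint_id mulr0 add0r.
have fc' : continuous (fun x => - d * x + f x).
  move=> x; exact: (cvgC_lin (cvg_id (F := nbhs x)) (fc x)).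
rewrite (_ : 8 * e * s ^+ 2 = 4 * (e * (2 * s)) * s); last by ring.
apply: (bdint_osc (z0 := z0)) => // z sz.
have -> : - d * z + f z - (- d * z0 + f z0) = f z - f z0 - d * (z - z0) by ring.
by rewrite (le_trans (H _ sz)) // ler_wpM2l // (cabs_square sz).
Qed.

Section Cousin.
Variable P : C -> R -> Prop.
Hypothesis P_split : forall a s, 0 < s -> P a (s / 2) -> P (a + (s / 2)%:C) (s / 2) ->
  P (a + I * (s / 2)%:C) (s / 2) -> P (a + (s / 2)%:C + I * (s / 2)%:C) (s / 2) ->
  P a s.

Lemma square_sub (a : C) s : 0 < s -> forall b : C,
  [\/ b = a, b = a + (s / 2)%:C, b = a + I * (s / 2)%:C |
      b = a + (s / 2)%:C + I * (s / 2)%:C] ->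
  square b (s / 2) `<=` square a s.
Proof.
move=> s0 b H z.
have : complex.Re a <= complex.Re b <= complex.Re a + s / 2 /\
    complex.Im a <= complex.Im b <= complex.Im a + s / 2.
  case: H => ->; rewrite ?(ReD, ImD, Re_iM, Im_iM) /=;
  by split; apply/andP; split; lra.
move=> [/andP[h1 h2] /andP[h3 h4]] /andP[/andP[h5 h6] /andP[h7 h8]].
by rewrite /square; apply/andP; split; apply/andP; split; lra.
Qed.

(* Cousin's lemma, by repeated bisection. *)
Lemma square_cousin a s : 0 < s ->
  (forall z, square a s z -> exists2 r : R, 0 < r & forall b u, 0 < u < r ->
     square b u z -> square b u `<=` square a s -> P b u) ->
  P a s.
Proof.
move=> s0 H; apply: contrapT => nP.
(* A bad square has a bad quarter. The conditions stand under the existential so that [choice] gives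
   a total function to iterate. *)
have step (p : C * R) : exists p' : C * R, (0 < p.2 -> ~ P p.1 p.2 ->
    [/\ p'.2 = p.2 / 2, square p'.1 p'.2 `<=` square p.1 p.2 & ~ P p'.1 p'.2]).
  case: p => b u /=; have [[u0 nb]|h] := pselect (0 < u /\ ~ P b u); last first.
    by exists (b, u) => u0 nb; case: h.
  have [h|h] := pselect (exists b', [\/ b' = b, b' = b + (u / 2)%:C,
      b' = b + I * (u / 2)%:C | b' = b + (u / 2)%:C + I * (u / 2)%:C] /\ ~ P b' (u / 2)).
    case: h => b' [hb' nb']; exists (b', u / 2) => _ _; split => //=.
    exact: square_sub.
  exfalso; apply: nb; apply: P_split => //; apply: contrapT => nb; apply: h.
  - by exists b; split => //; constructor 1.
  - by eexists; split; [constructor 2|exact: nb].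
  - by eexists; split; [constructor 3|exact: nb].
  - by eexists; split; [constructor 4|exact: nb].
have [next nextP] := choice step.
pose q n := iter n next (a, s).
have qP n : [/\ (q n).2 = s / 2 ^+ n, ~ P (q n).1 (q n).2 &
    square (q n).1 (q n).2 `<=` square a s].
  elim: n => [|n [e1 n1 sub1]]; first by rewrite /q /= expr0 divr1; split.
  have u0 : 0 < (q n).2 by rewrite e1 divr_gt0 // exprn_gt0.
  have [e2 sub2 n2] := nextP (q n) u0 n1.
  split => //; last by move=> z /sub2/sub1.
  by rewrite [(q n.+1).2]e2 e1 exprS invfM mulrA mulrAC.
have q0 n : 0 < (q n).2 by case: (qP n) => -> _ _; rewrite divr_gt0 // exprn_gt0.
have qsub n m : (n <= m)%N -> square (q m).1 (q m).2 `<=` square (q n).1 (q n).2.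
  elim: m => [|m IH]; first by rewrite leqn0 => /eqP ->.
  rewrite leq_eqVlt => /orP[/eqP -> //|nm] z.
  have [_ nm' _] := qP m; have [_ sub _] := nextP (q m) (q0 m) nm'.
  by move=> /sub; exact: IH.
have corner b u : 0 < u -> square b u b.
  by move=> u0; rewrite /square !lexx /= !lerDl ltW.
have qq n m : square (q n).1 (q n).2 (q (maxn n m)).1.
  by apply: (qsub n (maxn n m)); rewrite ?leq_maxl //; exact: corner.
have mono n m : complex.Re (q n).1 <= complex.Re (q m).1 + (q m).2 /\
    complex.Im (q n).1 <= complex.Im (q m).1 + (q m).2.
  have /andP[/andP[h1 h2] /andP[h3 h4]] := qq n m.
  have /andP[/andP[h5 h6] /andP[h7 h8]] := qq m n.
  by rewrite maxnC in h5 h6 h7 h8; split; lra.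
(* Every left end is at most every right end by [mono], so the supremum of the left ends lies in all
   the nested intervals; likewise for y. *)
pose x := sup (range (fun n => complex.Re (q n).1)).
pose y := sup (range (fun n => complex.Im (q n).1)).
have zP n : square (q n).1 (q n).2 (x +i* y)%C.
  rewrite /square /=; apply/andP; split; apply/andP; split.
  - apply: sup_upper_bound; last by exists n.
    split; first by exists (complex.Re (q 0%N).1), 0%N.
    by exists (complex.Re (q 0%N).1 + (q 0%N).2) => _ [k _ <-]; case: (mono k 0%N).
  - apply: ge_sup; first by exists (complex.Re (q 0%N).1), 0%N.
    by move=> _ [k _ <-]; case: (mono k n).
  - apply: sup_upper_bound; last by exists n.
    split; first by exists (complex.Im (q 0%N).1), 0%N.
    by exists (complex.Im (q 0%N).1 + (q 0%N).2) => _ [k _ <-]; case: (mono k 0%N).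
  - apply: ge_sup; first by exists (complex.Im (q 0%N).1), 0%N.
    by move=> _ [k _ <-]; case: (mono k n).
have [r r0 rP] := H _ (zP 0%N).
have [n nP2] : exists n, (q n).2 < r.
  have [N NP] := ex_inv_lt (divr_gt0 r0 s0).
  exists N; case: (qP N) => -> _ _; rewrite ltr_pdivrMr ?exprn_gt0 //.
  have := NP N (leqnn _); rewrite ltr_pdivlMr // => h.
  have h2 : (N.+1%:R : R) <= 2 ^+ N by rewrite -natrX ler_nat ltn_expl.
  have N0 : (0 : R) < N.+1%:R by rewrite ltr0n.
  move: h; rewrite mulrC ltr_pdivrMr // => h.
  by rewrite (lt_le_trans h) // ler_wpM2l // ltW.
have [_ nn sub] := qP n.
by apply: nn; apply: rP => //; rewrite q0.
Qed.
End Cousin.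

(** The bound 8 * e' * (area) passes from four quarters to their union because areas add, and it
    holds for all small squares around a point by differentiability there. Cousin's lemma then gives
    it for the whole square, with e' arbitrary. *)
Lemma goursat f a s : continuous f -> 0 < s ->
  (forall z, square a s z -> derivable f z 1) -> bdint f a s = 0.
Proof.
move=> fc s0 fd; apply/eqP; rewrite -cabs_eq0 eq_le cabs_ge0 andbT.
apply/ler_addgt0Pr => e e0; rewrite add0r.
pose e' := e / (8 * s ^+ 2).
have s20 : 0 < 8 * s ^+ 2 by rewrite mulr_gt0 // exprn_gt0.
have e'0 : 0 < e' by rewrite divr_gt0.
suff h : cabs (bdint f a s) <= 8 * e' * s ^+ 2.
  by rewrite (le_trans h) // /e' mulrAC mulrC divfK // gt_eqF.
apply: (square_cousin (P := fun b u => cabs (bdint f b u) <= 8 * e' * u ^+ 2)) => //.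
  move=> b u u0 h1 h2 h3 h4; rewrite bdint_split //.
  have -> : 8 * e' * u ^+ 2 = 8 * e' * (u / 2) ^+ 2 + 8 * e' * (u / 2) ^+ 2 +
      8 * e' * (u / 2) ^+ 2 + 8 * e' * (u / 2) ^+ 2 by field.
  rewrite (le_trans (cabsD _ _)) // lerD //.
  rewrite (le_trans (cabsD _ _)) // lerD //.
  by rewrite (le_trans (cabsD _ _)) // lerD.
move=> z sz; have /derivableCP[d /(_ _ e'0)[r r0 rP]] := fd z sz.
exists (r / 2); first by rewrite divr_gt0.
move=> b u /andP[u0 ur] bz _; apply: (bdint_diff (z0 := z) (d := d)) => //; try exact: ltW.
move=> x bx; apply: rP; rewrite (le_lt_trans (cabs_square bx bz)) //; lra.
Qed.

End Squares.

(** * Integrals over squares crossed by a rectifiable curve *)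

Section Painleve.
Context {R : realType}.
Local Notation C := (Cplx R).
Local Notation I := ('i%C : C).
Implicit Types f : C -> C.

Definition grid_point (a : C) (h : R) (i j : nat) : C :=
  a + (i%:R * h)%:C + I * (j%:R * h)%:C.

Lemma sum_double (F : nat -> C) n :
  \sum_(i < n.*2) F i = \sum_(i < n) (F i.*2 + F i.*2.+1).
Proof.
by elim: n => [|n IH]; rewrite ?big_ord0 // doubleS !big_ord_recr IH /= addrA.
Qed.

Lemma bdint_grid f a s N : continuous f ->
  bdint f a (2 ^+ N * s) =
  \sum_(i < 2 ^ N) \sum_(j < 2 ^ N) bdint f (grid_point a s i j) s.
Proof.
move=> fc; elim: N s => [|N IH] s.
  rewrite expr0 mul1r expn0 !big_ord1 /grid_point.
  by rewrite !mul0r mulr0 !addr0.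
rewrite exprSr -mulrA IH.
have -> : (2 ^ N.+1 = (2 ^ N).*2)%N by rewrite expnS mul2n.
rewrite (sum_double (fun i => \sum_(j < (2 ^ N).*2) bdint f (grid_point a s i j) s)).
apply: eq_bigr => i _.
rewrite (sum_double (fun j => bdint f (grid_point a s i.*2 j) s)).
rewrite (sum_double (fun j => bdint f (grid_point a s i.*2.+1 j) s)).
rewrite -big_split; apply: eq_bigr => j _ /=.
rewrite bdint_split // mulrAC divff // mul1r.
have e0 : grid_point a (2 * s) i j = grid_point a s i.*2 j.*2.
  by rewrite /grid_point -!muln2 !natrM !mulrA.
have e1 (k l : nat) : grid_point a s k l + s%:C = grid_point a s k.+1 l.
  rewrite /grid_point -[k.+1%:R]natr1 mulrDl mul1r rmorphD /=; ring.
have e2 (k l : nat) : grid_point a s k l + I * s%:C = grid_point a s k l.+1.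
  rewrite /grid_point -[l.+1%:R]natr1 mulrDl mul1r rmorphD /=; ring.
rewrite e0 e1 !e2.
move: (bdint _ _ _) (bdint _ _ _) (bdint _ _ _) (bdint _ _ _) => x1 x2 x3 x4.
ring.
Qed.

Lemma square_grid_point a h i j z : square (grid_point a h i j) h z ->
  (complex.Re a + i%:R * h <= complex.Re z <= complex.Re a + i%:R * h + h) /\
  (complex.Im a + j%:R * h <= complex.Im z <= complex.Im a + j%:R * h + h).
Proof.
by move=> /andP[]; rewrite /grid_point !(ReD, ImD, Re_iM, Im_iM) /= !addr0.
Qed.

(* The trace of a rectifiable curve is slim: v is the total variation up to a
   parameter of the point. A grid of mesh h has O(1/h) squares meeting it. *)
Definition slim (E : set C) :=
  exists (v : C -> R) (L : R), (forall z, E z -> `|v z| <= L) /\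
    forall z z', E z -> E z' -> cabs (z - z') <= `|v z - v z'|.

(** Numbers less than h apart lie in cells whose indices differ by at most 1; equal parity then
    forces equality. *)
Lemma index_close (x y b h : R) (i j : nat) : 0 < h -> `|x - y| < h ->
  b + i%:R * h <= x <= b + i%:R * h + h -> b + j%:R * h <= y <= b + j%:R * h + h ->
  odd i = odd j -> i = j.
Proof.
move=> h0 + /andP[x1 x2] /andP[y1 y2] oij; rewrite ltr_norml => /andP[d1 d2].
have ij : (i < j.+2)%N.
  rewrite -(ltr_nat R) -(ltr_pM2r h0) -addn2 natrD; lra.
have ji : (j < i.+2)%N.
  rewrite -(ltr_nat R) -(ltr_pM2r h0) -addn2 natrD; lra.
have : (i = j \/ i = j.+1 \/ j = i.+1)%N by lia.
by case=> [//|[e|e]]; move: oij; rewrite e /=; case: (odd _).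
Qed.

(** Choose a point of E in each bad cell and encode the cell by the integer part of (v + |L|) / h at
    that point together with the parities of its two indices. Equal codes give values of v less than
    h apart, hence points less than h apart, hence the same cell by [index_close]. There are 4 * K
    codes, with K at most 2 * |L| / h + 1. *)
Lemma card_bad_squares (E : set C) (v : C -> R) (L : R) a (h : R) M : 0 < h ->
  (forall z, E z -> `|v z| <= L) ->
  (forall z z', E z -> E z' -> cabs (z - z') <= `|v z - v z'|) ->
  (#|[set p : 'I_M * 'I_M | `[< exists z, E z /\ square (grid_point a h p.1 p.2) h z >]]%SET|%:R
     * h <= 8 * `|L| + 4 * h)%R.
Proof.
move=> h0 vL vE; set B := finset _.
have BP (p : 'I_M * 'I_M) : exists z, p \in B -> E z /\ square (grid_point a h p.1 p.2) h z.
  have [|pB] := boolP (p \in B); last by exists 0.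
  by rewrite inE => /asboolP[z hz]; exists z.
have [zz zzP] := choice BP.
pose w p : R := (v (zz p) + `|L|) / h.
pose K := (Num.trunc (2 * `|L| / h)).+1.
have w0 p : p \in B -> 0 <= w p.
  move=> /zzP[/vL]; rewrite ler_norml => /andP[h1 _] _.
  by rewrite divr_ge0 ?(ltW h0) //; have := ler_norm L; lra.
have wK p : p \in B -> (Num.trunc (w p) < K)%N.
  move=> pB; rewrite ltnS; apply: le_truncn.
  rewrite ler_pM2r ?invr_gt0 //; have [/vL] := zzP _ pB.
  by rewrite ler_norml => /andP[_ h1] _; have := ler_norm L; lra.
pose code (p : 'I_M * 'I_M) : 'I_K * bool * bool :=
  (inord (Num.trunc (w p)), odd p.1, odd p.2).
have inj : {in B &, injective code}.
  move=> p p' pB p'B [/(congr1 val)]; rewrite /= !inordK ?wK // => ew o1 o2.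
  have [Ez /square_grid_point[sz1 sz2]] := zzP _ pB.
  have [Ez' /square_grid_point[sz1' sz2']] := zzP _ p'B.
  have ww : `|w p - w p'| < 1.
    have /andP[a1 a2] := truncn_itv (w0 _ pB).
    have /andP[b1 b2] := truncn_itv (w0 _ p'B).
    move: a1 a2 b1 b2; rewrite ew -!natr1 ltr_norml => a1 a2 b1 b2.
    by apply/andP; split; lra.
  have zz' : cabs (zz p - zz p') < h.
    rewrite (le_lt_trans (vE _ _ Ez Ez')) //.
    move: ww; rewrite -mulrBl normrM normfV (gtr0_norm h0) ltr_pdivrMr // mul1r.
    by rewrite opprD addrACA subrr addr0.
  have re : `|complex.Re (zz p) - complex.Re (zz p')| < h.
    by rewrite -ReB (le_lt_trans (Re_le_cabs _)).
  have im : `|complex.Im (zz p) - complex.Im (zz p')| < h.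
    by rewrite -ImB (le_lt_trans (Im_le_cabs _)).
  have e1 := index_close h0 re sz1 sz1' o1.
  have e2 := index_close h0 im sz2 sz2' o2.
  case: p p' e1 e2 {pB p'B ew o1 o2 Ez sz1 sz2 Ez' sz1' sz2' ww zz' re im} => [i j] [i' j'] /= e1 e2.
  by congr (_, _); apply: val_inj.
have cB : (#|B| <= K * 4)%N.
  have := card_in_imset inj => <-.
  have := max_card (mem [set code x | x in B]%SET).
  by rewrite !card_prod card_ord !card_bool -mulnA.
have : #|B|%:R * h <= (K * 4)%:R * h by rewrite ler_pM2r // ler_nat.
move=> hB; rewrite (le_trans hB) // natrM /K -natr1.
have K0 : 0 <= 2 * `|L| / h by rewrite divr_ge0 ?mulr_ge0 // ltW.
have /andP[t1 _] := truncn_itv K0.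
move: t1; rewrite ler_pdivlMr // => t1; lra.
Qed.

(** Cousin's lemma is applied to the existence of a modulus: the least of the four moduli serves the
    union of the quarters. Since z' may leave the square, pairs straddling two quarters are
    covered. *)
Lemma square_unif_continuous f a s (e : R) : continuous f -> 0 < s -> 0 < e ->
  exists2 d : R, 0 < d & forall z z', square a s z -> cabs (z' - z) < d ->
    cabs (f z' - f z) <= e.
Proof.
move=> fc s0 e0.
pose P b u := exists2 d : R, 0 < d & forall z z', square b u z -> cabs (z' - z) < d ->
    cabs (f z' - f z) <= e.
apply: (square_cousin (P := P)) => //.
  move=> b u u0 [d1 d10 D1] [d2 d20 D2] [d3 d30 D3] [d4 d40 D4].
  exists (Num.min (Num.min d1 d2) (Num.min d3 d4)).
    by rewrite !lt_min d10 d20 d30 d40.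
  move=> z z' /andP[/andP[h1 h2] /andP[h3 h4]]; rewrite !lt_min.
  move=> /andP[/andP[z1 z2] /andP[z3 z4]].
  have [r|r] := leP (complex.Re z) (complex.Re b + u / 2);
  have [i|i] := leP (complex.Im z) (complex.Im b + u / 2).
  - apply: D1 => //; rewrite /square; apply/andP; split; apply/andP; split; lra.
  - apply: D3 => //; rewrite /square !(ReD, ImD, Re_iM, Im_iM) /=.
    apply/andP; split; apply/andP; split; lra.
  - apply: D2 => //; rewrite /square !(ReD, ImD, Re_iM, Im_iM) /=.
    apply/andP; split; apply/andP; split; lra.
  - apply: D4 => //; rewrite /square !(ReD, ImD, Re_iM, Im_iM) /=.
    apply/andP; split; apply/andP; split; lra.
move=> z sz; have e20 : 0 < e / 2 by lra.
have /continuousCP/(_ _ e20)[r r0 rP] := fc z.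
exists (r / 4); first by lra.
move=> b u /andP[u0 ur] bz _; exists (r / 4); first by lra.
move=> x x' bx xx'.
have xz : cabs (x - z) < r by rewrite (le_lt_trans (cabs_square bx bz)) //; lra.
have x'z : cabs (x' - z) < r.
  rewrite (le_lt_trans (cabs_tri _ x _)) //.
  have := cabs_square bx bz; lra.
rewrite (le_trans (cabs_tri _ (f z) _)) // (cabs_distC (f z)).
have := rP _ xz; have := rP _ x'z; lra.
Qed.

(* The squares away from E contribute 0 by Goursat; each of the O(1/h) others
   contributes o(h) by uniform continuity. *)
Lemma painleve f (E : set C) a s : continuous f -> slim E -> 0 < s ->
  (forall z, ~ E z -> derivable f z 1) -> bdint f a s = 0.
Proof.
move=> fc [v [L [vL vE]]] s0 fd.
apply/eqP; rewrite -cabs_eq0 eq_le cabs_ge0 andbT.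
apply/ler_addgt0Pr => e e0; rewrite add0r.
(* The outer 4 comes from [bdint_osc]; the bracket bounds h times the number of bad squares, as h <=
   s. *)
pose K := 4 * (8 * `|L| + 4 * s).
have K0 : 0 < K by rewrite /K; have := normr_ge0 L; lra.
have e'0 : 0 < e / K by rewrite divr_gt0.
have [d d0 dP] := square_unif_continuous a fc s0 e'0.
have [N [N0 Nd]] : exists N, 0 < s / 2 ^+ N /\ 2 * (s / 2 ^+ N) < d.
  have [N NP] := ex_inv_lt (divr_gt0 d0 (mulr_gt0 (ltr0n R 2) s0)).
  exists N; split; first by rewrite divr_gt0 // exprn_gt0.
  rewrite mulrA ltr_pdivrMr ?exprn_gt0 //.
  have := NP N (leqnn _); rewrite ltr_pdivlMr ?mulr_gt0 //.
  have h2 : (N.+1%:R : R) <= 2 ^+ N by rewrite -natrX ler_nat ltn_expl.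
  have N0 : (0 : R) < N.+1%:R by rewrite ltr0n.
  rewrite mulrC ltr_pdivrMr // => h.
  by rewrite (lt_le_trans h) // ler_wpM2l // ltW.
set h := s / 2 ^+ N in N0 Nd.
have sh : s = 2 ^+ N * h by rewrite mulrC divfK // expf_neq0.
have hs : h <= s.
  rewrite sh ler_peMl ?(ltW N0) //; by rewrite exprn_ege1 // ler1n.
rewrite {1}sh bdint_grid // pair_big /=.
set B := [set p : 'I_(2 ^ N) * 'I_(2 ^ N) |
  `[< exists z, E z /\ square (grid_point a h p.1 p.2) h z >]]%SET.
have good (p : 'I_(2 ^ N) * 'I_(2 ^ N)) : p \notin B -> bdint f (grid_point a h p.1 p.2) h = 0.
  rewrite inE => /asboolP nE; apply: goursat => // z sz; apply: fd => Ez.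
  by apply: nE; exists z.
have bad (p : 'I_(2 ^ N) * 'I_(2 ^ N)) : cabs (bdint f (grid_point a h p.1 p.2) h) <= 4 * (e / K) * h.
  apply: (bdint_osc (z0 := grid_point a h p.1 p.2)) => //; first exact: ltW.
  have cc : square (grid_point a h p.1 p.2) h (grid_point a h p.1 p.2).
    by rewrite /square !lexx /= !lerDl ltW.
  move=> z sz; apply: dP; last by rewrite (le_lt_trans (cabs_square sz cc)).
  have := square_grid_point cc => -[/andP[h1 h2] /andP[h3 h4]].
  have bnd (i : 'I_(2 ^ N)) : 0 <= i%:R * h /\ i%:R * h + h <= s.
    split; first by rewrite mulr_ge0 // ltW.
    have -> : i%:R * h + h = (i%:R + 1) * h by ring.
    rewrite sh ler_pM2r // natr1 -natrX ler_nat; exact: ltn_ord.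
  have [i1 i2] := bnd p.1; have [j1 j2] := bnd p.2.
  by rewrite /square /grid_point !(ReD, ImD, Re_iM, Im_iM) /= !addr0;
    apply/andP; split; apply/andP; split; lra.
rewrite (bigID (mem B)) /= [X in cabs (_ + X)]big1 ?addr0; last first.
  by move=> p; exact: good.
rewrite (le_trans (cabs_sum _ _ _)) //.
rewrite (le_trans (ler_sum _ (fun p _ => bad p))) //.
rewrite sumr_const -[X in X <= _]mulr_natr.
have := card_bad_squares a (2 ^ N) N0 vL vE; rewrite -/B => cB.
have -> : 4 * (e / K) * h * #|B|%:R = (e / K) * (4 * (#|B|%:R * h)) by ring.
apply: (@le_trans _ _ ((e / K) * K)); last by rewrite divfK // gt_eqF.
rewrite ler_pM2l // /K; lra.
Qed.

End Painleve.

(** * A Liouville theorem for functions holomorphic off a slim set *)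

Section Liouville.
Context {R : realType}.
Local Notation C := (Cplx R).
Local Notation I := ('i%C : C).
Implicit Types f : C -> C.

(** The new point receives the coordinate |L| + M, which exceeds every v z by at least M, a bound
    for its distance to E. The added point will be the centre of a difference quotient, where only
    continuity is known. *)
Lemma slim_add_point (E : set C) a : slim E -> slim (E `|` [set a]).
Proof.
move=> [v [L [vL vE]]].
have [M [M0 MP]] : exists M : R, 0 <= M /\ forall z, E z -> cabs (a - z) <= M.
  have [[z0 Ez0]|nE] := pselect (exists z, E z); last first.
    by exists 0; split => // z Ez; case: nE; exists z.
  exists (cabs (a - z0) + 2 * `|L|); split => [|z Ez].
    by rewrite addr_ge0 ?cabs_ge0 ?mulr_ge0.
  rewrite (le_trans (cabs_tri _ z0 _)) // lerD2l (le_trans (vE _ _ Ez0 Ez)) //.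
  rewrite (le_trans (ler_normB _ _)) // mulrDl mul1r lerD //;
  by rewrite (le_trans (vL _ _)) // ler_norm.
have vL' z : E z -> v z <= `|L|.
  by move=> /vL h; rewrite (le_trans (ler_norm _)) // (le_trans h) // ler_norm.
exists (fun z => if z == a then `|L| + M else v z), (`|L| + M); split.
  move=> z [Ez|->]; last by rewrite eqxx ger0_norm // addr_ge0.
  case: eqP => _; first by rewrite ger0_norm // addr_ge0.
  by rewrite (le_trans (vL _ Ez)) // (le_trans (ler_norm _)) // lerDl.
have far z : E z -> cabs (a - z) <= `| `|L| + M - v z|.
  move=> Ez; rewrite (le_trans (MP _ Ez)) // ger0_norm; have := vL' z Ez; lra.
move=> z z' Ez Ez'; have [->|za] := eqVneq z a; have [->|z'a] := eqVneq z' a.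
- by rewrite !subrr cabs0 normr0.
- by apply: far; case: Ez' => // e; rewrite e eqxx in z'a.
- by rewrite cabs_distC distrC; apply: far; case: Ez => // e; rewrite e eqxx in za.
- case: Ez => [Ez|e]; last by rewrite e eqxx in za.
  by case: Ez' => [Ez'|e]; [exact: vE|rewrite e eqxx in z'a].
Qed.

(** The coordinate is V at a chosen parameter of the point; any choice works, so multiple points
    such as g 0 = g 1 are harmless. *)
Lemma slim_trace (g : R -> C) : good_curve g -> slim (trace g).
Proof.
move=> [_ [V gV]].
have tP z : exists t, trace g z -> t \in `[0, 1] /\ g t = z.
  have [[t t01 <-]|nz] := pselect (trace g z); first by exists t.
  by exists 0 => /nz.
have [t tz] := choice tP.
have Vm (s u : R) : 0 <= s -> s <= u -> u <= 1 -> V s <= V u.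
  by move=> s0 su u1; rewrite -subr_ge0 (le_trans _ (gV _ _ s0 su u1)) // cabs_ge0.
exists (V \o t), (`|V 0| + `|V 1|); split.
  move=> z /tz[]; rewrite in_itv /= => /andP[t0 t1] _.
  have := Vm 0 _ (lexx 0) t0 t1; have := Vm _ 1 t0 t1 (lexx 1).
  have := ler_norm (V 1); have := ler_norm (- V 0); rewrite normrN.
  have := normr_ge0 (V 0); have := normr_ge0 (V 1).
  by rewrite ler_norml => *; apply/andP; split; lra.
move=> z z' /tz[]; rewrite in_itv /= => /andP[t0 t1] e /tz[].
rewrite in_itv /= => /andP[t0' t1'] e'; rewrite -{1}e -{1}e'.
have [tt|tt] := leP (t z) (t z').
  by rewrite cabs_distC distrC (le_trans (gV _ _ t0 tt t1')) // ler_norm.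
by rewrite (le_trans (gV _ _ t0' (ltW tt) t1)) // ler_norm.
Qed.

Definition edges (a : C) (s : R) (x : C) : Prop :=
  [\/ trace (seg a s%:C) x, trace (seg (a + s%:C) (I * s%:C)) x,
      trace (seg (a + I * s%:C) s%:C) x | trace (seg a (I * s%:C)) x].

Lemma bdint_lin_on (f h k : C -> C) a s (c : C) :
  (forall x, edges a s x -> [/\ {for x, continuous f}, {for x, continuous h} &
     k x = c * f x + h x]) ->
  bdint k a s = c * bdint f a s + bdint h a s.
Proof.
move=> H; rewrite /bdint.
rewrite (@sint_lin_on _ f h k a s%:C c); last by move=> x hx; apply: H; constructor 1.
rewrite (@sint_lin_on _ f h k _ (I * s%:C) c); last by move=> x hx; apply: H; constructor 2.
rewrite (@sint_lin_on _ f h k _ s%:C c); last by move=> x hx; apply: H; constructor 3.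
rewrite (@sint_lin_on _ f h k a (I * s%:C) c); last by move=> x hx; apply: H; constructor 4.
ring.
Qed.

(** A pointwise lower bound on the integrand passes to the uniform sums, which are averages, and
    then to the limit. *)
Lemma Im_sint_ge f a d (c : C) (m : R) :
  (forall x, trace (seg a d) x -> {for x, continuous f}) ->
  (forall t : R, 0 <= t <= 1 -> m <= complex.Im (c * (f (seg a d t) * d))) ->
  m <= complex.Im (c * sint f a d).
Proof.
move=> fc H; apply/ler_addgt0Pr => e e0.
have cl : (fun n => c * usum f a d n.+1) @ \oo --> c * sint f a d.
  exact: (cvgC_scale (sint_usum fc)).
have /cvgCP/(_ _ e0)[N _ /(_ N (leqnn _)) /= h] := cl.
have h1 := le_lt_trans (le_trans (ler_norm _) (Im_le_cabs _)) h.
have : m <= complex.Im (c * usum f a d N.+1); last first.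
  by move: h1; rewrite ImB; lra.
have ImZ (n : nat) (x : C) : complex.Im (x / n.+1%:R) = complex.Im x / n.+1%:R.
  have -> : x / n.+1%:R = (n.+1%:R^-1 : R)%:C * x.
    by rewrite fmorphV rmorph_nat mulrC.
  by rewrite ImRM mulrC.
have -> : complex.Im (c * usum f a d N.+1) =
    \sum_(k < N.+1) complex.Im (c * (f (seg a d (k%:R / N.+1%:R)) * d)) / N.+1%:R.
  rewrite /usum mulr_sumr (big_morph (@complex.Im R) (@ImD R) (erefl _)).
  apply: eq_bigr => k _; rewrite -ImZ -!mulrA /seg.
  by rewrite rmorphM fmorphV !rmorph_nat -!mulrA.
have -> : m = \sum_(k < N.+1) (m / N.+1%:R).
  by rewrite sumr_const card_ord -mulrnAr -[_ *+ _]mulr_natr mulVf ?mulr1 // pnatr_eq0.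
apply: ler_sum => k _; rewrite ler_pM2r ?invr_gt0 ?ltr0n //; apply: H.
by rewrite divr_ge0 //= ler_pdivrMr ?ltr0n // mul1r ler_nat ltnW.
Qed.

Lemma Im_div (z w : C) : complex.Im (z / w) =
  (complex.Im z * complex.Re w - complex.Re z * complex.Im w) /
  (complex.Re w ^+ 2 + complex.Im w ^+ 2).
Proof. by case: z w => [a b] [c d] /=; ring. Qed.

Lemma continuous_inv_sub (a x : C) : x != a -> {for x, continuous (fun z => (z - a)^-1)}.
Proof.
move=> xa; apply: (@sdiff_continuous _ setT _ x) => //.
apply: sdiffV => //; last by rewrite subr_eq0.
by apply: sdiffB => //; [exact: sdiff_id|exact: sdiff_cst].
Qed.

(** Lower left corner of the square with centre a and side 2 * r. *)
Definition corner (a : C) (r : R) : C := a - r%:C - I * r%:C.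

Lemma corner_edges a (r : R) : 0 < r -> forall x,
  edges (corner a r) (2 * r) x ->
  r <= cabs (x - a).
Proof.
move=> r0 x H.
suff : r <= `|complex.Re (x - a)| \/ r <= `|complex.Im (x - a)|.
  by case=> h; apply: (le_trans h); [exact: Re_le_cabs|exact: Im_le_cabs].
case: H => -[t _ <-]; [right|left|right|left];
rewrite /seg /corner !(ReB, ImB, ReD, ImD, ReRM, ImRM, Re_iM, Im_iM) /= ?mulr0.
- by rewrite ler_normr; apply/orP; right; lra.
- by rewrite ler_normr; apply/orP; left; lra.
- by rewrite ler_normr; apply/orP; left; lra.
- by rewrite ler_normr; apply/orP; right; lra.
Qed.

(** The true value is 2 * pi; a positive lower bound independent of r is what [liouville] uses. Each
    edge gives at least 1: at offset u = (2 * t - 1) * r along the edge the imaginary part of the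
    integrand is 2 * r^2 / (r^2 + u^2), and |u| <= r. *)
Lemma bdint_inv a (r : R) : 0 < r ->
  4 <= complex.Im (bdint (fun z => (z - a)^-1) (corner a r) (2 * r)).
Proof.
move=> r0.
have fc x : edges (corner a r) (2 * r) x ->
    {for x, continuous (fun z => (z - a)^-1)}.
  move=> /(corner_edges r0) h; apply: continuous_inv_sub.
  by rewrite -subr_eq0 -cabs_gt0 (lt_le_trans r0).
have key (u : R) : u ^+ 2 <= r ^+ 2 -> 1 <= 2 * r ^+ 2 / (r ^+ 2 + u ^+ 2).
  move=> h; have r2 : 0 < r ^+ 2 by rewrite exprn_gt0.
  have u2 : 0 <= u ^+ 2 by rewrite sqr_ge0.
  by rewrite ler_pdivlMr; lra.
have sq (t : R) : 0 <= t <= 1 -> ((2 * t - 1) * r) ^+ 2 <= r ^+ 2.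
  move=> /andP[t0 t1]; rewrite exprMn ler_piMl ?sqr_ge0 //.
  rewrite -subr_ge0 (_ : 1 - _ = 4 * t * (1 - t)); last by ring.
  by rewrite !mulr_ge0 // subr_ge0.
have e1 : 1 <= complex.Im (1 * sint (fun z => (z - a)^-1) (corner a r) (2 * r)%:C).
  apply: Im_sint_ge => [x hx|t t01]; first by apply: fc; constructor 1.
  rewrite mul1r mulrC Im_div /seg /corner.
  rewrite !(ReB, ImB, ReD, ImD, ReRM, ImRM, Re_iM, Im_iM) /=.
  apply: le_trans (key ((2 * t - 1) * r) (sq t t01)) _.
  rewrite le_eqVlt; apply/orP; left; apply/eqP; congr (_ / _); ring.
have e2 : 1 <= complex.Im (1 * sint (fun z => (z - a)^-1) (corner a r + (2 * r)%:C) (I * (2 * r)%:C)).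
  apply: Im_sint_ge => [x hx|t t01]; first by apply: fc; constructor 2.
  rewrite mul1r mulrC Im_div /seg /corner.
  rewrite !(ReB, ImB, ReD, ImD, ReRM, ImRM, Re_iM, Im_iM) /=.
  apply: le_trans (key ((2 * t - 1) * r) (sq t t01)) _.
  rewrite le_eqVlt; apply/orP; left; apply/eqP; congr (_ / _); ring.
have e3 : 1 <= complex.Im (-1 * sint (fun z => (z - a)^-1) (corner a r + I * (2 * r)%:C) (2 * r)%:C).
  apply: Im_sint_ge => [x hx|t t01]; first by apply: fc; constructor 3.
  rewrite [_ * (2 * r)%:C]mulrC mulrA Im_div mulN1r /seg /corner.
  rewrite !(ReB, ImB, ReD, ImD, ReRM, ImRM, Re_iM, Im_iM) /=.
  apply: le_trans (key ((2 * t - 1) * r) (sq t t01)) _.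
  rewrite le_eqVlt; apply/orP; left; apply/eqP; congr (_ / _); ring.
have e4 : 1 <= complex.Im (-1 * sint (fun z => (z - a)^-1) (corner a r) (I * (2 * r)%:C)).
  apply: Im_sint_ge => [x hx|t t01]; first by apply: fc; constructor 4.
  rewrite [_ * (I * _)]mulrC mulrA Im_div mulN1r /seg /corner.
  rewrite !(ReB, ImB, ReD, ImD, ReRM, ImRM, Re_iM, Im_iM) /=.
  apply: le_trans (key ((2 * t - 1) * r) (sq t t01)) _.
  rewrite le_eqVlt; apply/orP; left; apply/eqP; congr (_ / _); ring.
move: e1 e2 e3 e4; rewrite /bdint !mul1r !mulN1r !ImB !ImD.
have ImN (x : C) : complex.Im (- x) = - complex.Im x by case: x.
rewrite !ImN; lra.
Qed.

(* The difference quotient (f - f a) / (z - a), extended continuously to a, has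
   integral 0 over large squares by painleve. The part due to f / (z - a)
   tends to 0, so f a times the integral of 1 / (z - a) vanishes. *)
Lemma liouville f (E : set C) : continuous f -> slim E ->
  (forall z, ~ E z -> derivable f z 1) ->
  (forall e : R, 0 < e -> exists r : R, forall z, r < cabs z -> cabs (f z) <= e) ->
  forall a, ~ E a -> f a = 0.
Proof.
move=> fc Es fd flim a Ea.
have /derivable_sdiff[phi [d [fphi phid]]] := fd a Ea.
pose g z := if z == a then d else (f z - f a) / (z - a).
have fq z : z != a -> sdiff setT (fun x => (x - a)^-1) z.
  move=> za; apply: sdiffV; rewrite ?subr_eq0 //.
  by apply: sdiffB => //; [exact: sdiff_id|exact: sdiff_cst].
have gq z : z != a -> exists2 r : R, 0 < r & forall x, cabs (x - z) < r ->
    g x = (f x - f a) * (x - a)^-1.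
  move=> za; exists (cabs (z - a)); first by rewrite cabs_gt0 subr_eq0.
  move=> x xz; rewrite /g; case: eqP => // e; move: xz.
  by rewrite e cabs_distC ltxx.
have gc : continuous g.
  move=> z; have [->|za] := eqVneq z a.
    apply/continuousCP => e e0; move: phid => /cvgCP/(_ _ e0) h.
    have [r r0 rP] := filterI fphi h; exists r => // x xa.
    rewrite /g eqxx; case: eqP => [_|/eqP xa0]; first by rewrite subrr cabs0.
    have [|/= e1 e2] := rP (x, a); first by split => //=; rewrite subrr cabs0.
    by rewrite e1 mulfK // subr_eq0.
  have [r r0 rP] := gq z za.
  have /continuousCP c1 : {for z, continuous (fun x => (f x - f a) * (x - a)^-1)}.
    have c2 : (fun x => f x - f a) @ z --> f z - f a.
      exact: (cvgC_add (fc z) (@continuous_cstC _ (- f a) z)).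
    exact: (cvgC_mul c2 (sdiff_continuousT (fq z za))).
  apply/continuousCP => e /c1[r' r'0 r'P]; exists (Num.min r r').
    by rewrite lt_min r0.
  move=> x; rewrite lt_min => /andP[xr xr']; rewrite !rP ?r'P //.
  by rewrite subrr cabs0.
have gd z : ~ (E `|` [set a]) z -> derivable g z 1.
  move=> /not_orP[nE /eqP za]; apply/derivable_sdiff.
  have [r r0 rP] := gq z za.
  apply: (@sdiff_near _ _ (fun x => (f x - f a) * (x - a)^-1)); last by exists r.
  apply: sdiffM => //; last by apply: (sdiff_sub _ (fq z za)).
  by apply: sdiffB => //; [exact/derivable_sdiff/fd|exact: sdiff_cst].
have B0 r : 0 < r -> bdint g (corner a r) (2 * r) = 0.
  by move=> r0; apply: (painleve _ gc (slim_add_point a Es) _ gd); rewrite mulr_gt0.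
apply/eqP; rewrite -cabs_eq0 eq_le cabs_ge0 andbT.
apply/ler_addgt0Pr => e e0; rewrite add0r.
have e20 : 0 < e / 2 by lra.
have [r0 rP] := flim _ e20.
(* Points at distance at least r from a have modulus above r0, where f is at most e / 2. *)
pose r := Num.max 1 (r0 + cabs a + 1).
have r_gt0 : 0 < r by rewrite lt_max ltr01.
have far x : r <= cabs (x - a) -> cabs (f x) <= e / 2.
  rewrite ge_max => /andP[_ h]; apply: rP.
  have := cabsB x a; lra.
have e_ne x : edges (corner a r) (2 * r) x -> x != a /\ r <= cabs (x - a).
  move=> /(corner_edges r_gt0) h; split => //.
  by rewrite -subr_eq0 -cabs_gt0 (lt_le_trans r_gt0).
pose h x := f x * (x - a)^-1.
have hc x : x != a -> {for x, continuous h}.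
  by move=> xa; exact: (cvgC_mul (fc x) (sdiff_continuousT (fq x xa))).
have := B0 r r_gt0.
rewrite (@bdint_lin_on (fun x => (x - a)^-1) h g _ _ (- f a)); last first.
  move=> x /e_ne[xa _]; split; [exact: continuous_inv_sub|exact: hc|].
  by rewrite /g (negbTE xa) /h; ring.
move=> /eqP; rewrite mulNr addrC subr_eq0 => /eqP e1.
have hb : cabs (bdint h (corner a r) (2 * r)) <= 4 * (e / 2 / r) * (2 * r).
  apply: bdint_bound => [|x /e_ne[xa h1]]; first by rewrite mulr_ge0 // ltW.
  split; first exact: hc.
  rewrite /h cabsM cabsV ler_pM ?cabs_ge0 ?invr_ge0 ?cabs_ge0 //; first exact: far.
  by rewrite lef_pV2 // posrE // (lt_le_trans r_gt0).
have := le_trans (bdint_inv a r_gt0) (le_trans (ler_norm _) (Im_le_cabs _)).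
move: hb; rewrite e1 cabsM; set B := cabs (bdint _ _ _).
have -> : 4 * (e / 2 / r) * (2 * r) = 4 * e.
  by field; rewrite gt_eqF.
move=> h1 h2; have ca := cabs_ge0 (f a).
have : cabs (f a) * 4 <= cabs (f a) * B by rewrite ler_wpM2l.
lra.
Qed.

End Liouville.

(** * Rectifiable curves: the two sides and the winding number *)

Section Curves.
Context {R : realType}.
Local Notation C := (Cplx R).
Implicit Types (g : R -> C) (z y : C).

(** V is the sum of the variation functions of the real and imaginary parts; additivity over
    adjacent intervals makes its increments the variations. *)
Lemma rectifiable_dominated (g : R -> C) : rectifiable g -> exists V, dominated g V.
Proof.
move=> [bR bI].
pose tv (f : R -> R) t := fine (total_variation 0 t f).
have key (f : R -> R) s t : bounded_variation 0 1 f -> 0 <= s -> s <= t -> t <= 1 ->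
    `|f t - f s| <= tv f t - tv f s.
  move=> bf s0 st t1.
  have t0 := le_trans s0 st.
  have bt := bounded_variationl t0 t1 bf.
  have bs := bounded_variationl s0 st bt.
  have br := bounded_variationr s0 st bt.
  have /(bounded_variationP _ t0) ft := bt.
  have /(bounded_variationP _ s0) fs := bs.
  have /(bounded_variationP _ st) fr := br.
  have := total_variation_ge f st.
  rewrite -(fineK fr) lee_fin => /le_trans; apply.
  by rewrite /tv (total_variationD f s0 st) fineD // addrC addKr.
exists (fun t => tv (fun t => complex.Re (g t)) t + tv (fun t => complex.Im (g t)) t).
move=> s t s0 st t1; rewrite (le_trans (cabs_le_ReIm _)) // ReB ImB.
have := key _ _ _ bR s0 st t1; have := key _ _ _ bI s0 st t1; lra.
Qed.

Lemma good_curve_rectifiable (g : R -> C) : jordan_curve g -> rectifiable g ->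
  good_curve g.
Proof. by move=> [gc _ _] /rectifiable_dominated. Qed.

Lemma tube_trace (g : R -> C) (P : R -> C -> Prop) : {within `[0, 1], continuous g} ->
  (forall x, trace g x -> exists2 r : R, 0 < r & forall d x', 0 < d < r ->
     trace g x' -> cabs (x' - x) < r -> P d x') ->
  exists2 r : R, 0 < r & forall d x, 0 < d < r -> trace g x -> P d x.
Proof.
move=> /within01P gc H.
have [r r0 rP] : exists2 r : R, 0 < r & forall d t, 0 < d < r -> t \in `[0, 1] -> P d (g t).
  apply: tube01 => t t01; have gt : trace g (g t) by exists t.
  have [r r0 rP] := H _ gt; have [r' r'0 r'P] := gc t t01 r r0.
  exists (Num.min r r'); first by rewrite lt_min r0.
  move=> d t' /andP[d0]; rewrite !lt_min => /andP[dr dr'] t'01 /andP[tr tr'].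
  by apply: rP; rewrite ?d0 //; [exists t'|exact: r'P].
by exists r => // d _ dr [t t01 <-]; exact: rP.
Qed.

Lemma trace_far (g : R -> C) z : {within `[0, 1], continuous g} -> ~ trace g z ->
  exists2 r : R, 0 < r & forall x, trace g x -> r <= cabs (x - z).
Proof.
move=> gc gz; have [|r r0 rP] := @tube_trace g (fun d x => d <= cabs (x - z)) gc.
  move=> x gx; exists (cabs (x - z) / 2) => [|d x' /andP[d0 dr] _ xx].
    rewrite divr_gt0 // cabs_gt0 subr_eq0; apply/eqP => e; by rewrite e in gx.
  have := cabs_tri x x' z; rewrite (cabs_distC x x'); lra.
by exists (r / 2) => [|x gx]; [lra|apply: rP => //; lra].
Qed.

Lemma trace_bounded (g : R -> C) : {within `[0, 1], continuous g} ->
  exists2 r : R, 0 < r & forall x, trace g x -> cabs x <= r.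
Proof.
move=> gc; have [|r r0 rP] := @tube_trace g (fun d x => d * cabs x <= 1) gc.
  move=> x gx; have k0 : 0 < cabs x + 1 by rewrite ltr_wpDl // cabs_ge0.
  exists (Num.min 1 (cabs x + 1)^-1); first by rewrite lt_min ltr01 invr_gt0.
  move=> d x' /andP[d0]; rewrite !lt_min => /andP[d1 dx] _ /andP[xx _].
  have h : cabs x' <= cabs x + 1.
    have := cabs_rev x' x; lra.
  rewrite (@le_trans _ _ (d * (cabs x + 1))) //; first by rewrite ler_wpM2l // ltW.
  by rewrite -ler_pdivlMr // mul1r ltW.
have r20 : 0 < r / 2 by lra.
exists (r / 2)^-1 => [|x gx]; first by rewrite invr_gt0.
rewrite -[_^-1]mul1r ler_pdivlMr // mulrC; apply: rP => //; lra.
Qed.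

Lemma bounded_setCP (A : set C) : bounded_set A <->
  exists M : R, forall x, A x -> cabs x <= M.
Proof.
split=> [[M [Mr H]]|[M MP]].
  exists (complex.Re M + 1) => x Ax; rewrite -lecR -cabsE.
  apply: (H (complex.Re M + 1)%:C) => //.
  by rewrite -{1}(RRe_real Mr) ltcR ltrDl.
exists M%:C; split; first by apply/complex_realP; exists M.
by move=> x Mx y Ay; rewrite /= (le_trans _ (ltW Mx)) // cabsE lecR MP.
Qed.

Lemma segment_component (A : set C) z y :
  (forall t : R, 0 <= t <= 1 -> A (seg z (y - z) t)) -> connected_component A z y.
Proof.
move=> H.
have s1 : trace (seg z (y - z)) y.
  exists 1; rewrite /= ?in_itv /= ?ler01 ?lexx //.
  by rewrite /seg mul1r addrC subrK.
have s0 : trace (seg z (y - z)) z.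
  exists 0; rewrite /= ?in_itv /= ?ler01 ?lexx //.
  by rewrite /seg mul0r addr0.
apply: (connected_component_max (B := trace (seg z (y - z)))) => //.
  by move=> _ [t + <-]; rewrite /= in_itv => /H.
apply: connected_continuous_connected; first exact: segment_connected.
exact: seg_continuous.
Qed.

Lemma inside_component g z y : connected_component (~` trace g) z y ->
  inside g z <-> inside g y.
Proof.
move=> zy; have Ay := connected_component_sub zy.
have Az := connected_component_sub (connected_component_sym zy).
by rewrite /inside /= (same_connected_component zy); split=> -[].
Qed.

Lemma outside_component g z y : connected_component (~` trace g) z y ->
  outside g z <-> outside g y.
Proof.
move=> zy; have Ay := connected_component_sub zy.
have Az := connected_component_sub (connected_component_sym zy).
by rewrite /outside /= (same_connected_component zy); split=> -[].
Qed.

Lemma seg_close z y (t : R) : 0 <= t <= 1 -> cabs (seg z (y - z) t - z) <= cabs (y - z).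
Proof.
move=> /andP[t0 t1]; rewrite /seg addrC addKr cabsM cabs_real ger0_norm //.
by rewrite ler_piMl // cabs_ge0.
Qed.

Lemma ball_component g z (r : R) : (forall x, trace g x -> r <= cabs (x - z)) ->
  forall y, cabs (y - z) < r -> connected_component (~` trace g) z y.
Proof.
move=> H y yz; apply: segment_component => t t01 /H.
by have := seg_close z y t01; lra.
Qed.

Lemma inside_outside g z : ~ trace g z -> inside g z \/ outside g z.
Proof.
move=> gz; have [b|nb] := pselect (bounded_set (connected_component (~` trace g) z)).
  by left.
by right.
Qed.

Lemma inside_not_outside g z : inside g z -> outside g z -> False.
Proof. by move=> [_ b] [_ nb]. Qed.

Lemma inside_open g z : {within `[0, 1], continuous g} -> inside g z ->
  exists2 r : R, 0 < r & forall y, cabs (y - z) < r -> inside g y.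
Proof.
move=> gc iz; have [r r0 rP] := trace_far gc iz.1; exists r => // y yz.
exact/(inside_component (ball_component rP yz)).
Qed.

Lemma outside_open g z : {within `[0, 1], continuous g} -> outside g z ->
  exists2 r : R, 0 < r & forall y, cabs (y - z) < r -> outside g y.
Proof.
move=> gc iz; have [r r0 rP] := trace_far gc iz.1; exists r => // y yz.
exact/(outside_component (ball_component rP yz)).
Qed.

(** The ray from z away from 0 avoids the disc that contains the curve, and it is unbounded. *)
Lemma outside_large g (r : R) z : (forall x, trace g x -> cabs x <= r) -> r < cabs z ->
  outside g z.
Proof.
move=> gr rz; split=> [/gr|/bounded_setCP[M MP]]; first by lra.
have z0 : 0 < cabs z.
  rewrite lt_neqAle cabs_ge0 andbT eq_sym; apply/eqP => zz0.
  have [x gx] : exists x, trace g x by exists (g 0), 0; rewrite //= in_itv /= lexx ler01.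
  have := gr x gx; have := cabs_ge0 x; lra.
(* Chosen so that u * z lies on the ray and has modulus greater than M. *)
pose u := Num.max 1 (M / cabs z + 1).
have u1 : 1 <= u by rewrite le_max lexx.
have : M / cabs z + 1 <= u by rewrite le_max lexx orbT.
have uz : connected_component (~` trace g) z (u%:C * z).
  apply: segment_component => t /andP[t0 t1] /gr.
  have -> : seg z (u%:C * z - z) t = (1 + t * (u - 1))%:C * z.
    rewrite /seg rmorphD rmorphM rmorphB /= rmorph1; ring.
  have h : 1 <= 1 + t * (u - 1) by rewrite lerDl mulr_ge0 // subr_ge0.
  rewrite cabsM cabs_real ger0_norm ?(le_trans ler01) //.
  have : cabs z <= (1 + t * (u - 1)) * cabs z by rewrite ler_peMl // ltW.
  lra.
have := MP _ uz; rewrite cabsM cabs_real ger0_norm ?(le_trans ler01) // => h1 h2.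
have : (M / cabs z + 1) * cabs z <= u * cabs z by rewrite ler_pM2r.
rewrite mulrDl divfK ?gt_eqF //; lra.
Qed.

Definition wnum (g : R -> C) z := contour_integral g (fun x => (x - z)^-1).

Lemma is_int_wnum g z : good_curve g -> ~ trace g z ->
  is_int g (fun x => (x - z)^-1) (wnum g z).
Proof.
move=> gg gz; apply: is_int_cont => // x gx; apply: continuous_inv_sub.
by apply/eqP => e; rewrite e in gx.
Qed.

(** With h = 1 / (g - z), the product h (s k.+1) * h (s k) times the increment of g equals h (s k) -
    h (s k.+1), which telescopes to 0 on a closed curve. Replacing that product by the square of h
    at the tag costs little, by uniform continuity of h. *)
Lemma is_int_inv_sqr g z : good_curve g -> g 0 = g 1 -> ~ trace g z ->
  is_int g (fun x => (x - z)^-1 ^+ 2) 0.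
Proof.
move=> gg g01 gz; have [gc [V gV]] := gg.
have [r r0 rP] := trace_far gc gz.
pose h t := (g t - z)^-1.
have hc : {within `[0, 1], continuous h}.
  apply: (continuous_comp01 gc (f := fun x => (x - z)^-1)) => x gx.
  by apply: continuous_inv_sub; apply/eqP => e; rewrite e in gx.
have gt t : t \in `[0, 1] -> trace g (g t) by exists t.
have gz0 t : t \in `[0, 1] -> g t - z != 0.
  by move=> /gt/rP h1; rewrite -cabs_gt0 (lt_le_trans r0).
have hb t : t \in `[0, 1] -> cabs (h t) <= r^-1.
  move=> t01; rewrite cabsV lef_pV2 ?posrE ?cabs_gt0 ?gz0 //.
  exact/rP/gt.
have VV : 0 <= V 1 - V 0 by rewrite (le_trans _ (gV _ _ _ _ _)) ?cabs_ge0.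
apply/cvgCP => e e0.
pose K := 2 * r^-1 * (V 1 - V 0) + 1.
have K0 : 0 < K by rewrite ltr_wpDl // !mulr_ge0 // invr_ge0 ltW.
have [d d0 dP] := unif_continuous01 hc (divr_gt0 e0 K0).
apply: filterS (near_mesh d0) => P [sP tP]; rewrite subr0.
rewrite stieltjes_rsum /rsum; set s := fun k => _ in sP tP *.
have t01 k : (k <= size P.1)%N -> s k \in `[0, 1].
  by move=> kn; rewrite in_itv /=; exact: (subdivision01 sP).
have tel : \sum_(k < size P.1) (h (s k.+1) - h (s k)) = 0.
  by rewrite -(subdivision_telescope h sP) /h g01 subrr.
have -> : \sum_(k < size P.1) ((fun x => (x - z)^-1 ^+ 2) \o g) (P.2 k) * (g (s k.+1) - g (s k)) =
   \sum_(k < size P.1) (h (P.2 k) ^+ 2 - h (s k.+1) * h (s k)) * (g (s k.+1) - g (s k)).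
  rewrite -[LHS]addr0 -[X in _ + X = _]tel -big_split; apply: eq_bigr => k _ /=.
  rewrite mulrBl -/(h _); congr (_ + _); rewrite /h.
  by field; rewrite !gz0 // t01 // ltnW.
rewrite (le_lt_trans (cabs_sum _ _ _)) //.
apply: (@le_lt_trans _ _ (2 * r^-1 * (e / K) * (V 1 - V 0))); last first.
  rewrite [X in X < _](_ : _ = e / K * (2 * r^-1 * (V 1 - V 0))); last by ring.
  by rewrite mulrAC ltr_pdivrMr // ltr_pM2l // /K ltrDl.
rewrite (subdivision_telescope V sP) mulr_sumr; apply: ler_sum => k _.
have [a1 a2 a3] := tP k (ltn_ord k).
have s1 := t01 _ (ltn_ord k); have s0 := t01 _ (ltnW (ltn_ord k)).
have tt : P.2 k \in `[0, 1].
  move: s0 s1; rewrite !in_itv /= => /andP[? ?] /andP[? ?].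
  by apply/andP; split; lra.
case: (sP) => _ _ hs.
rewrite cabsM ler_pM ?cabs_ge0 //; last first.
  move: s0 s1; rewrite !in_itv /= => /andP[? ?] /andP[? ?].
  by apply: gV => //; exact: hs.
have -> : h (P.2 k) ^+ 2 - h (s k.+1) * h (s k) =
    h (P.2 k) * (h (P.2 k) - h (s k)) + h (s k) * (h (P.2 k) - h (s k.+1)) by ring.
rewrite (le_trans (cabsD _ _)) // !cabsM -mulrA mulrDl mul1r lerD //.
  by rewrite ler_pM ?cabs_ge0 ?hb // ltW // dP // ger0_norm; lra.
by rewrite ler_pM ?cabs_ge0 ?hb // ltW // dP // ler0_norm; lra.
Qed.

(** The first-order variation is a multiple of the integral of 1 / (x - y')^2, which is 0, so wnum
    changes by O(|y - y'|^2). Cutting the segment from z to y into n + 1 equal pieces bounds the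
    total change by a constant over n + 1, for every n. *)
Lemma wnum_near g z : good_curve g -> g 0 = g 1 -> ~ trace g z ->
  exists2 r : R, 0 < r & forall y, cabs (y - z) < r -> wnum g y = wnum g z.
Proof.
move=> gg g01 gz; have [gc [V gV]] := gg.
have [r r0 rP] := trace_far gc gz.
have VV : 0 <= V 1 - V 0 by rewrite (le_trans _ (gV _ _ _ _ _)) ?cabs_ge0.
have far y x : cabs (y - z) < r / 2 -> trace g x -> r / 2 <= cabs (x - y).
  move=> yz /rP h; have := cabs_tri x y z; lra.
pose K := (r / 2)^-1 ^+ 3 * (V 1 - V 0).
have r20 : 0 < r / 2 by lra.
have est y y' : cabs (y - z) < r / 2 -> cabs (y' - z) < r / 2 ->
    cabs (wnum g y - wnum g y') <= K * cabs (y - y') ^+ 2.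
  move=> yz y'z.
  have gy : ~ trace g y by move=> /(far y _ yz); rewrite subrr cabs0; lra.
  have gy' : ~ trace g y' by move=> /(far y' _ y'z); rewrite subrr cabs0; lra.
  have i1 := is_int_lin (a := - 1) (is_int_wnum gg gy') (is_int_wnum gg gy).
  have i2 := is_int_lin (a := - (y - y')) (is_int_inv_sqr gg g01 gy') i1.
  rewrite mulr0 add0r mulN1r [- wnum g y' + _]addrC in i2.
  rewrite /K mulrAC.
  apply: (is_int_bound gV i2) => x gx.
  have x1 := far _ _ yz gx; have x2 := far _ _ y'z gx.
  have x10 : x - y != 0 by rewrite -cabs_gt0 (lt_le_trans r20).
  have x20 : x - y' != 0 by rewrite -cabs_gt0 (lt_le_trans r20).
  have -> : - (y - y') * (x - y')^-1 ^+ 2 + (-1 * (x - y')^-1 + (x - y)^-1) =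
      (x - y)^-1 * ((x - y')^-1 * (x - y')^-1) * (y - y') ^+ 2.
    by field; rewrite x10 x20.
  rewrite cabsM cabsX ler_wpM2r ?exprn_ge0 ?cabs_ge0 //.
  rewrite !cabsM !cabsV !exprS expr0 mulr1.
  have i x' : r / 2 <= cabs x' -> (cabs x')^-1 <= (r / 2)^-1.
    by move=> h; rewrite lef_pV2 // posrE // (lt_le_trans r20).
  by rewrite !ler_pM ?mulr_ge0 ?invr_ge0 ?cabs_ge0 ?i.
exists (r / 2) => // y yz.
apply/eqP; rewrite -subr_eq0 -cabs_eq0 eq_le cabs_ge0 andbT.
have K0 : 0 <= K by rewrite mulr_ge0 // exprn_ge0 // invr_ge0 ltW.
have est2 n : cabs (wnum g y - wnum g z) <= K * cabs (y - z) ^+ 2 / n.+1%:R.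
  pose p k : C := z + k%:R / n.+1%:R * (y - z).
  have n0 : n.+1%:R != 0 :> C by rewrite pnatr_eq0.
  have pz k : (k <= n.+1)%N -> cabs (p k - z) < r / 2.
    move=> kn; rewrite /p addrC addKr cabsM (le_lt_trans _ yz) // ler_piMl ?cabs_ge0 //.
    have -> : k%:R / n.+1%:R = (k%:R / n.+1%:R : R)%:C :> C.
      by rewrite rmorphM fmorphV !rmorph_nat.
    rewrite cabs_real ger0_norm ?divr_ge0 // ler_pdivrMr ?ltr0n // mul1r.
    by rewrite ler_nat.
  have -> : wnum g y - wnum g z = \sum_(k < n.+1) (wnum g (p k.+1) - wnum g (p k)).
    rewrite -(big_mkord xpredT (fun k => wnum g (p k.+1) - wnum g (p k))).
    rewrite (telescope_sumr (fun k => wnum g (p k))) //.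
    by rewrite /p divff // mul1r [z + _]addrC subrK !mul0r addr0.
  rewrite (le_trans (cabs_sum _ _ _)) //.
  apply: (@le_trans _ _ (\sum_(k < n.+1) K * (cabs (y - z) / n.+1%:R) ^+ 2)).
    apply: ler_sum => k _; rewrite (le_trans (est _ _ (pz _ _) (pz _ _))) //.
      exact: ltnW.
    rewrite ler_wpM2l // le_eqVlt; apply/orP; left; apply/eqP; congr (_ ^+ 2).
    have -> : p k.+1 - p k = (n.+1%:R^-1 : R)%:C * (y - z).
      by rewrite /p fmorphV rmorph_nat -[k.+1%:R]natr1; ring.
    by rewrite cabsM cabs_real ger0_norm ?invr_ge0 // mulrC.
  rewrite sumr_const card_ord -[X in X <= _]mulr_natr le_eqVlt; apply/orP; left.
  apply/eqP; have : n.+1%:R != 0 :> R by rewrite pnatr_eq0.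
  by move: (n.+1%:R) => N N0; field.
apply/ler_addgt0Pr => e e0; rewrite add0r.
have K1 : 0 < K * cabs (y - z) ^+ 2 + 1.
  by rewrite ltr_wpDl // mulr_ge0 // exprn_ge0 // cabs_ge0.
have [N /(_ N (leqnn _)) NP] := ex_inv_lt (divr_gt0 e0 K1).
rewrite (le_trans (est2 N)) //.
move: NP; rewrite ltr_pdivlMr // => NP.
rewrite mulrC (le_trans _ (ltW NP)) // ler_wpM2l ?invr_ge0 //; lra.
Qed.

Lemma wnum_component g z y : good_curve g -> g 0 = g 1 ->
  connected_component (~` trace g) z y -> wnum g y = wnum g z.
Proof.
move=> gg g01 zy; set B := connected_component (~` trace g) z.
have Az : B z by apply: connected_component_refl; exact: (connected_component_sub (connected_component_sym zy)).
(* Used with Q the identity and Q the negation: by local constancy both equality and inequality with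
   [wnum g z] are open conditions, so equality is clopen in the component. *)
have oc (Q : Prop -> Prop) : open [set u | ~ trace g u /\ Q (wnum g u = wnum g z)].
  apply/openCP => u [gu Qu]; have [r r0 rP] := wnum_near gg g01 gu.
  have [r' r'0 r'P] := trace_far gg.1 gu.
  exists (Num.min r r'); first by rewrite lt_min r0.
  move=> v; rewrite lt_min => /andP[v1 v2]; split; last by rewrite rP.
  by move=> /r'P; lra.
have : [set u | B u /\ wnum g u = wnum g z] = B.
  apply: (@component_connected _ (~` trace g) z).
  - by exists z.
  - exists [set u | ~ trace g u /\ wnum g u = wnum g z]; first exact: (oc id).
    apply/seteqP; split=> u [Bu h]; split => //; last by case: h.
    by split => //; exact: (connected_component_sub Bu).
  - exists (~` [set u | ~ trace g u /\ ~ (wnum g u = wnum g z)]).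
      exact/open_closedC/(oc not).
    apply/seteqP; split=> u [Bu h]; split => //; first by move=> [_].
    apply: contrapT => nh; apply: h; split => //.
    exact: (connected_component_sub Bu).
by move=> /seteqP[_ /(_ y zy)[]].
Qed.

(** The winding number is constant on the unbounded component, which contains points so far away
    that the integrand is arbitrarily small. *)
Lemma wnum_outside g z : good_curve g -> g 0 = g 1 -> outside g z -> wnum g z = 0.
Proof.
move=> gg g01 [gz nb]; have [gc [V gV]] := gg.
have VV : 0 <= V 1 - V 0 by rewrite (le_trans _ (gV _ _ _ _ _)) ?cabs_ge0.
have [r r0 rP] := trace_bounded gc.
apply/eqP; rewrite -cabs_eq0 eq_le cabs_ge0 andbT.
apply/ler_addgt0Pr => e e0; rewrite add0r.
(* Beyond M the integrand is at most 1 / (M - r), and (V 1 - V 0) / (M - r) <= e. *)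
pose M := r + (V 1 - V 0) / e + 1.
have [y [zy yM]] : exists y, connected_component (~` trace g) z y /\ M < cabs y.
  apply: contrapT => h; apply: nb; apply/bounded_setCP; exists M => x zx.
  by rewrite leNgt; apply/negP => xM; apply: h; exists x.
rewrite -(wnum_component gg g01 zy).
have gy : ~ trace g y by exact: (connected_component_sub zy).
have Ve : 0 <= (V 1 - V 0) / e by rewrite divr_ge0 // ltW.
have M0 : 0 < M - r by rewrite /M; lra.
apply: (@le_trans _ _ ((M - r)^-1 * (V 1 - V 0))).
  apply: (is_int_bound gV (is_int_wnum gg gy)) => x gx.
  have h : M - r <= cabs (x - y).
    have := rP x gx; have := cabs_rev y x; rewrite (cabs_distC y); lra.
  by rewrite cabsV lef_pV2 // posrE // (lt_le_trans M0).
rewrite mulrC ler_pdivrMr // /M.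
have -> : e * (r + (V 1 - V 0) / e + 1 - r) = (V 1 - V 0) + e.
  by field; rewrite gt_eqF.
by rewrite lerDl ltW.
Qed.

End Curves.

(** * The q-Pochhammer symbol and the theta function *)

Section QPochhammer.
Context {R : realType}.
Local Notation C := (Cplx R).
Variable q : C.
Hypothesis q_lt1 : cabs q < 1.

Definition qfin (z : C) (n : nat) : C := \prod_(k < n) (1 - q ^+ k * z).

Lemma qfinS z n : qfin z n.+1 = qfin z n * (1 - q ^+ n * z).
Proof. by rewrite /qfin big_ord_recr. Qed.

(** Majorant of the partial products and of their difference quotients on the disc of radius r,
    bounded uniformly in n. *)
Definition gprod (r : R) (n : nat) : R := \prod_(k < n) (1 + cabs q ^+ k * r).

Lemma gprodS r n : gprod r n.+1 = gprod r n * (1 + cabs q ^+ n * r).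
Proof. by rewrite /gprod big_ord_recr. Qed.

Lemma gprod_ge1 r n : 0 <= r -> 1 <= gprod r n.
Proof.
move=> r0; elim: n => [|n IH]; first by rewrite /gprod big_ord0.
by rewrite gprodS mulr_ege1 // lerDl mulr_ge0 // exprn_ge0 // cabs_ge0.
Qed.

(** By 1 + x <= exp x and the geometric series. *)
Lemma gprod_bounded r : 0 <= r -> exists M : R, forall n, gprod r n <= M.
Proof.
move=> r0; exists (expR (r / (1 - cabs q))) => n.
have q0 := cabs_ge0 q; have q1 : 0 < 1 - cabs q by rewrite subr_gt0.
have h : gprod r n <= expR (\sum_(k < n) cabs q ^+ k * r).
  elim: n => [|n IH]; first by rewrite /gprod !big_ord0 expR0.
  rewrite gprodS big_ord_recr /= expRD ler_pM ?expR_ge1Dx //.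
    by rewrite (le_trans ler01) // gprod_ge1.
  by rewrite addr_ge0 // mulr_ge0 // exprn_ge0.
rewrite (le_trans h) // ler_expR -mulr_suml mulrC ler_wpM2l //.
rewrite -[_^-1]mul1r ler_pdivlMr //.
have : (\sum_(k < n) cabs q ^+ k) * (1 - cabs q) = 1 - cabs q ^+ n.
  by rewrite mulrC -opprB mulNr -subrX1 opprB.
by move=> ->; rewrite gerBl exprn_ge0.
Qed.

Lemma geometric_cvg (u : nat -> C) (K : R) :
  (forall n, cabs (u n.+1 - u n) <= K * cabs q ^+ n) -> exists l : C, u @ \oo --> l.
Proof.
move=> H; have q0 := cabs_ge0 q; have q1 : 0 < 1 - cabs q by rewrite subr_gt0.
have K0 : 0 <= K by have := le_trans (cabs_ge0 _) (H 0%N); rewrite expr0 mulr1.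
have est n m : cabs (u (n + m)%N - u n) <= K / (1 - cabs q) * cabs q ^+ n.
  suff h : cabs (u (n + m)%N - u n) <= K * cabs q ^+ n * ((1 - cabs q ^+ m) / (1 - cabs q)).
    rewrite (le_trans h) // -!mulrA ler_wpM2l // mulrC mulrAC.
    rewrite ler_pdivrMr // mulrAC mulVf ?gt_eqF // mul1r ler_piMl ?exprn_ge0 //.
    by rewrite gerBl exprn_ge0.
  elim: m => [|m IH]; first by rewrite addn0 subrr cabs0 expr0 subrr mul0r mulr0.
  rewrite addnS (le_trans (cabs_tri _ (u (n + m)%N) _)) //.
  rewrite (le_trans (lerD (H _) IH)) // exprD.
  rewrite le_eqVlt; apply/orP; left; apply/eqP.
  by rewrite exprS; field; rewrite gt_eqF.
apply: cvgC_cauchy => e e0.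
pose B := 2 * (K / (1 - cabs q)) + 1.
have B0 : 0 < B by rewrite ltr_wpDl // mulr_ge0 // divr_ge0 // ltW.
have [N NP] : exists N, forall n, (N <= n)%N -> cabs q ^+ n < e / B.
  have h : (fun n => cabs q ^+ n) @ \oo --> (0 : R).
    by apply: cvg_expr; rewrite ger0_norm.
  have /cvgrPdist_lt/(_ _ (divr_gt0 e0 B0))[N _ NP] := h; exists N => n Nn.
  by have := NP n Nn; rewrite /= sub0r normrN ger0_norm // exprn_ge0.
exists [set n | (N <= n)%N]; first by exists N.
move=> n m Nn Nm.
have tail k : (N <= k)%N -> cabs (u k - u N) <= K / (1 - cabs q) * cabs q ^+ N.
  by move=> Nk; rewrite -(subnKC Nk); exact: est.
rewrite (le_lt_trans (cabs_tri _ (u N) _)) // (cabs_distC (u N)).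
rewrite (le_lt_trans (lerD (tail _ Nn) (tail _ Nm))) //.
have := NP N (leqnn _); rewrite ltr_pdivlMr // /B => h.
rewrite (le_lt_trans _ h) // -mulr2n -mulr_natl.
have := exprn_ge0 N q0; nra.
Qed.

Lemma qfin_bound r z n : cabs z <= r -> cabs (qfin z n) <= gprod r n.
Proof.
move=> zr; have r0 := le_trans (cabs_ge0 z) zr.
elim: n => [|n IH]; first by rewrite /qfin /gprod !big_ord0 cabs1.
rewrite qfinS gprodS cabsM ler_pM ?cabs_ge0 // (le_trans (cabsB _ _)) //.
by rewrite cabs1 cabsM cabsX lerD2l ler_wpM2l // exprn_ge0 // cabs_ge0.
Qed.

(* The difference quotients of qfin, from the product rule: defined also for
   x = y, which makes the limit of qfin strictly differentiable. *)
Fixpoint qquot (x y : C) (n : nat) : C :=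
  if n is m.+1 then qquot x y m * (1 - q ^+ m * x) - q ^+ m * qfin y m else 0.

Lemma qquotE x y n : qfin x n - qfin y n = qquot x y n * (x - y).
Proof.
elim: n => [|n IH]; first by rewrite /qfin !big_ord0 subrr mul0r.
rewrite !qfinS /= mulrBl mulrAC -IH; ring.
Qed.

(** The extra term of the recursion is absorbed by enlarging the radius: G * (1 + a * r) + a * G = G
    * (1 + a * (r + 1)), with a the n-th power of cabs q. *)
Lemma qquot_bound r x y n : 0 <= r -> cabs x <= r -> cabs y <= r ->
  cabs (qquot x y n) <= gprod (r + 1) n.
Proof.
move=> r0 xr yr; elim: n => [|n IH]; first by rewrite /gprod big_ord0 cabs0.
rewrite gprodS /= (le_trans (cabsB _ _)) // !cabsM cabsX.
have yr1 : cabs y <= r + 1 by lra.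
have h1 := qfin_bound n yr1.
have h2 : cabs (1 - q ^+ n * x) <= 1 + cabs q ^+ n * r.
  rewrite (le_trans (cabsB _ _)) // cabs1 cabsM cabsX lerD2l ler_wpM2l //.
  by rewrite exprn_ge0 // cabs_ge0.
have qn : 0 <= cabs q ^+ n by rewrite exprn_ge0 // cabs_ge0.
have h3 : cabs (qquot x y n) * cabs (1 - q ^+ n * x) <=
    gprod (r + 1) n * (1 + cabs q ^+ n * r) by rewrite ler_pM ?cabs_ge0.
have h4 : cabs q ^+ n * cabs (qfin y n) <= cabs q ^+ n * gprod (r + 1) n.
  by rewrite ler_wpM2l.
rewrite (le_trans (lerD h3 h4)) // le_eqVlt; apply/orP; left; apply/eqP; ring.
Qed.

(** The recursion for the difference has two extra terms of the size absorbed in [qquot_bound],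
    hence the radius r + 2. *)
Lemma qquot_lip r x y z n : 0 <= r -> cabs x <= r -> cabs y <= r -> cabs z <= r ->
  cabs (qquot x y n - qquot z z n) <=
    gprod (r + 2) n * (cabs (x - z) + cabs (y - z)).
Proof.
move=> r0 xr yr zr; set e := (X in _ <= _ * X).
have e0 : 0 <= e by rewrite addr_ge0 ?cabs_ge0.
have gm k : gprod (r + 1) k <= gprod (r + 2) k.
  rewrite /gprod; apply: ler_prod => i _.
  have qn : 0 <= cabs q ^+ i by rewrite exprn_ge0 // cabs_ge0.
  by rewrite addr_ge0 ?mulr_ge0 //= ?lerD2l ?ler_wpM2l //; lra.
elim: n => [|n IH].
  by rewrite /gprod big_ord0 subrr cabs0 mul1r.
have -> : qquot x y n.+1 - qquot z z n.+1 =
    (qquot x y n - qquot z z n) * (1 - q ^+ n * x)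
    - (q ^+ n * (qquot z z n * (x - z)) + q ^+ n * (qfin y n - qfin z n)).
  by rewrite /=; ring.
have qn : 0 <= cabs q ^+ n by rewrite exprn_ge0 // cabs_ge0.
have G1 := gprod_ge1 n (addr_ge0 r0 (ler0n R 2)).
have h1 : cabs (1 - q ^+ n * x) <= 1 + cabs q ^+ n * r.
  by rewrite (le_trans (cabsB _ _)) // cabs1 cabsM cabsX lerD2l ler_wpM2l.
have h2 : cabs (qquot z z n * (x - z)) <= gprod (r + 2) n * e.
  rewrite cabsM ler_pM ?cabs_ge0 // ?(le_trans (qquot_bound n r0 zr zr)) //.
  by rewrite lerDl cabs_ge0.
have h3 : cabs (qfin y n - qfin z n) <= gprod (r + 2) n * e.
  rewrite qquotE cabsM ler_pM ?cabs_ge0 // ?(le_trans (qquot_bound n r0 yr zr)) //.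
  by rewrite lerDr cabs_ge0.
rewrite gprodS (le_trans (cabsB _ _)) //.
have h4 : cabs ((qquot x y n - qquot z z n) * (1 - q ^+ n * x)) <=
    gprod (r + 2) n * e * (1 + cabs q ^+ n * r) by rewrite cabsM ler_pM ?cabs_ge0.
have h5 : cabs (q ^+ n * (qquot z z n * (x - z)) + q ^+ n * (qfin y n - qfin z n)) <=
    cabs q ^+ n * (gprod (r + 2) n * e) + cabs q ^+ n * (gprod (r + 2) n * e).
  rewrite (le_trans (cabsD _ _)) //.
  by rewrite lerD // cabsM cabsX ler_wpM2l.
rewrite (le_trans (lerD h4 h5)) // le_eqVlt; apply/orP; left; apply/eqP; ring.
Qed.

Lemma qpoch_cvg z : (fun n => qfin z n) @ \oo --> qpoch q z.
Proof.
have [M MP] := gprod_bounded (cabs_ge0 z).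
have [|l ql] := @geometric_cvg (fun n => qfin z n) (M * cabs z).
  move=> n; rewrite qfinS mulrBr mulr1 addrC addKr cabsN !cabsM cabsX.
  rewrite [cabs q ^+ n * _]mulrC mulrA ler_wpM2r ?exprn_ge0 ?cabs_ge0 //.
  by rewrite ler_wpM2r ?cabs_ge0 // (le_trans (qfin_bound n (lexx _))).
by have -> : qpoch q z = l by exact: cvgC_lim.
Qed.

(** The derivative is the limit of [qquot z z n]. The estimate [qquot_lip] becomes uniform in n by
    [gprod_bounded] and therefore survives the limit. *)
Lemma qpoch_sdiff z : sdiff setT (qpoch q) z.
Proof.
pose r := cabs z + 1; have z0 := cabs_ge0 z; have r0 : 0 <= r by rewrite /r; lra.
have zr : cabs z <= r by rewrite /r; lra.
have [M MP] := gprod_bounded (addr_ge0 r0 (ler0n R 2)).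
have [M' MP'] := gprod_bounded (addr_ge0 r0 (ler0n R 1)).
have [|d dP] := @geometric_cvg (fun n => qquot z z n) (M' * r + M').
  move=> n.
  have -> : qquot z z n.+1 - qquot z z n = - (q ^+ n * (qquot z z n * z + qfin z n)).
    by rewrite /=; ring.
  rewrite cabsN cabsM cabsX mulrC ler_wpM2r ?exprn_ge0 ?cabs_ge0 //.
  rewrite (le_trans (cabsD _ _)) // cabsM lerD ?ler_pM ?cabs_ge0 //.
    by rewrite (le_trans (qquot_bound n r0 zr zr)).
  rewrite (le_trans _ (MP' n)) // qfin_bound //; lra.
apply/sdiffP; exists d => e e0.
have M0 : 0 <= M.
  by rewrite (le_trans _ (MP 0%N)) // (le_trans ler01) // gprod_ge1 // addr_ge0.
have k0 : 0 < 2 * M + 1 by lra.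
exists (Num.min 1 (e / (2 * M + 1))); first by rewrite lt_min ltr01 divr_gt0.
move=> x y; rewrite !lt_min => /andP[x1 xe] /andP[y1 ye] _.
have xr : cabs x <= r by have := cabs_rev x z; rewrite /r; lra.
have yr : cabs y <= r by have := cabs_rev y z; rewrite /r; lra.
have lim : (fun n => - (x - y) * qquot z z n + (-1 * qfin y n + qfin x n)) @ \oo -->
    - (x - y) * d + (-1 * qpoch q y + qpoch q x).
  have l1 : (fun n => -1 * qfin y n + qfin x n) @ \oo --> -1 * qpoch q y + qpoch q x.
    exact: (cvgC_lin (@qpoch_cvg y) (@qpoch_cvg x)).
  exact: (cvgC_lin dP l1).
have -> : qpoch q x - qpoch q y - d * (x - y) =
   - (x - y) * d + (-1 * qpoch q y + qpoch q x) by ring.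
apply: (cabs_le_lim lim); exists 0%N => // n _ /=.
have -> : - (x - y) * qquot z z n + (-1 * qfin y n + qfin x n) =
    (qquot x y n - qquot z z n) * (x - y).
  have -> : -1 * qfin y n + qfin x n = qfin x n - qfin y n by ring.
  by rewrite qquotE; ring.
rewrite cabsM ler_wpM2r ?cabs_ge0 // (le_trans (qquot_lip n r0 xr yr zr)) //.
rewrite (@le_trans _ _ (M * (cabs (x - z) + cabs (y - z)))) //.
  by rewrite ler_wpM2r // addr_ge0 // cabs_ge0.
move: xe ye; rewrite !ltr_pdivlMr // => xe ye.
have := cabs_ge0 (x - z); have := cabs_ge0 (y - z); nra.
Qed.

Lemma qpoch0 : qpoch q 0 = 1.
Proof.
apply: cvgC_lim; apply/cvgCP => e e0; exists 0%N => // n _ /=.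
by rewrite big1 ?subrr ?cabs0 // => i _; rewrite mulr0 subr0.
Qed.

Lemma qpochS z : qpoch q z = (1 - z) * qpoch q (q * z).
Proof.
apply: (@cvgC_unique _ (fun n => qfin z n.+1)).
  exact: (@cvgC_subseq _ _ S _ (@qpoch_cvg z) leqnSn).
rewrite (_ : (fun n => _) = (fun n => (1 - z) * qfin (q * z) n)).
  exact: (cvgC_scale (@qpoch_cvg _)).
apply/funext => n; rewrite /qfin big_ord_recl expr0 mul1r; congr (_ * _).
by apply: eq_bigr => k _; rewrite mulrA -exprSr.
Qed.

Lemma qpoch_shift z n : qpoch q z = qfin z n * qpoch q (q ^+ n * z).
Proof.
elim: n => [|n IH]; first by rewrite /qfin big_ord0 mul1r expr0 mul1r.
by rewrite qfinS IH (qpochS (q ^+ n * z)) exprS !mulrA.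
Qed.

Lemma qpow_small (e : R) : 0 < e -> exists N, forall n, (N <= n)%N -> cabs q ^+ n < e.
Proof.
move=> e0; have h : (fun n => cabs q ^+ n) @ \oo --> (0 : R).
  by apply: cvg_expr; rewrite ger0_norm // cabs_ge0.
have /cvgrPdist_lt/(_ _ e0)[N _ NP] := h; exists N => n Nn.
by have := NP n Nn; rewrite /= sub0r normrN ger0_norm // exprn_ge0 // cabs_ge0.
Qed.

(** Finitely many factors, nonzero by hypothesis, are split off; the remaining symbol has an
    argument close to 0 and is nonzero by continuity at 0, where the value is 1. *)
Lemma qpoch_neq0 z : (forall k : nat, q ^+ k * z != 1) -> qpoch q z != 0.
Proof.
move=> H; have [|r r0 rP] := continuous_neq0 (sdiff_continuousT (qpoch_sdiff 0)).
  by rewrite qpoch0 oner_eq0.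
have k0 : 0 < cabs z + 1 by rewrite ltr_wpDl // cabs_ge0.
have [N /(_ N (leqnn _)) NP] := qpow_small (divr_gt0 r0 k0).
rewrite (qpoch_shift z N) mulf_neq0 //; last first.
  apply: rP; rewrite subr0 cabsM cabsX.
  move: NP; rewrite ltr_pdivlMr // => NP; rewrite (le_lt_trans _ NP) //.
  by rewrite ler_wpM2l ?exprn_ge0 ?cabs_ge0 //; lra.
apply/prodf_neq0 => k _; by rewrite subr_eq0 eq_sym.
Qed.

(** Source of the 1 + O(1/z) behaviour of the entries of [Finf] at infinity. *)
Lemma qpoch_near0 : exists2 K : R, 0 <= K & exists2 r : R, 0 < r &
  forall x, cabs x < r -> cabs (qpoch q x - 1) <= K * cabs x.
Proof.
have /sdiffP[d /(_ 1 ltr01)[r r0 rP]] := qpoch_sdiff 0.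
exists (cabs d + 1); first by rewrite addr_ge0 // cabs_ge0.
exists r => // x xr; have := rP x 0; rewrite subr0 subrr cabs0 qpoch0 => /(_ xr r0 Logic.I).
move=> h; rewrite -[qpoch q x - 1](subrK (d * x)) (le_trans (cabsD _ _)) //.
by rewrite (le_trans (lerD h (lexx _))) // cabsM; lra.
Qed.

Hypothesis q_neq0 : q != 0.

Lemma theta_qM z : z != 0 -> theta q (q * z) = - z^-1 * theta q z.
Proof.
move=> z0; rewrite /theta (qpochS z).
have -> : q / (q * z) = z^-1 by rewrite invfM mulrA divff // mul1r.
by rewrite (qpochS z^-1); field.
Qed.

(** Origin of the scalar in [D2]. The left side is multiplied by z when m grows by 1, because m * (m
    + 1) / 2 grows by m + 1; negative m are reached by running this step backwards. *)
Lemma theta_shift z (m : int) : z != 0 ->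
  (-1) ^ m * q ^ (m * (m + 1) %/ 2)%Z * theta q (q ^ (- m) * z) = z ^ m * theta q z.
Proof.
move=> z0.
have tri (k : int) : ((k + 1) * (k + 1 + 1) %/ 2)%Z = (k * (k + 1) %/ 2)%Z + (k + 1).
  have -> : (k + 1) * (k + 1 + 1) = k * (k + 1) + (k + 1) * 2 by ring.
  by rewrite addrC divzMDl // addrC.
pose f (k : int) := (-1) ^ k * q ^ (k * (k + 1) %/ 2)%Z * theta q (q ^ (- k) * z).
have step k : f (k + 1) = z * f k.
  have w0 : q ^ (- (k + 1)) * z != 0 by rewrite mulf_neq0 // expfz_neq0.
  have e1 : q ^ (- k) = q * q ^ (- (k + 1)).
    have -> : - k = 1 + - (k + 1) by ring.
    by rewrite expfzDr // expr1z.
  have := theta_qM w0; rewrite mulrA -e1.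
  rewrite /f tri !expfzDr ?oppr_eq0 ?oner_eq0 // !expr1z => ->.
  have qk : q ^ (- (k + 1)) = (q ^ k * q)^-1 by rewrite -invr_expz expfzDr.
  rewrite qk; have := expfz_neq0 k q_neq0; move: (q ^ k) => Q Q0.
  move: (theta _ _) => T; move: ((-1) ^ k) (q ^ _) => s t.
  by field; rewrite z0 Q0 q_neq0.
have f0 : f 0 = theta q z by rewrite /f oppr0 mul0r div0z !expr0z !mul1r.
rewrite -/(f m) -f0.
elim/int_ind: m => [|n IH|n IH]; first by rewrite expr0z mul1r.
  have -> : n.+1%:Z = n%:Z + 1 by rewrite intS addrC.
  by rewrite step IH expfzDr // expr1z; ring.
have e : (- n%:Z) = (- n.+1%:Z) + 1 by rewrite intS; ring.
apply: (mulfI z0); rewrite -step -e IH e expfzDr // expr1z; ring.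
Qed.

Lemma theta_sdiff z : z != 0 -> sdiff setT (theta q) z.
Proof.
move=> z0; apply: sdiffM => //; first exact: qpoch_sdiff.
apply: (sdiff_comp (f := qpoch q)) => //; last exact: qpoch_sdiff.
by apply: sdiffZ => //; apply: sdiffV => //; exact: sdiff_id.
Qed.

End QPochhammer.

(** * Cauchy transforms and their boundary values *)

Section CauchyTransform.
Context {R : realType}.
Local Notation C := (Cplx R).
Implicit Types (g : R -> C) (f h : C -> C) (z y s : C).

Definition kappa : C := ((2 * pi)%:C * 'i%C)^-1.

(** Continuity at trace points as a function on C, not only along the curve, since boundary values
    are limits from off the curve. *)
Definition trace_continuous g f := forall x, trace g x -> {for x, continuous f}.

Lemma ointegral_is_int g f J : is_int g f J -> ointegral g f = kappa * J.
Proof. by move=> h; rewrite /ointegral (is_int_eq h). Qed.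

Lemma ointegral_lin g f h (a : C) : good_curve g -> trace_continuous g f ->
  trace_continuous g h ->
  ointegral g (fun x => a * f x + h x) = a * ointegral g f + ointegral g h.
Proof.
move=> gg fc hc.
rewrite (ointegral_is_int (is_int_lin (a := a) (is_int_cont gg fc) (is_int_cont gg hc))).
by rewrite /ointegral -/kappa; ring.
Qed.

Lemma ointegral_ext g f h : good_curve g -> trace_continuous g f ->
  (forall x, trace g x -> f x = h x) -> ointegral g f = ointegral g h.
Proof.
move=> gg fc fh; rewrite (ointegral_is_int (is_int_cont gg fc)).
by rewrite (ointegral_is_int (is_int_ext fh (is_int_cont gg fc))).
Qed.

Lemma ointegral_bound g : good_curve g -> exists2 K : R, 0 <= K & forall f M,
  trace_continuous g f -> (forall x, trace g x -> cabs (f x) <= M) ->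
  cabs (ointegral g f) <= K * M.
Proof.
move=> gg; have [gc [V gV]] := gg.
have VV : 0 <= V 1 - V 0 by rewrite (le_trans _ (gV _ _ _ _ _)) ?cabs_ge0.
exists (cabs kappa * (V 1 - V 0)); first by rewrite mulr_ge0 ?cabs_ge0.
move=> f M fc fM; rewrite /ointegral -/kappa cabsM -mulrA ler_wpM2l ?cabs_ge0 //.
by rewrite mulrC; apply: (is_int_bound gV (is_int_cont gg fc)).
Qed.

Lemma trace_continuous_bounded g f : {within `[0, 1], continuous g} ->
  trace_continuous g f -> exists2 M : R, 0 <= M & forall x, trace g x -> cabs (f x) <= M.
Proof.
move=> gc fc; have [|r r0 rP] := @tube_trace _ g (fun d x => d * cabs (f x) <= 1) gc.
  move=> x gx; have k0 : 0 < cabs (f x) + 1 by rewrite ltr_wpDl // cabs_ge0.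
  have /continuousCP/(_ 1 ltr01)[r r0 rP] := fc x gx.
  exists (Num.min r (cabs (f x) + 1)^-1); first by rewrite lt_min r0 invr_gt0.
  move=> d x' /andP[d0]; rewrite !lt_min => /andP[dr dx] _ /andP[xx _].
  have h : cabs (f x') <= cabs (f x) + 1.
    have := cabs_rev (f x') (f x); have := rP _ xx; lra.
  rewrite (@le_trans _ _ (d * (cabs (f x) + 1))) //; first by rewrite ler_wpM2l // ltW.
  by rewrite -ler_pdivlMr // mul1r ltW.
have r20 : 0 < r / 2 by lra.
exists (r / 2)^-1 => [|x gx]; first by rewrite invr_ge0 ltW.
rewrite -[_^-1]mul1r ler_pdivlMr // mulrC; apply: rP => //; lra.
Qed.

Lemma trace_continuousM g f h : trace_continuous g f -> trace_continuous g h ->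
  trace_continuous g (fun x => f x * h x).
Proof. by move=> fc hc x gx; exact: (cvgC_mul (fc x gx) (hc x gx)). Qed.

Lemma trace_continuousD g f h : trace_continuous g f -> trace_continuous g h ->
  trace_continuous g (fun x => f x + h x).
Proof. by move=> fc hc x gx; exact: (cvgC_add (fc x gx) (hc x gx)). Qed.

Lemma trace_continuous_cst g (a : C) : trace_continuous g (fun=> a).
Proof. by move=> x gx; exact: (@continuous_cstC _ a x). Qed.

Lemma trace_continuous_id g : trace_continuous g id.
Proof. by move=> x gx; exact: cvg_id. Qed.

Lemma trace_continuous_inv g z : ~ trace g z -> trace_continuous g (fun x => (x - z)^-1).
Proof.
move=> gz x gx; apply: continuous_inv_sub; apply/eqP => e; by rewrite e in gx.
Qed.

Lemma trace_continuous_sdiff g f : (forall x, trace g x -> sdiff setT f x) ->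
  trace_continuous g f.
Proof. by move=> h x /h; exact: sdiff_continuousT. Qed.

(** After removal of the linear term the kernel is (y - z)^2 / ((x - y) * (x - z)^2), and its last
    factor is bounded by the cube of 2 / r while y stays within r / 2 of z. *)
Lemma derivable_cauchy_op g h z : good_curve g -> trace_continuous g h ->
  ~ trace g z -> derivable (cauchy_op g h) z 1.
Proof.
move=> gg hc gz; have [r r0 rP] := trace_far gg.1 gz.
have [K K0 KP] := ointegral_bound gg; have [M M0 MP] := trace_continuous_bounded gg.1 hc.
have ic := trace_continuous_inv gz.
have qc := trace_continuousM hc (trace_continuousM ic ic).
apply/derivableCP; exists (ointegral g (fun x => h x * ((x - z)^-1 * (x - z)^-1))) => e e0.
have r20 : 0 < r / 2 by lra.
pose B := (r / 2)^-1 * ((r / 2)^-1 * (r / 2)^-1).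
have B0 : 0 < B by rewrite !mulr_gt0 // invr_gt0.
have KMB : 0 < K * (M * B) + 1.
  by rewrite ltr_wpDl // mulr_ge0 // mulr_ge0 // ltW.
exists (Num.min (r / 2) (e / (K * (M * B) + 1))); first by rewrite lt_min r20 divr_gt0.
move=> y; rewrite lt_min => /andP[yr ye].
have far x : trace g x -> r / 2 <= cabs (x - y).
  by move=> /rP; have := cabs_tri x y z; lra.
have gy : ~ trace g y by move=> /far; rewrite subrr cabs0; lra.
have icy := trace_continuous_inv gy.
have hz := trace_continuousM hc ic; have hy := trace_continuousM hc icy.
have k1 := trace_continuousM (@trace_continuous_cst g (- (y - z))) qc.
have k3 := trace_continuousD (trace_continuousM (@trace_continuous_cst g (-1)) hz) hy.
rewrite /cauchy_op.
have -> : ointegral g (fun x => h x / (x - y)) - ointegral g (fun x => h x / (x - z)) -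
    ointegral g (fun x => h x * ((x - z)^-1 * (x - z)^-1)) * (y - z) =
    ointegral g (fun x => - (y - z) * (h x * ((x - z)^-1 * (x - z)^-1)) +
      (-1 * (h x / (x - z)) + h x / (x - y))).
  rewrite (ointegral_lin _ gg qc k3) (ointegral_lin _ gg hz hy); ring.
rewrite (@le_trans _ _ (K * (M * B * cabs (y - z) ^+ 2))) //.
  apply: (KP _ _ (trace_continuousD k1 k3)).
  move=> x gx; have x1 := far x gx; have x2 : r / 2 <= cabs (x - z) by have := rP x gx; lra.
  have x10 : x - y != 0 by rewrite -cabs_gt0 (lt_le_trans r20).
  have x20 : x - z != 0 by rewrite -cabs_gt0 (lt_le_trans r20).
  have -> : - (y - z) * (h x * ((x - z)^-1 * (x - z)^-1)) +
      (-1 * (h x / (x - z)) + h x / (x - y)) =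
      h x * ((x - y)^-1 * ((x - z)^-1 * (x - z)^-1)) * (y - z) ^+ 2.
    by field; rewrite x10 x20.
  rewrite cabsM cabsX ler_wpM2r ?exprn_ge0 ?cabs_ge0 //.
  rewrite cabsM ler_pM ?cabs_ge0 ?MP // /B !cabsM !cabsV.
  have i x' : r / 2 <= cabs x' -> (cabs x')^-1 <= (r / 2)^-1.
    by move=> h1; rewrite lef_pV2 // posrE // (lt_le_trans r20).
  by rewrite !ler_pM ?mulr_ge0 ?invr_ge0 ?cabs_ge0 ?i.
move: ye; rewrite ltr_pdivlMr // => ye.
have -> : K * (M * B * cabs (y - z) ^+ 2) = cabs (y - z) * (K * (M * B)) * cabs (y - z).
  ring.
rewrite ler_wpM2r ?cabs_ge0 //.
have := cabs_ge0 (y - z); move: ye; rewrite mulrDr mulr1; lra.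
Qed.

(** The derivative is continuous at s along points of strict differentiability: for z near s, both
    estimates apply to the increment from z to z + u with u small, and they can be compared. *)
Lemma sdiff_deriv_close h s (d : C) :
  (forall e : R, 0 < e -> exists2 r : R, 0 < r & forall x y,
    cabs (x - s) < r -> cabs (y - s) < r ->
    cabs (h x - h y - d * (x - y)) <= e * cabs (x - y)) ->
  forall e : R, 0 < e -> exists2 r : R, 0 < r & forall z (d' : C), cabs (z - s) < r ->
    (forall e : R, 0 < e -> exists2 r : R, 0 < r & forall x y,
      cabs (x - z) < r -> cabs (y - z) < r ->
      cabs (h x - h y - d' * (x - y)) <= e * cabs (x - y)) ->
    cabs (d' - d) <= e.
Proof.
move=> H e e0; have e20 : 0 < e / 2 by lra.
have [r r0 rP] := H _ e20; exists r => // z d' zs H'.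
have [r' r'0 r'P] := H' _ e20.
(* A real step so small that z + u stays in the disc of radius r' around z and in the disc of radius
   r around s. *)
pose u : R := Num.min (r' / 2) ((r - cabs (z - s)) / 2).
have u0 : 0 < u by rewrite lt_min; apply/andP; split; lra.
have ur' : u <= r' / 2 by rewrite ge_min lexx.
have ur : u <= (r - cabs (z - s)) / 2 by rewrite ge_min lexx orbT.
have cu : cabs u%:C = u by rewrite cabs_real gtr0_norm.
have h1 := rP (u%:C + z) z; have h2 := r'P (u%:C + z) z.
rewrite addrK subrr cabs0 cu in h2.
have xs : cabs (u%:C + z - s) < r.
  rewrite -addrA (le_lt_trans (cabsD _ _)) // cu; lra.
rewrite xs addrK cu in h1.
have {}h1 := h1 isT zs; have {}h2 : cabs (h (u%:C + z) - h z - d' * u%:C) <= e / 2 * u.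
  by apply: h2 => //; lra.
rewrite -(ler_pM2r u0) -{1}cu -cabsM.
have -> : (d' - d) * u%:C = (h (u%:C + z) - h z - d * u%:C) - (h (u%:C + z) - h z - d' * u%:C).
  by ring.
rewrite (le_trans (cabsB _ _)) //; lra.
Qed.

(* Phi z is the contour integral of (h x - h z) / (x - z), extended by h' z at
   x = z; what remains is h z times the winding number. *)
Lemma cauchy_op_boundary g h : good_curve g -> g 0 = g 1 -> positively_oriented g ->
  (forall x, trace g x -> sdiff setT h x) ->
  exists Phi : C -> C, [/\ trace_continuous g Phi,
    forall z, outside g z -> cauchy_op g h z = Phi z &
    forall z, inside g z -> cauchy_op g h z = Phi z + h z].
Proof.
move=> gg g01 gpos hd.
have hc := trace_continuous_sdiff hd.
have dP z : exists d : C, trace g z -> forall e : R, 0 < e ->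
    exists2 r : R, 0 < r & forall x y, cabs (x - z) < r -> cabs (y - z) < r ->
    cabs (h x - h y - d * (x - y)) <= e * cabs (x - y).
  have [/hd/sdiffP[d H]|gz] := pselect (trace g z); last by exists 0 => /gz.
  exists d => _ e /H[r r0 rP]; exists r => // x y xr yr; exact: rP.
have [h' h'P] := choice dP.
pose Q z x := if x == z then h' z else (h x - h z) * (x - z)^-1.
pose quot (p : C * C) := (h p.1 - h p.2) * (p.1 - p.2)^-1.
(* Joint continuity of (x, z) |-> Q z x away from the diagonal. *)
have quot_cvg x0 s : trace g x0 -> trace g s -> x0 != s ->
    forall e : R, 0 < e -> exists2 r : R, 0 < r & forall x z,
    cabs (x - x0) < r -> cabs (z - s) < r -> x != z /\ cabs (Q z x - Q s x0) <= e.
  move=> gx0 gs xs e e0.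
  pose F : set_system (C * C) := filter_from [set r : R | 0 < r]
    (fun r => [set p | cabs (p.1 - x0) < r /\ cabs (p.2 - s) < r]).
  have FF : Filter F.
    apply: filter_from_filter; first by exists 1 => /=.
    move=> r r' /= r0 r'0; exists (Num.min r r') => /=; first by rewrite lt_min r0.
    by move=> p [] /=; rewrite !lt_min => /andP[? ?] /andP[? ?].
  have c1 f : {for x0, continuous f} -> (fun p => f p.1) @ F --> f x0.
    move=> /continuousCP fc; apply/cvgCP => e' /fc[r r0 rP].
    by exists r => // p [/= pr _]; exact: rP.
  have c2 f : {for s, continuous f} -> (fun p => f p.2) @ F --> f s.
    move=> /continuousCP fc; apply/cvgCP => e' /fc[r r0 rP].
    by exists r => // p [/= _ pr]; exact: rP.
  have cN f : {for s, continuous f} -> {for s, continuous (fun x => - f x)}.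
    move=> /continuousCP fc; apply/continuousCP => e' /fc[r r0 rP]; exists r => // x /rP.
    by rewrite -opprD cabsN.
  have d1 : (fun p => h p.1 - h p.2) @ F --> h x0 - h s.
    exact: (cvgC_add (c1 _ (hc _ gx0)) (c2 _ (cN _ (hc _ gs)))).
  have d2 : (fun p : C * C => p.1 - p.2) @ F --> x0 - s.
    have ci x : {for x, continuous (id : C -> C)} by exact: cvg_id.
    exact: (cvgC_add (c1 _ (ci x0)) (c2 _ (cN _ (ci s)))).
  have xs0 : x0 - s != 0 by rewrite subr_eq0.
  have cq : quot @ F --> (h x0 - h s) * (x0 - s)^-1.
    exact: (cvgC_mul d1 (cvgC_inv xs0 d2)).
  have /cvgCP/(_ e e0)[r r0 rP] := cq.
  have cxs : 0 < cabs (x0 - s) / 2 by rewrite divr_gt0 // cabs_gt0.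
  exists (Num.min r (cabs (x0 - s) / 2)); first by rewrite lt_min r0.
  move=> x z; rewrite !lt_min => /andP[xr xx] /andP[zr zz].
  have xz : x != z.
    apply/eqP => exz; rewrite exz in xx.
    have := cabs_tri x0 z s; rewrite (cabs_distC x0 z); lra.
  split => //; rewrite /Q (negbTE xz) (negbTE xs).
  by apply/ltW/(rP (x, z)).
(* Joint continuity at (s, s): strict differentiability handles x != z, continuity of the derivative
   handles x = z. The side condition keeps diagonal points on the trace, where h' is the
   derivative. *)
have quot_diag s : trace g s -> forall e : R, 0 < e -> exists2 r : R, 0 < r & forall x z,
    cabs (x - s) < r -> cabs (z - s) < r -> (x = z -> trace g z) ->
    cabs (Q z x - h' s) <= e.
  move=> gs e e0; have [r1 r10 r1P] := h'P s gs e e0.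
  have [r2 r20 r2P] := sdiff_deriv_close (h'P s gs) e0.
  exists (Num.min r1 r2); first by rewrite lt_min r10.
  move=> x z; rewrite !lt_min => /andP[x1 x2] /andP[z1 z2] xzP.
  rewrite /Q; case: eqP => [xz|/eqP xz]; first exact: (r2P z (h' z) z2 (h'P z (xzP xz))).
  have xz0 : x - z != 0 by rewrite subr_eq0.
  rewrite -(ler_pM2r (_ : 0 < cabs (x - z))) ?cabs_gt0 // -cabsM mulrBl divfK //.
  exact: r1P.
have Qc z : trace_continuous g (Q z).
  move=> x gx; have [xz|xz] := eqVneq x z.
    rewrite -xz; apply/continuousCP => e e0; have e20 : 0 < e / 2 by lra.
    have [r r0 rP] := quot_diag x gx _ e20; exists r => // y yx.
    rewrite {2}/Q eqxx (@le_lt_trans _ _ (e / 2)) //; last by lra.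
    by apply: rP; rewrite ?subrr ?cabs0.
  have h1 : {for x, continuous (fun y => (h y - h z) * (y - z)^-1)}.
    have h2 : (fun y => h y - h z) @ x --> h x - h z.
      exact: (cvgC_add (hc x gx) (@continuous_cstC _ (- h z) x)).
    exact: (cvgC_mul h2 (@continuous_inv_sub _ z x xz)).
  move/continuousCP: h1 => h1; apply/continuousCP => e /h1[r r0 rP].
  exists (Num.min r (cabs (x - z))); first by rewrite lt_min r0 cabs_gt0 subr_eq0.
  move=> y; rewrite lt_min => /andP[yr yz]; rewrite /Q (negbTE xz).
  case: eqP => [e1|_]; last exact: rP.
  by move: yz; rewrite e1 cabs_distC ltxx.
have [K K0 KP] := ointegral_bound gg.
have decomp z : ~ trace g z ->
    cauchy_op g h z = h z * ointegral g (fun x => (x - z)^-1) + ointegral g (Q z).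
  move=> gz; have ic := trace_continuous_inv gz.
  rewrite -(ointegral_lin (h z) gg ic (Qc z)).
  apply/esym/(ointegral_ext gg).
    exact: (trace_continuousD (trace_continuousM (@trace_continuous_cst g (h z)) ic) (Qc z)).
  move=> x gx; rewrite /Q; case: eqP => [e|_]; first by rewrite e in gx.
  ring.
exists (fun z => ointegral g (Q z)); split.
- move=> s gs; apply/continuousCP => e e0.
  have KK : 0 < K + 1 by lra.
  have e'0 : 0 < e / (K + 1) by rewrite divr_gt0.
  have e20 : 0 < e / (K + 1) / 2 by lra.
  (* Compactness of the trace makes Q z close to Q s uniformly in x, so the integrals are close. *)
  have [|r r0 rP] := @tube_trace _ g (fun d x => forall z, cabs (z - s) < d ->
      cabs (Q z x - Q s x) <= e / (K + 1)) gg.1.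
    move=> x0 gx0; have [->|xs] := eqVneq x0 s.
      have [r r0 rP] := quot_diag s gs _ e20; exists r => // d x' /andP[d0 dr] gx' xx z zs.
      have zr := lt_trans zs dr.
      have := rP x' z xx zr; have := rP x' s xx; rewrite subrr cabs0 => /(_ r0 (fun _ => gs)) a1.
      have a2 : x' = z -> trace g z by move=> <-.
      move=> /(_ a2) a3; rewrite (le_trans (cabs_tri _ (h' s) _)) // (cabs_distC (h' s)); lra.
    have [r r0 rP] := quot_cvg x0 s gx0 gs xs _ e20; exists r => // d x' /andP[d0 dr] gx' xx z zs.
    have [_ a1] := rP x' z xx (lt_trans zs dr).
    have [|_ a2] := rP x' s xx; first by rewrite subrr cabs0.
    rewrite (le_trans (cabs_tri _ (Q s x0) _)) // (cabs_distC (Q s x0)); lra.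
  exists (r / 2); first by lra.
  move=> z zs.
  have -> : ointegral g (Q z) - ointegral g (Q s) =
      ointegral g (fun x => -1 * Q s x + Q z x).
    by rewrite (ointegral_lin (-1) gg (Qc s) (Qc z)); ring.
  rewrite (@le_lt_trans _ _ (K * (e / (K + 1)))) //.
    have ct := trace_continuousM (@trace_continuous_cst g (-1)) (Qc s).
    apply: (KP _ _ (trace_continuousD ct (Qc z))) => x gx.
    by rewrite mulN1r addrC; apply: (rP (r / 2)) => //; lra.
  by rewrite mulrC mulrAC ltr_pdivrMr // ltr_pM2l //; lra.
- by move=> z oz; rewrite (decomp z oz.1) /ointegral -/kappa -/(wnum g z) wnum_outside // !mulr0 add0r.
- move=> z oz; rewrite (decomp z oz.1); have := gpos z oz.
  by rewrite /winding_number => ->; rewrite mulr1 addrC.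
Qed.

Lemma cauchy_op_bound g h : good_curve g -> trace_continuous g h ->
  exists (K r : R), [/\ 0 <= K, 0 < r, forall x, trace g x -> cabs x <= r &
    forall z, r < cabs z -> cabs (cauchy_op g h z) <= K / cabs z].
Proof.
move=> gg hc; have [K K0 KP] := ointegral_bound gg.
have [M M0 MP] := trace_continuous_bounded gg.1 hc.
have [r r0 rP] := trace_bounded gg.1.
exists (K * (M * 2)), (2 * r); split.
- by rewrite !mulr_ge0.
- by rewrite mulr_gt0.
- by move=> x /rP; lra.
move=> z rz; have z0 : 0 < cabs z by lra.
have far x : trace g x -> cabs z / 2 <= cabs (x - z).
  move=> /rP; have := cabs_rev z x; rewrite (cabs_distC z); lra.
have gz : ~ trace g z by move=> /far; rewrite subrr cabs0; lra.
rewrite /cauchy_op -mulrA.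
apply: (KP _ _ (trace_continuousM hc (trace_continuous_inv gz))).
move=> x gx; rewrite cabsM cabsV -mulrA ler_pM ?cabs_ge0 ?invr_ge0 ?cabs_ge0 ?MP //.
have -> : 2 / cabs z = (cabs z / 2)^-1 by rewrite invfM invrK mulrC.
by rewrite lef_pV2 ?far // posrE; [rewrite (lt_le_trans _ (far x gx))|]; lra.
Qed.

(** From x / (x - z) = z / (x - z) + 1; iteration produces the expansion at infinity, with moments
    as coefficients. *)
Lemma cauchy_op_mulX g h z : good_curve g -> trace_continuous g h -> ~ trace g z ->
  cauchy_op g (fun x => x * h x) z = z * cauchy_op g h z + ointegral g h.
Proof.
move=> gg hc gz; have ic := trace_continuous_inv gz.
have hic := trace_continuousM hc ic.
rewrite /cauchy_op -(ointegral_lin z gg hic hc).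
apply: (ointegral_ext gg).
  exact: (trace_continuousM (trace_continuousM (@trace_continuous_id g) hc) ic).
move=> x gx; have xz : x - z != 0.
  by rewrite subr_eq0; apply/eqP => e; rewrite e in gx.
by field.
Qed.

End CauchyTransform.

(** * Rows of solutions, their determinants, and uniqueness *)

Section RowProblem.
Context {R : realType}.
Local Notation C := (Cplx R).
Implicit Types (g : R -> C) (u v w b : C -> C) (z s : C).

Definition boundary g (D : set C) u b := forall s, trace g s ->
  b @ within (trace g) (nbhs s) --> b s /\ u @ within D (nbhs s) --> b s.

Lemma boundary_valuesE g D (Y Yb : C -> 'M[C]_2) : boundary_values g D Y Yb <->
  forall i j, boundary g D (fun z => Y z i j) (fun z => Yb z i j).
Proof.
split=> H i j.
  have [/withinCP h1 h2] := H i j; move=> s gs; split; last exact: h2.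
  by apply/cvg_withinCP; exact: h1.
split; last by move=> s /H -/(_ i j)[].
by apply/withinCP => s /H -/(_ i j)[/cvg_withinCP h _].
Qed.

Lemma boundary_ext g D u u' b b' : (forall z, D z -> u z = u' z) ->
  (forall s, trace g s -> b s = b' s) -> boundary g D u b -> boundary g D u' b'.
Proof.
move=> uu bb H s gs; have [/cvg_withinCP h1 /cvg_withinCP h2] := H s gs.
split; apply/cvg_withinCP => e.
  by move=> /h1[r r0 rP]; exists r => // z gz; rewrite -!bb //; exact: rP.
by move=> /h2[r r0 rP]; exists r => // z Dz; rewrite -uu // -bb //; exact: rP.
Qed.

Lemma boundaryD g D u v b c : boundary g D u b -> boundary g D v c ->
  boundary g D (fun z => u z + v z) (fun z => b z + c z).
Proof.
move=> H H' s gs; have [h1 h2] := H s gs; have [h3 h4] := H' s gs.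
by split; [exact: (cvgC_add h1 h3)|exact: (cvgC_add h2 h4)].
Qed.

Lemma boundaryM g D u v b c : boundary g D u b -> boundary g D v c ->
  boundary g D (fun z => u z * v z) (fun z => b z * c z).
Proof.
move=> H H' s gs; have [h1 h2] := H s gs; have [h3 h4] := H' s gs.
by split; [exact: (cvgC_mul h1 h3)|exact: (cvgC_mul h2 h4)].
Qed.

Lemma boundary_continuous g D u : trace_continuous g u -> boundary g D u u.
Proof.
move=> uc s gs; have /continuousCP h := uc s gs.
by split; apply/cvg_withinCP => e /h[r r0 rP]; exists r => // z _; exact: rP.
Qed.

Lemma boundary_cst g D (c : C) : boundary g D (fun=> c) (fun=> c).
Proof. exact/boundary_continuous/trace_continuous_cst. Qed.

Lemma boundaryB g D u v b c : boundary g D u b -> boundary g D v c ->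
  boundary g D (fun z => u z - v z) (fun z => b z - c z).
Proof.
move=> h1 h2; have := boundaryD h1 (boundaryM (@boundary_cst g D (-1)) h2).
by apply: boundary_ext => z _; rewrite mulN1r.
Qed.

(** A point near a trace point lies on the trace, inside or outside, and b s is the common limit
    along all three sets. *)
Lemma glue_continuous g u b : {within `[0, 1], continuous g} ->
  (forall z, ~ trace g z -> derivable u z 1) ->
  boundary g (outside g) u b -> boundary g (inside g) u b ->
  continuous (fun z => if `[< trace g z >] then b z else u z).
Proof.
move=> gc ud ho hi z; have [gz|gz] := pselect (trace g z); last first.
  have /continuousCP h := derivable_continuousC (ud z gz).
  have [r r0 rP] := trace_far gc gz.
  apply/continuousCP => e /h[r' r'0 r'P]; exists (Num.min r r').
    by rewrite lt_min r0.
  move=> x; rewrite lt_min => /andP[xr xr'].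
  case: asboolP => [/rP|_]; first by lra.
  by case: asboolP => [//|_]; exact: r'P.
have [/cvg_withinCP h1 /cvg_withinCP h2] := ho z gz; have [_ /cvg_withinCP h3] := hi z gz.
apply/continuousCP => e e0.
have [r1 r10 r1P] := h1 e e0; have [r2 r20 r2P] := h2 e e0; have [r3 r30 r3P] := h3 e e0.
exists (Num.min r1 (Num.min r2 r3)); first by rewrite !lt_min r10 r20.
move=> x; rewrite !lt_min => /and3P[x1 x2 x3]; rewrite (asboolT gz).
case: asboolP => [gx|gx]; first exact: r1P.
by have [ix|ox] := inside_outside gx; [exact: r3P|exact: r2P].
Qed.

Definition tends_to_0 u := forall e : R, 0 < e -> exists r : R, forall z,
  r < cabs z -> cabs (u z) <= e.

Lemma entire_vanish g u b : good_curve g ->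
  (forall z, ~ trace g z -> derivable u z 1) ->
  boundary g (outside g) u b -> boundary g (inside g) u b -> tends_to_0 u ->
  forall z, ~ trace g z -> u z = 0.
Proof.
move=> gg ud ho hi u0 z gz; have [gc _] := gg.
have fc := glue_continuous gc ud ho hi.
have [r r0 rP] := trace_bounded gc.
have := @liouville _ _ (trace g) fc (slim_trace gg) _ _ z gz.
rewrite asboolF //; apply.
- move=> x gx; apply/derivable_sdiff.
  have [r' r'0 r'P] := trace_far gc gx.
  apply: (@sdiff_near _ _ u); first exact/derivable_sdiff/ud.
  by exists r' => // y yx; rewrite asboolF // => /r'P; lra.
- move=> e /u0[r1 r1P]; exists (Num.max r r1) => x; rewrite gt_max => /andP[xr xr1].
  by rewrite asboolF; [exact: r1P|move=> /rP; lra].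
Qed.

(* A row (u, v) of a solution of RHP III. *)
Definition row_rh g w u v :=
  [/\ forall z, ~ trace g z -> derivable u z 1,
      forall z, ~ trace g z -> derivable v z 1 &
      exists a b c, [/\ boundary g (outside g) u a, boundary g (inside g) u a,
        boundary g (outside g) v b, boundary g (inside g) v c &
        forall s, trace g s -> b s = a s * w s + c s]].

(* (u, v) = ((c, d) + O(1/z)) z^(n sigma_3) at infinity. *)
Definition row_asym (n : int) u v (c d : C) := exists K r : R, forall z, r < cabs z ->
  cabs (u z * z ^ (- n) - c) <= K / cabs z /\ cabs (v z * z ^ n - d) <= K / cabs z.

Lemma derivable_comb u v u' v' z : derivable u z 1 -> derivable v z 1 ->
  derivable u' z 1 -> derivable v' z 1 ->
  derivable (fun x => u x * v' x - v x * u' x) z 1.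
Proof.
move=> /derivable_sdiff h1 /derivable_sdiff h2 /derivable_sdiff h3 /derivable_sdiff h4.
by apply/derivable_sdiff; apply: sdiffB => //; apply: sdiffM.
Qed.

(* The determinant of two rows has no jump: (u + , v + ) = (u -, w u - + v -). *)
Lemma wronskian g w u v u' v' n (c d c' d' : C) : good_curve g ->
  row_rh g w u v -> row_rh g w u' v' ->
  row_asym n u v c d -> row_asym n u' v' c' d' ->
  forall z, ~ trace g z -> u z * v' z - v z * u' z = c * d' - d * c'.
Proof.
move=> gg [ud vd [a [b [b1 [h1 h2 h3 h4 jump]]]]].
move=> [ud' vd' [a' [b' [b1' [h1' h2' h3' h4' jump']]]]] [K [r Kr]] [K' [r' Kr']] z gz.
apply/eqP; rewrite -subr_eq0; apply/eqP; pose D := c * d' - d * c'.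
rewrite -/D.
pose F z := u z * v' z - v z * u' z - D.
have Fd x : ~ trace g x -> derivable F x 1.
  move=> gx; apply/derivable_sdiff/sdiffB => //; last exact: sdiff_cst.
  exact/derivable_sdiff/(derivable_comb (ud x gx) (vd x gx) (ud' x gx) (vd' x gx)).
have Fo : boundary g (outside g) F (fun s => a s * b' s - b s * a' s - D).
  exact: (boundaryB (boundaryB (boundaryM h1 h3') (boundaryM h3 h1'))
    (@boundary_cst g (outside g) D)).
have Fi : boundary g (inside g) F (fun s => a s * b' s - b s * a' s - D).
  have := boundaryB (boundaryB (boundaryM h2 h4') (boundaryM h4 h2'))
    (@boundary_cst g (inside g) D).
  by apply: (boundary_ext (fun z _ => erefl)) => s gs; rewrite jump // jump' //; ring.
suff F0 : tends_to_0 F by exact: (entire_vanish gg Fd Fo Fi F0).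
rewrite /F; move: z gz => _ _.
move=> e e0.
(* The errors that [prod] yields for the two products, in units of 1 / cabs z; the [+ 1] makes the
   sum positive. *)
pose B := `|K| * (`|K'| + cabs d') + cabs c * `|K'| + (`|K| * (`|K'| + cabs c') + cabs d * `|K'|) + 1.
have BP : 0 < B.
  by rewrite /B ltr_wpDl // !addr_ge0 ?mulr_ge0 ?addr_ge0 ?cabs_ge0.
exists (Num.max (Num.max r r') (Num.max 1 (B / e))) => z.
rewrite !gt_max => /andP[/andP[zr zr'] /andP[z1 zB]].
have [e1 e2] := Kr z zr; have [e3 e4] := Kr' z zr'.
have z0 : 0 < cabs z by lra.
have zn0 : z != 0 by rewrite -cabs_gt0.
set i := (cabs z)^-1; have i0 : 0 <= i by rewrite invr_ge0 ltW.
have i1 : i <= 1 by rewrite invf_le1 // ltW.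
have {}e1 : cabs (u z * z ^ (- n) - c) <= `|K| * i by rewrite (le_trans e1) // ler_wpM2r // ler_norm.
have {}e2 : cabs (v z * z ^ n - d) <= `|K| * i by rewrite (le_trans e2) // ler_wpM2r // ler_norm.
have {}e3 : cabs (u' z * z ^ (- n) - c') <= `|K'| * i by rewrite (le_trans e3) // ler_wpM2r // ler_norm.
have {}e4 : cabs (v' z * z ^ n - d') <= `|K'| * i by rewrite (le_trans e4) // ler_wpM2r // ler_norm.
(* The growth factors of the two columns cancel in the determinant. *)
have zz : z ^ (- n) * z ^ n = 1 by rewrite -expfzDr // addNr expr0z.
have -> : u z * v' z - v z * u' z - D =
  ((u z * z ^ (- n)) * (v' z * z ^ n) - c * d') - ((v z * z ^ n) * (u' z * z ^ (- n)) - d * c').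
  have -> : (u z * z ^ (- n)) * (v' z * z ^ n) = u z * v' z * (z ^ (- n) * z ^ n) by ring.
  have -> : (v z * z ^ n) * (u' z * z ^ (- n)) = v z * u' z * (z ^ (- n) * z ^ n) by ring.
  by rewrite zz /D; ring.
have prod (x y p r0 : C) (k k' : R) : 0 <= k -> 0 <= k' -> cabs (x - p) <= k * i ->
    cabs (y - r0) <= k' * i ->
    cabs (x * y - p * r0) <= (k * (k' + cabs r0) + cabs p * k') * i.
  move=> k0 k'0 xp yr.
  have -> : x * y - p * r0 = (x - p) * y + p * (y - r0) by ring.
  rewrite (le_trans (cabsD _ _)) // !cabsM mulrDl lerD //; last first.
    by rewrite -mulrA ler_wpM2l ?cabs_ge0.
  rewrite mulrAC ler_pM ?cabs_ge0 //.
  have := cabs_rev y r0; have : k' * i <= k' by rewrite ler_piMr.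
  lra.
rewrite (le_trans (cabsB _ _)) //.
have p1 := prod _ _ _ _ _ _ (normr_ge0 K) (normr_ge0 K') e1 e4.
have p2 := prod _ _ _ _ _ _ (normr_ge0 K) (normr_ge0 K') e2 e3.
apply: (@le_trans _ _ (B * i)).
  rewrite (le_trans (lerD p1 p2)) // -mulrDl ler_wpM2r // /B lerDl.
  exact: ler01.
rewrite ler_pdivrMr //; move: zB; rewrite ltr_pdivrMr // mulrC => /ltW //.
Qed.

Lemma row_rhZ g w u v (k : C) : row_rh g w u v ->
  row_rh g w (fun z => k * u z) (fun z => k * v z).
Proof.
move=> [ud vd [a [b [b1 [h1 h2 h3 h4 jump]]]]]; split.
- by move=> z /ud /derivable_sdiff h; apply/derivable_sdiff; apply: sdiffZ.
- by move=> z /vd /derivable_sdiff h; apply/derivable_sdiff; apply: sdiffZ.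
exists (fun z => k * a z), (fun z => k * b z), (fun z => k * b1 z).
have ko := @boundary_cst g (outside g) k; have ki := @boundary_cst g (inside g) k.
split; [exact: (boundaryM ko h1)|exact: (boundaryM ki h2)|exact: (boundaryM ko h3)|
  exact: (boundaryM ki h4)|].
by move=> s gs; rewrite jump //; ring.
Qed.

Lemma row_asymZ n u v (k c d : C) : row_asym n u v c d ->
  row_asym n (fun z => k * u z) (fun z => k * v z) (k * c) (k * d).
Proof.
move=> [K [r Kr]]; exists (cabs k * K), r => z /Kr[h1 h2].
by split; rewrite -mulrA -mulrBr cabsM -mulrA ler_wpM2l ?cabs_ge0.
Qed.

(** Row available for every weight: the second row of the solution for n = 0, and the test row for n
    < 0. *)
Lemma row_rh01 g w : row_rh g w (fun=> 0) (fun=> 1).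
Proof.
split; try by move=> z _; apply/strict_derivable/sdiff_cst.
exists (fun=> 0), (fun=> 1), (fun=> 1); split; try exact: boundary_cst.
by move=> s _; rewrite mul0r add0r.
Qed.

Lemma sum_ord2 (F : 'I_2 -> C) : \sum_(i < 2) F i = F 0 + F 1.
Proof.
by rewrite !big_ord_recl big_ord0 addr0; congr (_ + F _); apply: val_inj.
Qed.

Lemma ord2E (i : 'I_2) : i = 0 \/ i = 1.
Proof. by case: i => -[|[|//]] h; [left|right]; apply: val_inj. Qed.

Lemma mat2_00 (a b c d : C) : mat2 a b c d 0 0 = a. Proof. by rewrite mxE. Qed.
Lemma mat2_01 (a b c d : C) : mat2 a b c d 0 1 = b. Proof. by rewrite mxE. Qed.
Lemma mat2_10 (a b c d : C) : mat2 a b c d 1 0 = c. Proof. by rewrite mxE. Qed.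
Lemma mat2_11 (a b c d : C) : mat2 a b c d 1 1 = d. Proof. by rewrite mxE. Qed.
Definition mat2E := (mat2_00, mat2_01, mat2_10, mat2_11).

Lemma RHP_III_row g w n Y : RHP_III g w n Y ->
  forall i, row_rh g w (fun z => Y z i 0) (fun z => Y z i 1).
Proof.
move=> [Yh [Yp [Ym [/boundary_valuesE bp /boundary_valuesE bm jump]]] _] i.
have e0 s : trace g s -> Yp s i 0 = Ym s i 0.
  by move=> gs; rewrite jump // mxE sum_ord2 !mat2E mulr1 mulr0 addr0.
split; [by move=> z; exact: Yh|by move=> z; exact: Yh|].
exists (fun s => Yp s i 0), (fun s => Yp s i 1), (fun s => Ym s i 1); split => //.
  by apply: boundary_ext (bm i 0) => // s gs; rewrite e0.
by move=> s gs; rewrite e0 // jump // mxE sum_ord2 !mat2E mulr1.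
Qed.

Lemma asymptotic_row n Y : asymptotic_at_infinity n Y ->
  forall i, row_asym n (fun z => Y z i 0) (fun z => Y z i 1) (i == 0)%:R (i == 1)%:R.
Proof.
move=> [E [K [r H]]] i; exists K, (Num.max r 0) => z.
rewrite gt_max => /andP[zr z0].
have zn0 : z != 0 by rewrite -cabs_gt0.
have [|e Eb] := H z; first by rewrite cabsE ltcR.
have eij j : Y z i j = ((i == j)%:R + E z i j) * sigma3_exp z n j j.
  rewrite e mxE sum_ord2; case: (ord2E j) => ->; rewrite /sigma3_exp /diag2 !mat2E mulr0 ?addr0 ?add0r;
  by rewrite !mxE.
have bE j : cabs (E z i j) <= K / cabs z.
  have := Eb i j; rewrite !cabsE -fmorphV -rmorphM lecR; exact.
rewrite !eij /sigma3_exp /diag2 !mat2E -!mulrA -!expfzDr // subrr addNr expr0z !mulr1.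
by split; rewrite addrC addKr.
Qed.

Lemma RHP_III_asym g w n Y : RHP_III g w n Y ->
  forall i, row_asym n (fun z => Y z i 0) (fun z => Y z i 1) (i == 0)%:R (i == 1)%:R.
Proof. by move=> [_ _]; exact: asymptotic_row. Qed.

Lemma row_asymptotic n (Y : C -> 'M[C]_2) :
  (forall i : 'I_2, row_asym n (fun z => Y z i 0) (fun z => Y z i 1) (i == 0)%:R (i == 1)%:R) ->
  asymptotic_at_infinity n Y.
Proof.
move=> ha.
have [K0 [r0 H0]] := ha 0; have [K1 [r1 H1]] := ha 1.
exists (fun z => Y z *m sigma3_exp z (- n) - 1%:M), (Num.max K0 K1), (Num.max 0 (Num.max r0 r1)).
move=> z; rewrite cabsE ltcR !gt_max => /and3P[z0 zr0 zr1].
have zn0 : z != 0 by rewrite -cabs_gt0.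
have ez i j : (Y z *m sigma3_exp z (- n)) i j = Y z i j * z ^ (if j == 0 then - n else n).
  rewrite mxE sum_ord2 /sigma3_exp /diag2; case: (ord2E j) => -> /=;
  by rewrite !mat2E mulr0 ?addr0 ?add0r ?opprK.
split.
  rewrite addrC subrK; apply/matrixP => i j; rewrite mxE sum_ord2 !ez /sigma3_exp /diag2.
  by case: (ord2E j) => -> /=; rewrite !mat2E mulr0 ?addr0 ?add0r -mulrA -expfzDr // ?addNr ?subrr expr0z mulr1.
move=> i j; rewrite !cabsE -fmorphV -rmorphM lecR.
have -> : (Y z *m sigma3_exp z (- n) - 1%:M) i j =
    Y z i j * z ^ (if j == 0 then - n else n) - (i == j)%:R.
  by rewrite mxE ez; congr (_ + _); rewrite !mxE.
have le (K : R) : K = K0 \/ K = K1 -> K / cabs z <= Num.max K0 K1 / cabs z.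
  by move=> h; rewrite ler_wpM2r ?invr_ge0 ?cabs_ge0 // le_max; case: h => ->; rewrite lexx ?orbT.
case: (ord2E i) => ->; case: (ord2E j) => -> /=.
- by rewrite (le_trans (H0 z zr0).1) // le //; left.
- by rewrite (le_trans (H0 z zr0).2) // le //; left.
- by rewrite (le_trans (H1 z zr1).1) // le //; right.
- by rewrite (le_trans (H1 z zr1).2) // le //; right.
Qed.

Lemma RHP_IIIP g w n (Y : C -> 'M[C]_2) :
  (forall i : 'I_2, row_rh g w (fun z => Y z i 0) (fun z => Y z i 1)) ->
  (forall i : 'I_2, row_asym n (fun z => Y z i 0) (fun z => Y z i 1) (i == 0)%:R (i == 1)%:R) ->
  RHP_III g w n Y.
Proof.
move=> hr ha; split.
- by move=> i j z gz; case: (ord2E j) => ->; case: (hr i) => h1 h2 _; [exact: h1|exact: h2].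
- have ch i : exists abc : (C -> C) * (C -> C) * (C -> C),
      [/\ boundary g (outside g) (fun z => Y z i 0) abc.1.1,
          boundary g (inside g) (fun z => Y z i 0) abc.1.1,
          boundary g (outside g) (fun z => Y z i 1) abc.1.2,
          boundary g (inside g) (fun z => Y z i 1) abc.2 &
          forall s, trace g s -> abc.1.2 s = abc.1.1 s * w s + abc.2 s].
    by case: (hr i) => _ _ [a [b [c H]]]; exists (a, b, c).
  have [F FP] := choice ch.
  exists (fun z => \matrix_(i, j) (if j == 0 then (F i).1.1 z else (F i).1.2 z)).
  exists (fun z => \matrix_(i, j) (if j == 0 then (F i).1.1 z else (F i).2 z)).
  split.
  + apply/boundary_valuesE => i j; have [h1 h2 h3 h4 _] := FP i.
    case: (ord2E j) => ->.
      by apply: boundary_ext h1 => // s _; rewrite mxE.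
    by apply: boundary_ext h3 => // s _; rewrite mxE.
  + apply/boundary_valuesE => i j; have [h1 h2 h3 h4 _] := FP i.
    case: (ord2E j) => ->.
      by apply: boundary_ext h2 => // s _; rewrite mxE.
    by apply: boundary_ext h4 => // s _; rewrite mxE.
  + move=> s gs; apply/matrixP => i j; rewrite !mxE sum_ord2 !mxE /=.
    have [_ _ _ _ h] := FP i; rewrite h //.
    by case: (ord2E j) => -> /=; rewrite ?mulr1 ?mulr0 ?addr0.
exact: row_asymptotic.
Qed.

(** Cramer's rule: the rows of X have determinant 1, so a row of Y is recovered from its
    determinants with them, and these are constants fixed by the asymptotics. *)
Lemma RHP_III_unique g w n Y X : good_curve g -> RHP_III g w n Y -> RHP_III g w n X ->
  forall z, ~ trace g z -> Y z = X z.
Proof.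
move=> gg hY hX z gz; have Yr := RHP_III_row hY; have Ya := RHP_III_asym hY.
have Xr := RHP_III_row hX; have Xa := RHP_III_asym hX.
have wX := wronskian gg (Xr 0) (Xr 1) (Xa 0) (Xa 1) gz.
apply/matrixP => i j.
have w0 := wronskian gg (Yr i) (Xr 0) (Ya i) (Xa 0) gz.
have w1 := wronskian gg (Yr i) (Xr 1) (Ya i) (Xa 1) gz.
move: wX w0 w1; rewrite !eqxx /= !(mulr1, mulr0, mul1r, mul0r, subr0, sub0r) => wX w0 w1.
have key : Y z i j = (Y z i 0 * X z 1 1 - Y z i 1 * X z 1 0) * X z 0 j -
    (Y z i 0 * X z 0 1 - Y z i 1 * X z 0 0) * X z 1 j.
  transitivity (Y z i j * (X z 0 0 * X z 1 1 - X z 0 1 * X z 1 0)).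
    by rewrite wX mulr1.
  by case: (ord2E j) => ->; ring.
rewrite key w0 w1; case: (ord2E i) => -> /=; ring.
Qed.

(** For n < 0 the row (0, 1) has both leading coefficients 0, because z^n is O(1/z). Its determinant
    with the first row of Y is the entry Y z 0 0, which therefore vanishes, against its leading
    coefficient 1. *)
Lemma RHP_III_neg g w (n : int) Y : good_curve g -> n < 0 -> ~ RHP_III g w n Y.
Proof.
move=> gg n0 hY; have Yr := RHP_III_row hY; have Ya := RHP_III_asym hY.
have a01 : row_asym n (fun=> 0) (fun=> 1) (0 : C) 0.
  exists 1, 1 => z z1; have z0 : 0 < cabs z by lra.
  rewrite !mul0r !mul1r subrr cabs0 subr0 invr_ge0 cabs_ge0; split => //.
  rewrite cabs_exprz; have -> : (cabs z)^-1 = cabs z ^ (-1) by [].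
  by rewrite ler_weXz2l // ?ltW //; lia.
have [K [r H]] := Ya 0.
have [r' r'0 r'P] := trace_bounded gg.1.
(* At modulus M + 1 the point is off the trace, the asymptotic estimate applies, and K / cabs z <
   1. *)
pose M := Num.max (Num.max r r') (Num.max 1 (K + 1)).
pose z : C := (M + 1)%:C.
have M1 : 1 <= M by rewrite !le_max lexx !orbT.
have cz : cabs z = M + 1 by rewrite cabs_real ger0_norm //; lra.
have Mr : r <= M by rewrite !le_max lexx.
have Mr' : r' <= M by rewrite !le_max lexx !orbT.
have MK : K + 1 <= M by rewrite !le_max lexx !orbT.
have gz : ~ trace g z by move=> /r'P; rewrite cz; lra.
have := wronskian gg (Yr 0) (row_rh01 g w) (Ya 0) a01 gz.
rewrite mulr1 mulr0 subr0 !mulr0 subrr => Y0.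
have [|h _] := H z; first by rewrite cz; lra.
move: h; rewrite Y0 mul0r sub0r eqxx cabsN cabs1 cz ler_pdivlMr; lra.
Qed.

End RowProblem.

(** * Orthogonal polynomials, Hankel determinants and explicit solutions *)

Section OrthogonalPolynomials.
Context {R : realType}.
Local Notation C := (Cplx R).
Variables (g : R -> C) (w : C -> C).
Hypotheses (gg : good_curve g) (g01 : g 0 = g 1) (gpos : positively_oriented g).
Hypothesis wd : forall x, trace g x -> sdiff setT w x.
Implicit Types p : {poly C}.

Definition pairing p := ointegral g (fun x => p.[x] * w x).

Lemma pw_sdiff p x : trace g x -> sdiff setT (fun x => p.[x] * w x) x.
Proof. by move=> gx; apply: sdiffM => //; [exact: sdiff_horner|exact: wd]. Qed.

Lemma pw_continuous p : trace_continuous g (fun x => p.[x] * w x).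
Proof. by apply: trace_continuous_sdiff => x; exact: pw_sdiff. Qed.

Lemma pairing_lin a p r : pairing (a *: p + r) = a * pairing p + pairing r.
Proof.
rewrite /pairing -(ointegral_lin a gg (@pw_continuous p) (@pw_continuous r)).
congr ointegral; apply/funext => x; rewrite hornerD hornerZ; ring.
Qed.

Lemma pairing0 : pairing 0 = 0.
Proof.
have := pairing_lin 1 0 0; rewrite scale1r addr0 mul1r => /eqP.
by rewrite -subr_eq subrr eq_sym => /eqP.
Qed.

Lemma pairing_sum n (c : 'I_n -> C) (P : 'I_n -> {poly C}) :
  pairing (\sum_(j < n) c j *: P j) = \sum_(j < n) c j * pairing (P j).
Proof.
elim: n c P => [|n IH] c P; first by rewrite !big_ord0 pairing0.
by rewrite !big_ord_recl pairing_lin IH.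
Qed.

Lemma pairing_Xn k : pairing 'X^k = moment g w k.
Proof. by congr ointegral; apply/funext => x; rewrite hornerXn. Qed.

Lemma row_rh_poly p :
  row_rh g w (horner p) (fun z => - cauchy_op g (fun x => p.[x] * w x) z).
Proof.
have [Phi [Pc Po Pi]] := cauchy_op_boundary gg g01 gpos (@pw_sdiff p).
have pc : trace_continuous g (horner p).
  by move=> x _; exact/sdiff_continuousT/sdiff_horner.
have wc : trace_continuous g w by apply: trace_continuous_sdiff => x; exact: wd.
split.
- by move=> z _; exact/strict_derivable/sdiff_horner.
- move=> z gz; have := derivable_cauchy_op gg (@pw_continuous p) gz.
  by move=> /derivable_sdiff h; apply/derivable_sdiff/sdiffN.
have ct := trace_continuousM (@trace_continuous_cst _ g (-1)) Pc.
have ci := trace_continuousM (@trace_continuous_cst _ g (-1)) (trace_continuousD Pc (@pw_continuous p)).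
exists (horner p), (fun s => - Phi s), (fun s => - (Phi s + p.[s] * w s)); split.
- exact: boundary_continuous.
- exact: boundary_continuous.
- have := boundary_continuous (outside g) ct.
  by apply: boundary_ext => z oz; rewrite mulN1r // Po.
- have := boundary_continuous (inside g) ci.
  by apply: boundary_ext => z oz; rewrite mulN1r // Pi.
- by move=> s gs; ring.
Qed.

(** Each use of [cauchy_op_mulX] leaves behind a pairing of p with a lower power, which is 0. *)
Lemma cauchy_op_Xn n p z : ~ trace g z ->
  (forall k, (k < n)%N -> pairing ('X^k * p) = 0) ->
  cauchy_op g (fun x => ('X^n * p).[x] * w x) z =
  z ^+ n * cauchy_op g (fun x => p.[x] * w x) z.
Proof.
move=> gz; elim: n => [|n IH] H; first by rewrite expr0 mul1r expr0 mul1r.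
have -> : (fun x => ('X^(n.+1) * p).[x] * w x) = (fun x => x * (('X^n * p).[x] * w x)).
  by apply/funext => x; rewrite !hornerM !hornerXn exprS; ring.
rewrite (cauchy_op_mulX gg (@pw_continuous ('X^n * p)) gz) -/(pairing _) H // addr0.
by rewrite IH ?exprS ?mulrA // => k kn; apply: H; exact: ltnW.
Qed.

Lemma horner_asym n p : (size p <= n.+1)%N -> exists K : R, forall z, 1 < cabs z ->
  cabs (p.[z] * z ^ (- n%:Z) - p`_n) <= K / cabs z.
Proof.
move=> sp; exists (\sum_(j < n) cabs p`_j) => z z1.
have z0 : 0 < cabs z by lra.
have zn0 : z != 0 by rewrite -cabs_gt0.
rewrite (horner_coef_wide _ sp) big_ord_recr /= mulrDl -mulrA exprnP -expfzDr // subrr expr0z mulr1.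
rewrite addrK mulr_suml (le_trans (cabs_sum _ _ _)) // mulr_suml ler_sum // => j _.
rewrite -mulrA cabsM ler_wpM2l ?cabs_ge0 // exprnP -expfzDr // cabs_exprz.
have -> : (cabs z)^-1 = cabs z ^ (-1) by [].
apply: ler_weXz2l; first exact: ltW.
by have := ltn_ord j; lia.
Qed.

(** Only m orthogonality conditions are imposed for exponent m + 1; the next pairing is the leading
    coefficient of the second entry. The same statement then serves p_(m+1), where this coefficient
    is 0, and p_m, where it is the Hankel determinant of size m + 1. *)
Lemma row_asym_poly m p : (size p <= m.+2)%N ->
  (forall k, (k < m)%N -> pairing ('X^k * p) = 0) ->
  row_asym m.+1%:Z (horner p) (fun z => - cauchy_op g (fun x => p.[x] * w x) z)
    p`_m.+1 (pairing ('X^m * p)).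
Proof.
move=> sp H; have [K KP] := horner_asym sp.
have [K' [r [K'0 r0 rP bP]]] := cauchy_op_bound gg (@pw_continuous ('X^(m.+1) * p)).
exists (Num.max K K'), (Num.max 1 r) => z; rewrite gt_max => /andP[z1 zr].
have gz : ~ trace g z by move=> /rP; lra.
have le x : x = K \/ x = K' -> x / cabs z <= Num.max K K' / cabs z.
  by move=> h; rewrite ler_wpM2r ?invr_ge0 ?cabs_ge0 // le_max; case: h => ->; rewrite lexx ?orbT.
split; first by rewrite (le_trans (KP z z1)) // le //; left.
apply: le_trans (le K' (or_intror erefl)).
have e1 : cauchy_op g (fun x => ('X^(m.+1) * p).[x] * w x) z =
    z ^+ m.+1 * cauchy_op g (fun x => p.[x] * w x) z + pairing ('X^m * p).
  have -> : (fun x => ('X^(m.+1) * p).[x] * w x) = (fun x => x * (('X^m * p).[x] * w x)).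
    by apply/funext => x; rewrite !hornerM !hornerXn exprS; ring.
  rewrite (cauchy_op_mulX gg (@pw_continuous ('X^m * p)) gz) -/(pairing _).
  by rewrite (cauchy_op_Xn gz H) exprS mulrA.
have -> : - cauchy_op g (fun x => p.[x] * w x) z * z ^ m.+1 - pairing ('X^m * p) =
    - cauchy_op g (fun x => ('X^(m.+1) * p).[x] * w x) z.
  by rewrite e1 -exprnP; ring.
by rewrite cabsN; exact: bP.
Qed.

Lemma bump_lt n i : (i < n)%N -> bump n i = i.
Proof. by rewrite /bump ltnNge => /negbTE ->. Qed.

(** A cofactor along the last row is independent of that row, so the row is filled with 0; the same
    coefficients serve powers of z and moments. *)
Definition minor_coef n (j : 'I_n.+1) : C :=
  cofactor (\matrix_(i < n.+1, j < n.+1) if (i < n)%N then moment g w (i + j) else 0)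
    ord_max j.

Lemma det_last_row n (r : nat -> C) :
  \det (\matrix_(i < n.+1, j < n.+1) if (i < n)%N then moment g w (i + j) else r j) =
  \sum_(j < n.+1) r j * minor_coef j.
Proof.
rewrite (expand_det_row _ ord_max); apply: eq_bigr => j _; rewrite mxE /= ltnn.
congr (_ * (_ * \det _)); apply/matrixP => i k; rewrite !mxE /=.
by rewrite bump_lt ltn_ord.
Qed.

Definition orthpoly n : {poly C} := \sum_(j < n.+1) minor_coef j *: 'X^j.

Lemma orth_polyE n : orth_poly g w n = horner (orthpoly n).
Proof.
apply/funext => z; rewrite /orth_poly (det_last_row n (fun j => z ^+ j)) horner_sum.
by apply: eq_bigr => j _; rewrite hornerZ hornerXn mulrC.
Qed.

Lemma size_orthpoly n : (size (orthpoly n) <= n.+1)%N.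
Proof.
apply: (leq_trans (size_sum _ _ _)); apply/bigmax_leqP => j _.
by rewrite (leq_trans (size_scale_leq _ _)) // size_polyXn.
Qed.

(** The pairing is linear, so it acts on the last row of the determinant and turns its powers into
    moments. *)
Lemma pairing_Xorth k n : pairing ('X^k * orthpoly n) =
  \det (\matrix_(i < n.+1, j < n.+1) if (i < n)%N then moment g w (i + j)
    else moment g w (k + j)).
Proof.
rewrite (det_last_row n (fun j => moment g w (k + j))) /orthpoly mulr_sumr.
under eq_bigr => j _ do rewrite -scalerAr -exprD.
rewrite pairing_sum; apply: eq_bigr => j _; by rewrite pairing_Xn mulrC.
Qed.

(** The last row of the determinant repeats row k. *)
Lemma pairing_orth_lt k n : (k < n)%N -> pairing ('X^k * orthpoly n) = 0.
Proof.
move=> kn; rewrite pairing_Xorth.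
have kn1 : (k < n.+1)%N by exact: ltnW.
apply: (@determinant_alternate _ _ _ (Ordinal kn1) ord_max).
  by rewrite -val_eqE /= neq_ltn kn.
by move=> j; rewrite !mxE /= kn ltnn.
Qed.

Lemma pairing_orth_eq n : pairing ('X^n * orthpoly n) = hankel_det g w n.+1.
Proof.
rewrite pairing_Xorth; congr (\det _); apply/matrixP => i j; rewrite !mxE.
case: ltnP => // ni; suff -> : nat_of_ord i = n by [].
by apply/eqP; rewrite eqn_leq ni -ltnS ltn_ord.
Qed.

Lemma coef_orthpoly n : (orthpoly n)`_n = hankel_det g w n.
Proof.
rewrite /orthpoly coef_sum (bigD1 ord_max) //= big1 ?addr0; last first.
  move=> j jn; rewrite coefZ coefXn; case: eqP => [e|_]; last by rewrite mulr0.
  by case/eqP: jn; apply: val_inj.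
rewrite coefZ coefXn eqxx mulr1 /minor_coef /cofactor /= addnn -signr_odd odd_double.
rewrite expr0 mul1r; congr (\det _); apply/matrixP => i j.
by rewrite !mxE /= !bump_lt ?ltn_ord.
Qed.

(** By symmetry l <= n. Expanding the factor of index l in powers leaves only the power l, and only
    if l = n; its coefficient is a Hankel determinant. *)
Lemma pairing_orthM l n : pairing (orthpoly l * orthpoly n) =
  hankel_det g w n * hankel_det g w n.+1 * (l == n)%:R.
Proof.
wlog ln : l n / (l <= n)%N.
  move=> H; have [/H //|nl] := leqP l n.
  rewrite mulrC H ?(ltnW nl) // eq_sym; case: eqP => [e|_]; last by rewrite !mulr0.
  by rewrite e ltnn in nl.
rewrite {1}(_ : orthpoly l = \sum_(j < l.+1) (orthpoly l)`_j *: 'X^j); last first.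
  by rewrite -poly_def; apply/polyP => i; rewrite coef_poly; case: ltnP => // /(leq_trans (size_orthpoly l)) h; rewrite nth_default.
rewrite mulr_suml; under eq_bigr => j _ do rewrite -scalerAl.
rewrite pairing_sum big_ord_recr /= big1 ?add0r; last first.
  move=> j _; rewrite pairing_orth_lt ?mulr0 //.
  exact: leq_trans (ltn_ord j) ln.
have [->|ln'] := eqVneq l n; first by rewrite pairing_orth_eq coef_orthpoly mulr1.
by rewrite pairing_orth_lt ?mulr0 // ltn_neqAle ln'.
Qed.

Lemma RHP_III_0 : RHP_III g w 0 (fun z => mat2 1 (- cauchy_op g w z) 0 1).
Proof.
have e1 : (fun x => (1 : {poly C}).[x] * w x) = w.
  by apply/funext => x; rewrite hornerC mul1r.
have e2 : horner (1 : {poly C}) = (fun=> 1) by apply/funext => x; rewrite hornerC.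
apply: RHP_IIIP => i; case: (ord2E i) => ->.
- rewrite (_ : (fun z => mat2 1 (- cauchy_op g w z) 0 1 0 0) = horner (1 : {poly C})); last first.
    by rewrite e2; apply/funext => z; rewrite mat2E.
  rewrite (_ : (fun z => mat2 1 (- cauchy_op g w z) 0 1 0 1) =
      (fun z => - cauchy_op g (fun x => (1 : {poly C}).[x] * w x) z)); last first.
    by rewrite e1; apply/funext => z; rewrite mat2E.
  exact: row_rh_poly.
- rewrite (_ : (fun z => mat2 1 (- cauchy_op g w z) 0 1 1 0) = (fun=> 0)); last first.
    by apply/funext => z; rewrite mat2E.
  rewrite (_ : (fun z => mat2 1 (- cauchy_op g w z) 0 1 1 1) = (fun=> 1)); last first.
    by apply/funext => z; rewrite mat2E.
  exact: row_rh01.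
- have wc : trace_continuous g w by apply: trace_continuous_sdiff => x; exact: wd.
  have [K [r [K0 r0 _ H]]] := cauchy_op_bound gg wc.
  exists K, r => z zr; rewrite oppr0 expr0z !mulr1 !mat2E eqxx
    (_ : (0 == 1 :> 'I_2) = false) // mulr1n mulr0n subrr cabs0 subr0 cabsN.
  by split; [rewrite divr_ge0 ?cabs_ge0|exact: H].
- exists 0, 0 => z _; rewrite oppr0 expr0z !mulr1 !mat2E eqxx
    (_ : (1 == 0 :> 'I_2) = false) // mulr1n mulr0n !subrr cabs0.
  by rewrite mul0r.
Qed.

Definition explicit_solution n z := (hankel_det g w n)^-1 *:
  mat2 (orth_poly g w n z) (- cauchy_op g (fun x => orth_poly g w n x * w x) z)
    (orth_poly g w n.-1 z) (- cauchy_op g (fun x => orth_poly g w n.-1 x * w x) z).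

Lemma RHP_III_pos m : hankel_det g w m.+1 != 0 ->
  RHP_III g w m.+1%:Z (explicit_solution m.+1).
Proof.
move=> D0; set D := hankel_det g w m.+1 in D0 *.
have row l i : (i == 0 :> 'I_2 /\ l = m.+1) \/ (i == 1 :> 'I_2 /\ l = m) ->
    (fun z => explicit_solution m.+1 z i 0) = (fun z => D^-1 * horner (orthpoly l) z) /\
    (fun z => explicit_solution m.+1 z i 1) = (fun z => D^-1 *
       - cauchy_op g (fun x => (orthpoly l).[x] * w x) z).
  rewrite /explicit_solution /= !orth_polyE.
  by case=> -[/eqP -> ->]; split; apply/funext => z; rewrite mxE mat2E.
apply: RHP_IIIP => i; case: (ord2E i) => ->.
- have [|-> ->] := row m.+1 0; first by left.
  exact: (row_rhZ _ (row_rh_poly _)).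
- have [|-> ->] := row m 1; first by right.
  exact: (row_rhZ _ (row_rh_poly _)).
- have [|-> ->] := row m.+1 0; first by left.
  (* p_(m+1) is orthogonal to one power more than the lemma asks for, which kills the leading
     coefficient of the second entry. *)
  have := row_asymZ D^-1 (row_asym_poly (size_orthpoly m.+1)
    (fun k km => pairing_orth_lt (leqW km))).
  by rewrite pairing_orth_lt // mulr0 coef_orthpoly mulVf.
- have [|-> ->] := row m 1; first by right.
  (* p_m has degree at most m, so its coefficient of index m + 1 is 0, while the pairing with X^m is
     D. *)
  have := row_asymZ D^-1 (row_asym_poly (leqW (size_orthpoly m))
    (fun k km => pairing_orth_lt km)).
  by rewrite pairing_orth_eq mulVf // nth_default ?mulr0 // size_orthpoly.
Qed.

(** A nonzero p would have [size p] distinct roots among the integers beyond r, one too many. *)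
Lemma poly_vanish_far p (r : R) : (forall z, r < cabs z -> p.[z] = 0) -> p = 0.
Proof.
move=> H; apply/eqP; apply: contraT => p0.
pose N := (Num.trunc `|r|).+1.
pose rs : seq C := [seq (N + k)%:R | k <- iota 0 (size p)].
have := @max_poly_roots _ p rs p0; rewrite size_map size_iota ltnn.
move=> -> //; last first.
  rewrite map_inj_uniq ?iota_uniq // => i j /eqP.
  by rewrite eqr_nat eqn_add2l => /eqP.
apply/allP => _ /mapP[k _ ->]; rewrite /root H //.
have -> : (N + k)%:R = ((N + k)%:R : R)%:C :> C by rewrite rmorph_nat.
rewrite cabs_real ger0_norm // (le_lt_trans (ler_norm r)) //.
have /andP[_ h] := truncn_itv (normr_ge0 r).
by rewrite (lt_le_trans h) // ler_nat leq_addr.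
Qed.

(* A kernel vector of a singular Hankel matrix gives a row (p, -C[p w]) decaying
   too fast at infinity: its determinants with the rows of Y vanish. *)
Lemma RHP_III_hankel m Y : RHP_III g w m.+1%:Z Y -> hankel_det g w m.+1 != 0.
Proof.
move=> hY; apply/negP => /det0P[v v0 vH].
pose p : {poly C} := \sum_(j < m.+1) v 0 j *: 'X^j.
have pX k : (k < m.+1)%N -> pairing ('X^k * p) = 0.
  move=> km; rewrite /p mulr_sumr; under eq_bigr => j _ do rewrite -scalerAr -exprD.
  rewrite pairing_sum; move/rowP: vH => /(_ (Ordinal km)); rewrite !mxE => e; rewrite -[RHS]e.
  by apply: eq_bigr => j _; rewrite pairing_Xn mxE addnC.
have sp : (size p <= m.+1)%N.
  apply: (leq_trans (size_sum _ _ _)); apply/bigmax_leqP => j _.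
  by rewrite (leq_trans (size_scale_leq _ _)) // size_polyXn.
have pa := row_asym_poly (leqW sp) (fun k km => pX k (leqW km)).
(* p has degree at most m and is orthogonal to X^m as well, so both leading coefficients of the row
   are 0. *)
rewrite pX // nth_default // in pa.
have Yr := RHP_III_row hY; have Ya := RHP_III_asym hY.
have [r r0 rP] := trace_bounded gg.1.
have p0 : p = 0.
  apply: (@poly_vanish_far p r) => z zr; have gz : ~ trace g z by move=> /rP; lra.
  have wY := wronskian gg (Yr 0) (Yr 1) (Ya 0) (Ya 1) gz.
  have w0 := wronskian gg (row_rh_poly p) (Yr 0) pa (Ya 0) gz.
  have w1 := wronskian gg (row_rh_poly p) (Yr 1) pa (Ya 1) gz.
  move: wY w0 w1; rewrite !eqxx /= !(mulr1, mulr0, mul1r, mul0r, subr0) => wY w0 w1.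
  set c := - cauchy_op _ _ _ in w0 w1.
  (* As det Y = 1, the value p.[z] is a combination of the two vanishing determinants, with entries
     of the first column of Y as coefficients. *)
  transitivity (p.[z] * (Y z 0 0 * Y z 1 1 - Y z 0 1 * Y z 1 0)).
    by rewrite wY mulr1.
  transitivity ((p.[z] * Y z 1 1 - c * Y z 1 0) * Y z 0 0 -
    (p.[z] * Y z 0 1 - c * Y z 0 0) * Y z 1 0); first by ring.
  by rewrite w0 w1 !mul0r subrr.
case/eqP: v0; apply/rowP => j; rewrite mxE.
have := congr1 (fun q : {poly C} => q`_j) p0; rewrite coef0 coef_sum (bigD1 j) //= big1 ?addr0.
  by rewrite coefZ coefXn eqxx mulr1.
move=> i ij; rewrite coefZ coefXn; case: eqP => [e|_]; last by rewrite mulr0.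
by case/eqP: ij; apply: val_inj.
Qed.

End OrthogonalPolynomials.

(** * Changing the jump by diagonal factors *)

Section Transformation.
Context {R : realType}.
Local Notation C := (Cplx R).
Implicit Types (g : R -> C) (z s : C).

Definition near1 (f : C -> C) := exists K r : R, forall z, r < cabs z ->
  cabs (f z - 1) <= K / cabs z.

Lemma near1W f : near1 f -> exists2 K : R, 0 <= K & exists2 r : R, 1 <= r &
  forall z, r < cabs z -> cabs (f z - 1) <= K / cabs z.
Proof.
move=> [K [r H]]; exists `|K|; first exact: normr_ge0.
exists (Num.max 1 r); first by rewrite le_max lexx.
move=> z; rewrite gt_max => /andP[_ /H h]; rewrite (le_trans h) //.
by rewrite ler_wpM2r ?invr_ge0 ?cabs_ge0 // ler_norm.
Qed.

Lemma near1M f h : near1 f -> near1 h -> near1 (fun z => f z * h z).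
Proof.
move=> /near1W[K K0 [r r1 H]] /near1W[K' K'0 [r' r'1 H']].
exists (K * (1 + K') + K'), (Num.max r r') => z.
rewrite gt_max => /andP[zr zr'].
have z1 : 1 <= cabs z by lra.
have := H z zr; have := H' z zr'; set i := (cabs z)^-1 => h1 h2.
have i0 : 0 <= i by rewrite invr_ge0 cabs_ge0.
have i1 : i <= 1 by rewrite invf_le1 //; lra.
have -> : f z * h z - 1 = (f z - 1) * h z + (h z - 1) by ring.
rewrite (le_trans (cabsD _ _)) // cabsM mulrDl lerD //.
rewrite mulrAC ler_pM ?cabs_ge0 //.
have := cabs_rev (h z) 1; rewrite cabs1; have : K' * i <= K' by rewrite ler_piMr.
lra.
Qed.

Lemma near1V f : near1 f -> near1 (fun z => (f z)^-1).
Proof.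
move=> /near1W[K K0 [r r1 H]].
exists (2 * K), (Num.max r (2 * K)) => z; rewrite gt_max => /andP[zr zK].
have z0 : 0 < cabs z by lra.
have := H z zr => h.
have h2 : K / cabs z <= 1 / 2 by rewrite ler_pdivrMr //; lra.
have f2 : 1 / 2 <= cabs (f z).
  have := cabs_rev 1 (f z); rewrite cabs1 cabs_distC; lra.
have f0 : f z != 0 by rewrite -cabs_gt0; lra.
have -> : (f z)^-1 - 1 = (1 - f z) * (f z)^-1 by field.
rewrite cabsM cabsV cabs_distC -mulrA mulrC ler_pM ?invr_ge0 ?cabs_ge0 //.
have -> : 2 = (1 / 2)^-1 :> R by rewrite div1r invrK.
by rewrite lef_pV2 // posrE; lra.
Qed.

(** Entrywise form of a constant diagonal matrix on the left and a diagonal matrix on the right that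
    depends on the side. Trace points fall into the [pin] branch; values there are immaterial. *)
Definition diagonal_transform g (l : 'I_2 -> C) (po pin : 'I_2 -> C -> C)
    (Y : C -> 'M[C]_2) z : 'M[C]_2 :=
  \matrix_(i, j) (l i * (Y z i j * (if `[< outside g z >] then po j z else pin j z))).

(** The factors are regular on the closed sides, so boundary values are multiplied by them and the
    jump becomes J' with pin J' = J po. The left factor l restores the normalisation at infinity:
    the factor po tends to the inverse of l, not to 1. Both directions between the two problems are
    instances. *)
Lemma RHP_transform g (J J' : C -> 'M[C]_2) n Y l po pin :
  {within `[0, 1], continuous g} ->
  (forall j z, ~ inside g z -> sdiff setT (po j) z) ->
  (forall j z, ~ outside g z -> sdiff setT (pin j) z) ->
  (forall s, trace g s -> forall k j, pin k s * J' s k j = J s k j * po j s) ->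
  (forall j, l j != 0) -> (forall j, near1 (fun z => l j * po j z)) ->
  RHP g J n Y -> RHP g J' n (diagonal_transform g l po pin Y).
Proof.
move=> gc pod pid jump l0 asy [Yh [Yp [Ym [/boundary_valuesE bp /boundary_valuesE bm YJ]]] Ya].
have no s : trace g s -> ~ outside g s by move=> gs [].
have ni s : trace g s -> ~ inside g s by move=> gs [].
split.
- move=> i j z gz; apply/derivable_sdiff.
  have [iz|oz] := inside_outside gz.
    have [r r0 rP] := inside_open gc iz.
    apply: (@sdiff_near _ _ (fun x => l i * (Y x i j * pin j x))); last first.
      exists r => // x /rP ix; rewrite mxE asboolF // => ox.
      exact: (inside_not_outside ix ox).
    apply: sdiffZ => //; apply: sdiffM => //; first exact/derivable_sdiff/Yh.
    by apply: sdiff_sub (pid j z _) => // oz; exact: (inside_not_outside iz oz).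
  have [r r0 rP] := outside_open gc oz.
  apply: (@sdiff_near _ _ (fun x => l i * (Y x i j * po j x))); last first.
    by exists r => // x /rP ox; rewrite mxE asboolT.
  apply: sdiffZ => //; apply: sdiffM => //; first exact/derivable_sdiff/Yh.
  by apply: sdiff_sub (pod j z _) => // iz; exact: (inside_not_outside iz oz).
- exists (fun z => \matrix_(i, j) (l i * (Yp z i j * po j z))).
  exists (fun z => \matrix_(i, j) (l i * (Ym z i j * pin j z))).
  have pc j : trace_continuous g (po j).
    by apply: trace_continuous_sdiff => s /ni; exact: pod.
  have ic j : trace_continuous g (pin j).
    by apply: trace_continuous_sdiff => s /no; exact: pid.
  split.
  + apply/boundary_valuesE => i j.
    have := boundaryM (@boundary_cst _ g (outside g) (l i))
      (boundaryM (bp i j) (boundary_continuous (outside g) (pc j))).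
    by apply: boundary_ext => z hz; rewrite mxE // asboolT.
  + apply/boundary_valuesE => i j.
    have := boundaryM (@boundary_cst _ g (inside g) (l i))
      (boundaryM (bm i j) (boundary_continuous (inside g) (ic j))).
    apply: boundary_ext => z hz; rewrite mxE // asboolF // => oz.
    exact: (inside_not_outside hz oz).
  + move=> s gs; apply/matrixP => i j; rewrite !mxE sum_ord2 !mxE.
    rewrite YJ // mxE sum_ord2.
    have e0 := jump s gs 0 j; have e1 := jump s gs 1 j.
    transitivity (l i * (Ym s i 0 * (J s 0 j * po j s) + Ym s i 1 * (J s 1 j * po j s))).
      by ring.
    by rewrite -e0 -e1; ring.
apply: row_asymptotic => i.
have [r0 r00 r0P] := trace_bounded gc.
have [K1 [r1 H1]] := asymptotic_row Ya i.
have [K2 K20 [r2 r21 H2]] := near1W (asy 0); have [K3 K30 [r3 r31 H3]] := near1W (asy 1).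
have ex (j : 'I_2) (Kj rj : R) (e : int) : 1 <= rj -> 0 <= Kj ->
    (forall z, r1 < cabs z -> cabs (Y z i j * z ^ e - (i == j)%:R) <= K1 / cabs z) ->
    (forall z, rj < cabs z -> cabs (l j * po j z - 1) <= Kj / cabs z) ->
    exists K r : R, forall z, r < cabs z ->
      cabs (diagonal_transform g l po pin Y z i j * z ^ e - (i == j)%:R) <= K / cabs z.
  move=> rj1 Kj0 hY hp.
  (* Off the diagonal the left and right constants do not cancel; their ratio only rescales an entry
     that is O(1/z). *)
  pose c := l i / l j.
  exists (cabs c * (`|K1| * (1 + Kj)) + Kj), (Num.max (Num.max r0 r1) rj) => z.
  rewrite !gt_max => /andP[/andP[z0 zr1] zj].
  have oz := outside_large r0P z0.
  have := hY z zr1; have := hp z zj; rewrite mxE asboolT //.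
  set i' := (cabs z)^-1; set N := Y z i j * z ^ e; set P := l j * po j z => h1 h2.
  have {}h2 : cabs (N - (i == j)%:R) <= `|K1| * i'.
    by rewrite (le_trans h2) // ler_wpM2r ?ler_norm // invr_ge0 cabs_ge0.
  have i0 : 0 <= i' by rewrite invr_ge0 cabs_ge0.
  have i1 : i' <= 1 by rewrite invf_le1 //; lra.
  have P2 : cabs P <= 1 + Kj.
    have := cabs_rev P 1; rewrite cabs1; have : Kj * i' <= Kj by rewrite ler_piMr.
    lra.
  have -> : l i * (Y z i j * po j z) * z ^ e = c * (N * P).
    by rewrite /c /N /P; field; exact: l0.
  have -> : c * (N * P) - (i == j)%:R =
      c * ((N - (i == j)%:R) * P) + (i == j)%:R * (P - 1).
    case: eqP => [e1|_]; last by rewrite mulr0n; ring.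
    by rewrite /c e1 mulr1n divff ?l0 //; ring.
  rewrite (le_trans (cabsD _ _)) // [X in _ <= X]mulrDl lerD //.
    rewrite (cabsM c) (cabsM (N - _)) -[X in _ <= X]mulrA.
    by rewrite ler_wpM2l ?cabs_ge0 // mulrAC ler_pM ?cabs_ge0.
  rewrite (cabsM (_)%:R).
  case: eqP => _; rewrite ?cabs1 ?cabs0 ?mul1r ?mul0r //.
  by rewrite mulr_ge0.
have [Ka [ra Ha]] := ex 0 K2 r2 (- n) r21 K20 (fun z h => (H1 z h).1) H2.
have [Kb [rb Hb]] := ex 1 K3 r3 n r31 K30 (fun z h => (H1 z h).2) H3.
exists (Num.max Ka Kb), (Num.max ra rb) => z; rewrite gt_max => /andP[za zb].
have le (K : R) : K = Ka \/ K = Kb -> K / cabs z <= Num.max Ka Kb / cabs z.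
  by move=> h; rewrite ler_wpM2r ?invr_ge0 ?cabs_ge0 // le_max; case: h => ->; rewrite lexx ?orbT.
split; first by rewrite (le_trans (Ha z za)) // le //; left.
by rewrite (le_trans (Hb z zb)) // le //; right.
Qed.

Lemma diag2_mul (a d : C) (M : 'M[C]_2) i j :
  (diag2 a d *m M) i j = (if i == 0 then a else d) * M i j.
Proof.
rewrite mxE sum_ord2 /diag2; case: (ord2E i) => ->;
by rewrite !mat2E /= mul0r ?addr0 ?add0r.
Qed.

Lemma mul_diag2 (a d : C) (M : 'M[C]_2) i j :
  (M *m diag2 a d) i j = M i j * (if j == 0 then a else d).
Proof.
rewrite mxE sum_ord2 /diag2; case: (ord2E j) => ->;
by rewrite !mat2E /= mulr0 ?addr0 ?add0r.
Qed.

Lemma invmx_diag2 (a d : C) : a != 0 -> d != 0 -> invmx (diag2 a d) = diag2 a^-1 d^-1.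
Proof.
move=> a0 d0.
have e : diag2 a d *m diag2 a^-1 d^-1 = 1%:M.
  apply/matrixP => i j; rewrite diag2_mul [RHS]mxE.
  by case: (ord2E i) => ->; case: (ord2E j) => ->; rewrite /diag2 !mat2E /= ?mulr0 // divff.
have [u _] := mulmx1_unit e.
by rewrite -[LHS]mulmx1 -e mulmxA mulVmx // mul1mx.
Qed.

End Transformation.

(** * The reducible connection matrix and its factorisation *)

Section Reducible.
Context {R : realType}.
Local Notation C := (Cplx R).
Variables (q k0 kt k1 kinf t0 c nu : C).
Hypotheses (q_neq0 : q != 0) (q_lt1 : cabs q < 1).
Hypotheses (k0_neq0 : k0 != 0) (kt_neq0 : kt != 0) (k1_neq0 : k1 != 0)
  (kinf_neq0 : kinf != 0) (t0_neq0 : t0 != 0) (nu_neq0 : nu != 0).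

Lemma qpochs2 (a b : C) : qpochs q [:: a; b] = qpoch q a * qpoch q b.
Proof. by rewrite /qpochs !big_cons big_nil mulr1. Qed.

Lemma thetas2 (a b : C) : thetas q [:: a; b] = theta q a * theta q b.
Proof. by rewrite /thetas !big_cons big_nil mulr1. Qed.

Lemma sdiff_scaled_theta (a z : C) : a != 0 -> z != 0 ->
  sdiff setT (fun x => theta q (a * x)) z.
Proof.
move=> a0 z0; apply: (sdiff_comp (f := theta q)) => //.
  by apply: sdiffZ => //; exact: sdiff_id.
by apply: theta_sdiff => //; rewrite mulf_neq0.
Qed.

Lemma sdiff_scaled_qpoch (a z : C) : sdiff setT (fun x => qpoch q (a * x)) z.
Proof.
apply: (sdiff_comp (f := qpoch q)) => //; last exact: qpoch_sdiff.
by apply: sdiffZ => //; exact: sdiff_id.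
Qed.

Lemma sdiff_inverted_qpoch (a z : C) : z != 0 -> sdiff setT (fun x => qpoch q (a / x)) z.
Proof.
move=> z0; apply: (sdiff_comp (f := qpoch q)) => //; last exact: qpoch_sdiff.
by apply: sdiffZ => //; apply: sdiffV => //; exact: sdiff_id.
Qed.

Lemma near1_qpoch (a : C) : near1 (fun z => qpoch q (a / z)).
Proof.
have [K K0 [r r0 H]] := qpoch_near0 q_lt1.
exists (K * cabs a), (Num.max 1 (cabs a / r)) => z; rewrite gt_max => /andP[z1 zr].
have z0 : 0 < cabs z by lra.
have e : cabs (a / z) = cabs a / cabs z by rewrite cabsM cabsV.
rewrite -mulrA -e; apply: H; rewrite e ltr_pdivrMr // mulrC.
by move: zr; rewrite ltr_pdivrMr.
Qed.

Lemma det_mx2 (M : 'M[C]_2) : \det M = M 0 0 * M 1 1 - M 0 1 * M 1 0.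
Proof.
rewrite (expand_det_row _ 0) sum_ord2 /cofactor !det_mx11 !mxE /=.
by rewrite expr0 mul1r expr1 mulN1r mulrN; congr (_ * M _ _ - _ * M _ _); apply/val_inj.
Qed.

Section Connection.
Hypothesis reducible : k0 = kt * k1 * kinf.

Let A := reducible_connection q k0 kt k1 kinf t0 c nu.

(** A product of two theta functions in a * z and b * z acquires the factor 1 / (a * b * z^2) under
    z -> q * z; the relation between the parameters makes this the required multiplier on the
    diagonal. *)
Lemma reducible_connection_in : connection_matrices q k0 kt k1 kinf t0 A.
Proof.
have th (a b z : C) : a != 0 -> b != 0 -> z != 0 -> derivable (fun x => theta q (a * x) * theta q (b * x)) z 1.
  move=> a0 b0 z0; apply/strict_derivable/sdiffM => //; exact: sdiff_scaled_theta.
have E00 z : A z 0 0 = theta q ((kt * t0)^-1 * z) * theta q (k1^-1 * z).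
  by rewrite /A /reducible_connection mat2E thetas2 ![_^-1 * z]mulrC.
have E01 z : A z 0 1 = c * (theta q ((nu * t0)^-1 * z) * theta q (nu / (k0 * kinf) * z)).
  rewrite /A /reducible_connection mat2E thetas2 [_^-1 * z]mulrC.
  by have -> : z * nu / (k0 * kinf) = nu / (k0 * kinf) * z by ring.
have E10 z : A z 1 0 = 0 by rewrite /A /reducible_connection mat2E.
have E11 z : A z 1 1 = theta q (kt / t0 * z) * theta q (k1 * z).
  rewrite /A /reducible_connection mat2E thetas2 [k1 * z]mulrC.
  by have -> : z * kt / t0 = kt / t0 * z by ring.
split.
- move=> i j z /= z0; case: (ord2E i) => ->; case: (ord2E j) => ->.
  + rewrite (_ : (fun z => A z 0 0) = (fun z => theta q ((kt * t0)^-1 * z) * theta q (k1^-1 * z))).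
      by apply: th => //; rewrite invr_eq0 // mulf_neq0.
    by apply/funext => x; exact: E00.
  + rewrite (_ : (fun z => A z 0 1) = (fun z => c * (theta q ((nu * t0)^-1 * z) * theta q (nu / (k0 * kinf) * z)))).
      apply/strict_derivable/sdiffZ => //; apply: sdiffM => //; apply: sdiff_scaled_theta => //.
        by rewrite invr_eq0 mulf_neq0.
      by rewrite mulf_neq0 // invr_eq0 mulf_neq0.
    by apply/funext => x; exact: E01.
  + rewrite (_ : (fun z => A z 1 0) = (fun=> 0)); first exact/strict_derivable/sdiff_cst.
    by apply/funext => x; exact: E10.
  + rewrite (_ : (fun z => A z 1 1) = (fun z => theta q (kt / t0 * z) * theta q (k1 * z))).
      by apply: th => //; rewrite mulf_neq0 // invr_eq0.
    by apply/funext => x; exact: E11.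
- move=> z z0.
  have tq (a : C) : a != 0 -> theta q (a * (q * z)) = - (a * z)^-1 * theta q (a * z).
    by move=> a0; rewrite mulrCA theta_qM // mulf_neq0.
  apply/matrixP => i j; rewrite [RHS]mxE /sigma3_exp mul_diag2 diag2_mul.
  case: (ord2E i) => ->; case: (ord2E j) => -> /=; rewrite ?E00 ?E01 ?E10 ?E11.
  + rewrite !tq ?invr_eq0 ?mulf_neq0 // reducible expr1z exprN1.
    by field; rewrite z0 kt_neq0 k1_neq0 kinf_neq0 t0_neq0.
  + rewrite !tq ?invr_eq0 ?mulf_neq0 ?invr_eq0 ?mulf_neq0 // expr1z opprK expr1z.
    by field; rewrite z0 k0_neq0 kinf_neq0 t0_neq0 nu_neq0.
  + by rewrite !(mulr0, mul0r).
  + rewrite !tq ?mulf_neq0 ?invr_eq0 // reducible !exprN1 opprK expr1z.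
    by field; rewrite z0 kt_neq0 k1_neq0 kinf_neq0 t0_neq0.
exists 1; first exact: oner_neq0.
move=> z z0; rewrite mul1r det_mx2 E00 E01 E10 E11 mulr0 subr0.
rewrite /thetas !big_cons big_nil mulr1.
have -> : kt * z / t0 = kt / t0 * z by ring.
have -> : kt^-1 * z / t0 = (kt * t0)^-1 * z by rewrite invfM; ring.
ring.
Qed.

End Connection.

Section FixedTime.
Variables (m : int) (g : R -> C).
Let t := q ^ m * t0.
Hypotheses (gj : jordan_curve g) (gr : rectifiable g) (gpos : positively_oriented g)
  (g_neq0 : ~ trace g 0).
Hypothesis adm : forall x, x \in [:: kt * t; kt^-1 * t; k1; k1^-1] ->
  (forall k : int, 0 < k -> inside g (q ^ k * x)) /\
  (forall k : int, k <= 0 -> outside g (q ^ k * x)).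

Let gg : good_curve g := good_curve_rectifiable gj gr.
Let gc : {within `[0, 1], continuous g} := gg.1.

Lemma t_neq0 : t != 0.
Proof. by rewrite mulf_neq0 // expfz_neq0. Qed.

(** The points q^k * k1 with k > 0 are inside and tend to 0, which is off the curve. Hence the
    factors in 1 / z are regular on the curve and outside it. *)
Lemma inside0 : inside g 0.
Proof.
have [r r0 rP] := trace_far gc g_neq0.
have k10 : 0 < cabs k1 by rewrite cabs_gt0.
have [N /(_ N.+1 (leqnSn _)) NP] := qpow_small q_lt1 (divr_gt0 r0 k10).
have small : cabs (q ^ N.+1%:Z * k1 - 0) < r.
  by rewrite subr0 cabsM cabsX -ltr_pdivlMr.
have k1in : k1 \in [:: kt * t; kt^-1 * t; k1; k1^-1] by rewrite !inE eqxx !orbT.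
have [h _] := adm k1in; have := h N.+1%:Z isT.
by move/(inside_component (ball_component rP small)).
Qed.

Lemma outside_neq0 z : ~ inside g z -> z != 0.
Proof. by move=> h; apply/eqP => z0; apply: h; rewrite z0; exact: inside0. Qed.

(** The zeros are the points q^(-k) * x with k >= 0, all outside. *)
Lemma qpoch_inside x z : x \in [:: kt * t; kt^-1 * t; k1; k1^-1] -> x != 0 ->
  ~ outside g z -> qpoch q (x^-1 * z) != 0.
Proof.
move=> xin x0 oz; apply: qpoch_neq0 => // k; apply/eqP => e; apply: oz.
have [_ h] := adm xin; have := h (- k%:Z); rewrite oppr_le0 => /(_ isT).
suff -> : q ^ (- k%:Z) * x = z by [].
apply: (mulfI (expf_neq0 k q_neq0)).
have -> : q ^+ k * z = x * (q ^+ k * (x^-1 * z)) by field.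
by rewrite e mulr1 -exprnN mulrA divff ?expf_neq0 // mul1r.
Qed.

(** The zeros are the points q^(k+1) * x with k >= 0, all inside. *)
Lemma qpoch_outside x z : x \in [:: kt * t; kt^-1 * t; k1; k1^-1] -> x != 0 ->
  ~ inside g z -> qpoch q (q * x / z) != 0.
Proof.
move=> xin x0 oz; have z0 := outside_neq0 oz.
apply: qpoch_neq0 => // k; apply/eqP => e; apply: oz.
have [h _] := adm xin; have := h k.+1%:Z isT.
suff -> : q ^ k.+1%:Z * x = z by [].
have -> : q ^ k.+1%:Z * x = q ^+ k * (q * x / z) * z by rewrite -exprnP exprSr; field.
by rewrite e mul1r.
Qed.

(** [fin] and [fout] are the diagonal entries of [F0] and [Finf], written with the four points of
    the admissibility condition, as in [k1^-1^-1], so that the two preceding lemmas apply. *)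
Definition fin (j : 'I_2) (z : C) : C :=
  if j == 0 then qpoch q ((kt * t)^-1 * z) * qpoch q (k1^-1 * z)
  else qpoch q ((kt^-1 * t)^-1 * z) * qpoch q (k1^-1^-1 * z).

Definition fout (j : 'I_2) (z : C) : C :=
  if j == 0 then qpoch q (q * (kt * t) / z) * qpoch q (q * k1 / z)
  else qpoch q (q * (kt^-1 * t) / z) * qpoch q (q * k1^-1 / z).

Lemma fin0E z : fin 0 z = qpoch q ((kt * t)^-1 * z) * qpoch q (k1^-1 * z).
Proof. by []. Qed.

Lemma fin1E z : fin 1 z = qpoch q ((kt^-1 * t)^-1 * z) * qpoch q (k1^-1^-1 * z).
Proof. by []. Qed.

Lemma fout0E z : fout 0 z = qpoch q (q * (kt * t) / z) * qpoch q (q * k1 / z).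
Proof. by []. Qed.

Lemma fout1E z : fout 1 z = qpoch q (q * (kt^-1 * t) / z) * qpoch q (q * k1^-1 / z).
Proof. by []. Qed.

Lemma poles : [/\ kt * t \in [:: kt * t; kt^-1 * t; k1; k1^-1],
  kt^-1 * t \in [:: kt * t; kt^-1 * t; k1; k1^-1],
  k1 \in [:: kt * t; kt^-1 * t; k1; k1^-1] & k1^-1 \in [:: kt * t; kt^-1 * t; k1; k1^-1]].
Proof. by rewrite !inE !eqxx !orbT. Qed.

Lemma poles_neq0 : [/\ kt * t != 0, kt^-1 * t != 0, k1 != 0 & k1^-1 != 0].
Proof.
have kti : kt^-1 != 0 by rewrite invr_eq0.
split; [exact: mulf_neq0 t_neq0|exact: mulf_neq0 t_neq0|by []|by rewrite invr_eq0].
Qed.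

Lemma fin_neq0 j z : ~ outside g z -> fin j z != 0.
Proof.
move=> oz; have [m1 m2 m3 m4] := poles; have [n1 n2 n3 n4] := poles_neq0.
have h1 := qpoch_inside m1 n1 oz; have h2 := qpoch_inside m2 n2 oz.
have h3 := qpoch_inside m3 n3 oz; have h4 := qpoch_inside m4 n4 oz.
by case: (ord2E j) => ->; rewrite ?fin0E ?fin1E mulf_neq0.
Qed.

Lemma fout_neq0 j z : ~ inside g z -> fout j z != 0.
Proof.
move=> oz; have [m1 m2 m3 m4] := poles; have [n1 n2 n3 n4] := poles_neq0.
have h1 := qpoch_outside m1 n1 oz; have h2 := qpoch_outside m2 n2 oz.
have h3 := qpoch_outside m3 n3 oz; have h4 := qpoch_outside m4 n4 oz.
by case: (ord2E j) => ->; rewrite ?fout0E ?fout1E mulf_neq0.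
Qed.

Lemma fin_sdiff j z : sdiff setT (fin j) z.
Proof.
case: (ord2E j) => ->; rewrite /fin /=; apply: sdiffM => //; exact: sdiff_scaled_qpoch.
Qed.

Lemma fout_sdiff j z : z != 0 -> sdiff setT (fout j) z.
Proof.
move=> z0; case: (ord2E j) => ->; rewrite /fout /=; apply: sdiffM => //; exact: sdiff_inverted_qpoch.
Qed.

Lemma fout_near1 j : near1 (fout j).
Proof. by case: (ord2E j) => ->; rewrite /fout /=; apply: near1M; exact: near1_qpoch. Qed.

Lemma F0E z : F0 q kt k1 t z = diag2 (fin 0 z) (fin 1 z).
Proof.
rewrite /F0 /fin /= !qpochs2 invrK.
have -> : (kt^-1 * t)^-1 * z = z * kt / t by rewrite invfM invrK; ring.
by rewrite ![_ * z]mulrC.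
Qed.

Lemma FinfE z : Finf q kt k1 t z = diag2 (fout 0 z) (fout 1 z).
Proof.
rewrite /Finf /fout /= !qpochs2.
have -> : q * kt * t / z = q * (kt * t) / z by ring.
have -> : q * t / (kt * z) = q * (kt^-1 * t) / z by rewrite invfM; ring.
have -> : q / (k1 * z) = q / k1 / z by rewrite invfM; ring.
by [].
Qed.

Let w := weight q k0 kt k1 kinf c nu t.
Let A := reducible_connection q k0 kt k1 kinf t0 c nu.

Lemma weightE z : w z = c * (theta q ((nu * t)^-1 * z) * theta q (nu / (k0 * kinf) * z)) /
  (fin 0 z * fout 1 z).
Proof.
have -> : fin 0 z = qpochs q [:: z / (kt * t); z / k1].
  by rewrite /fin /= qpochs2 ![_^-1 * z]mulrC.
have -> : fout 1 z = qpochs q [:: q * t / (kt * z); q / (k1 * z)].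
  rewrite /fout /= qpochs2.
  have -> : q * t / (kt * z) = q * (kt^-1 * t) / z by rewrite invfM; ring.
  by have -> : q / (k1 * z) = q / k1 / z by rewrite invfM; ring.
rewrite /w /weight thetas2 [_^-1 * z]mulrC.
by have -> : z * nu / (k0 * kinf) = nu / (k0 * kinf) * z by ring.
Qed.

Lemma weight_sdiff z : trace g z -> sdiff setT w z.
Proof.
move=> gz; have oz : ~ outside g z by case.
have iz : ~ inside g z by case.
have z0 := outside_neq0 iz.
have -> : w = (fun z => c * (theta q ((nu * t)^-1 * z) * theta q (nu / (k0 * kinf) * z)) *
    (fin 0 z * fout 1 z)^-1) by apply/funext => x; exact: weightE.
apply: sdiffM => //.
  apply: sdiffZ => //; apply: sdiffM => //; apply: sdiff_scaled_theta => //.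
    by rewrite invr_eq0 mulf_neq0 // t_neq0.
  by rewrite mulf_neq0 // invr_eq0 mulf_neq0.
apply: sdiffV => //; last by rewrite mulf_neq0 ?fin_neq0 ?fout_neq0.
by apply: sdiffM => //; [exact: fin_sdiff|exact: fout_sdiff].
Qed.

Definition dfac : C := (-1) ^ m * q ^ (m * (m + 1) %/ 2)%Z * t0 ^ m.

Lemma dfac_neq0 : dfac != 0.
Proof. by rewrite !mulf_neq0 ?expfz_neq0 // oppr_eq0 oner_eq0. Qed.

(** [lfac], [pout] and [pins] are the diagonal entries of the inverse of D_1, of the inverse of
    F_infty times D_1, and of F_0 D_2. *)
Definition lfac (j : 'I_2) : C := if j == 0 then (nu ^ m)^-1 else (kt ^ m)^-1.

Definition pout (j : 'I_2) (z : C) : C := (fout j z)^-1 * (lfac j)^-1.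

Definition pins (j : 'I_2) (z : C) : C :=
  fin j z * (dfac * (if j == 0 then nu ^ m * kt ^ m else 1)).

Lemma lfac_neq0 j : lfac j != 0.
Proof. by rewrite /lfac; case: ifP => _; rewrite invr_eq0 expfz_neq0. Qed.

Lemma pins_neq0 j z : ~ outside g z -> pins j z != 0.
Proof.
move=> oz; rewrite mulf_neq0 ?fin_neq0 // mulf_neq0 ?dfac_neq0 //.
by case: ifP => _; rewrite ?oner_eq0 // mulf_neq0 ?expfz_neq0.
Qed.

Lemma pout_neq0 j z : ~ inside g z -> pout j z != 0.
Proof. by move=> iz; rewrite mulf_neq0 // invr_eq0 ?fout_neq0 ?lfac_neq0. Qed.

Lemma theta_split (x z : C) : x != 0 -> z != 0 ->
  theta q (x^-1 * z) = qpoch q (x^-1 * z) * qpoch q (q * x / z).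
Proof.
by move=> x0 z0; rewrite /theta invfM invrK; congr (_ * qpoch q _); ring.
Qed.

(** This absorbs the factor z^m of the jump by moving theta from t_0 to t_m; the remaining power of
    a is what D_1 and D_2 compensate. *)
Lemma theta_time (a z : C) : a != 0 -> z != 0 ->
  dfac * theta q ((a * t)^-1 * z) = a ^ (- m) * z ^ m * theta q ((a * t0)^-1 * z).
Proof.
move=> a0 z0; have at0 : a * t0 != 0 by rewrite mulf_neq0.
have u0 : (a * t0)^-1 * z != 0 by rewrite mulf_neq0 // invr_eq0.
have := theta_shift q_lt1 q_neq0 m u0.
have -> : q ^ (- m) * ((a * t0)^-1 * z) = (a * t)^-1 * z.
  by rewrite /t !invfM -invr_expz; ring.
rewrite /dfac => e; rewrite mulrAC e !expfzMl -!invr_expz.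
have ea : (a * t0)^-1 ^ m = (a ^ m)^-1 * (t0 ^ m)^-1.
  by rewrite exprz_inv -invr_expz expfzMl invfM.
rewrite ea; have := expfz_neq0 m t0_neq0; move: (t0 ^ m) => T T0.
by have := expfz_neq0 m a0; move: (a ^ m) => a' a'0; field; rewrite T0 a'0.
Qed.

(** With a = kt, kt^-1 and nu, [theta_time] leaves the constants kt^(-m), kt^m and nu^(-m) in the
    entries (0, 0), (1, 1) and (0, 1). The powers in D_1 and D_2 are the ones that cancel all
    three. *)
Lemma jump_relation s : trace g s -> forall k j,
  pins k s * mat2 1 (w s) 0 1 k j = (s ^ m *: A s) k j * pout j s.
Proof.
move=> gs k j; have oz : ~ outside g s by case.
have iz : ~ inside g s by case.
have s0 := outside_neq0 iz; have [n1 n2 n3 n4] := poles_neq0.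
have f0 := fin_neq0 (0) oz; have f1 := fin_neq0 (1) oz.
have fo0 := fout_neq0 (0) iz; have fo1 := fout_neq0 (1) iz.
have nm := expfz_neq0 m nu_neq0; have km := expfz_neq0 m kt_neq0.
have ki0 : kt^-1 != 0 by rewrite invr_eq0.
have e0 : fin 0 s * fout 0 s * dfac = (kt ^ m)^-1 * s ^ m *
    (theta q ((kt * t0)^-1 * s) * theta q (k1^-1 * s)).
  transitivity (dfac * theta q ((kt * t)^-1 * s) * theta q (k1^-1 * s)).
    rewrite (theta_split n1 s0) (theta_split n3 s0) fin0E fout0E.
    move: (qpoch _ _) (qpoch _ _) (qpoch _ _) (qpoch _ _) => x1 x2 x3 x4; ring.
  by rewrite (theta_time kt_neq0 s0) -invr_expz [RHS]mulrA.
have e1 : fin 1 s * fout 1 s * dfac = kt ^ m * s ^ m *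
    (theta q ((kt^-1 * t0)^-1 * s) * theta q (k1^-1^-1 * s)).
  transitivity (dfac * theta q ((kt^-1 * t)^-1 * s) * theta q (k1^-1^-1 * s)).
    rewrite (theta_split n2 s0) (theta_split n4 s0) fin1E fout1E.
    move: (qpoch _ _) (qpoch _ _) (qpoch _ _) (qpoch _ _) => x1 x2 x3 x4; ring.
  by rewrite (theta_time ki0 s0) exprz_inv opprK [RHS]mulrA.
have := theta_time nu_neq0 s0; rewrite -invr_expz => e2.
rewrite [(s ^ m *: A s) k j]mxE /A /reducible_connection /pins /pout /lfac.
case: (ord2E k) => ->; case: (ord2E j) => -> /=; rewrite !mat2E ?thetas2.
- rewrite ![s / _]mulrC mulr1.
  transitivity ((fin 0 s * fout 0 s * dfac) * (nu ^ m * kt ^ m) * (fout 0 s)^-1).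
    move: (fin 0 s) (fout 0 s) fo0 dfac (nu ^ m) (kt ^ m) => f h h0 d N K.
    by field.
  rewrite e0; move: (theta _ _) (theta _ _) (nu ^ m) nm (kt ^ m) km (s ^ m) (fout 0 s) fo0.
  by move=> a b N N0 K K0 S h h0; field; rewrite h0 K0 N0.
- rewrite weightE [s / _]mulrC.
  have -> : s * nu / (k0 * kinf) = nu / (k0 * kinf) * s by ring.
  transitivity ((dfac * theta q ((nu * t)^-1 * s)) * c * theta q (nu / (k0 * kinf) * s)
     * (nu ^ m * kt ^ m) * (fout 1 s)^-1).
    move: (theta _ _) (theta _ _) (fin 0 s) f0 (fout 1 s) fo1 dfac (nu ^ m) (kt ^ m).
    by move=> a b f f0' h h0 d N K; field; rewrite h0 f0'.
  rewrite e2; move: (theta _ _) (theta _ _) (nu ^ m) nm (kt ^ m) km (s ^ m) (fout 1 s) fo1.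
  by move=> a b N N0 K K0 S h h0; field; rewrite h0 K0 N0.
- by rewrite !(mulr0, mul0r).
- have -> : s * kt / t0 = (kt^-1 * t0)^-1 * s by rewrite invfM invrK; ring.
  have -> : s * k1 = k1^-1^-1 * s by rewrite invrK mulrC.
  transitivity ((fin 1 s * fout 1 s * dfac) * (fout 1 s)^-1).
    by move: (fin 1 s) (fout 1 s) fo1 dfac => f h h0 d; field.
  rewrite e1; move: (theta _ _) (theta _ _) (kt ^ m) km (s ^ m) (fout 1 s) fo1.
  by move=> a b K K0 S h h0; field; rewrite h0 K0.
Qed.

Lemma RHP_II_to_III n Psi : RHP_II g A m n Psi ->
  RHP_III g w n (diagonal_transform g lfac pout pins Psi).
Proof.
apply: RHP_transform => //.
- move=> j z iz; apply: sdiffM => //; last exact: sdiff_cst.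
  by apply: sdiffV => //; [exact/fout_sdiff/outside_neq0|exact: fout_neq0].
- by move=> j z oz; apply: sdiffM => //; [exact: fin_sdiff|exact: sdiff_cst].
- exact: jump_relation.
- exact: lfac_neq0.
(* The constants cancel: lfac j * pout j z is the inverse of fout j z. *)
move=> j; have [K [r H]] := near1V (fout_near1 j); exists K, r => z /H.
by rewrite /pout mulrCA divff ?mulr1 // lfac_neq0.
Qed.

Lemma RHP_III_to_II n Y : RHP_III g w n Y ->
  RHP_II g A m n (diagonal_transform g (fun j => (lfac j)^-1)
    (fun j z => (pout j z)^-1) (fun j z => (pins j z)^-1) Y).
Proof.
apply: RHP_transform => //.
- move=> j z iz; apply: sdiffV => //; last exact: pout_neq0.
  apply: sdiffM => //; last exact: sdiff_cst.
  by apply: sdiffV => //; [exact/fout_sdiff/outside_neq0|exact: fout_neq0].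
- move=> j z oz; apply: sdiffV => //; last exact: pins_neq0.
  by apply: sdiffM => //; [exact: fin_sdiff|exact: sdiff_cst].
- move=> s gs k j; have oz : ~ outside g s by case.
  have iz : ~ inside g s by case.
  have p0 := pins_neq0 k oz; have o0 := pout_neq0 j iz.
  apply: (mulfI p0); rewrite mulrA divff // mul1r mulrA jump_relation //.
  by rewrite mulfK.
- by move=> j; rewrite invr_eq0 lfac_neq0.
move=> j; have [K [r H]] := fout_near1 j; exists K, r => z /H.
by rewrite /pout invfM !invrK mulrCA mulVf ?mulr1 // lfac_neq0.
Qed.

Lemma diagonal_transformE Psi z : ~ trace g z ->
  (outside g z -> diagonal_transform g lfac pout pins Psi z =
    invmx (D1 kt nu m) *m Psi z *m invmx (Finf q kt k1 t z) *m D1 kt nu m) /\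
  (inside g z -> diagonal_transform g lfac pout pins Psi z =
    invmx (D1 kt nu m) *m Psi z *m F0 q kt k1 t z *m D2 q kt t0 nu m).
Proof.
move=> gz; have nm := expfz_neq0 m nu_neq0; have km := expfz_neq0 m kt_neq0.
split=> hz; apply/matrixP => i j; rewrite mxE.
  have iz : ~ inside g z by move=> iz; exact: (inside_not_outside iz hz).
  rewrite asboolT // FinfE !invmx_diag2 ?fout_neq0 //.
  rewrite !mul_diag2 diag2_mul /lfac /pout /lfac.
  by case: (ord2E i) => ->; case: (ord2E j) => -> /=; rewrite ?invrK; ring.
have oz : ~ outside g z by exact: inside_not_outside.
rewrite asboolF // F0E invmx_diag2 // /D2 -scalemxAr mxE.
rewrite !mul_diag2 diag2_mul /lfac /pins -/dfac.
by case: (ord2E i) => ->; case: (ord2E j) => -> /=; ring.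
Qed.

End FixedTime.
End Reducible.

Theorem mainTheorem6 (R : realType) (q k0 kt k1 kinf t0 c nu : Cplx R)
    (gamma : int -> R -> Cplx R)
    (q_gt0 : 0 < `|q|) (q_lt1 : `|q| < 1)
    (k0_neq0 : k0 != 0) (kt_neq0 : kt != 0) (k1_neq0 : k1 != 0)
    (kinf_neq0 : kinf != 0) (t0_neq0 : t0 != 0) (nu_neq0 : nu != 0)
    (nonres : nonresonant q k0 kt k1 kinf t0)
    (reducible : k0 = kt * k1 * kinf)
    (adm : admissible q kt k1 t0 gamma) :
  let A := reducible_connection q k0 kt k1 kinf t0 c nu in
  connection_matrices q k0 kt k1 kinf t0 A /\
  forall m : int,
  let g := gamma m in
  let tm := q ^ m * t0 in
  let w := weight q k0 kt k1 kinf c nu tm in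
  [/\ (* (a) *)
      (forall n : int,
         ((exists Psi, RHP_II g A m n Psi) <-> (exists Y, RHP_III g w n Y)) /\
         (forall Psi Y, RHP_II g A m n Psi -> RHP_III g w n Y ->
            (forall z, outside g z ->
               Y z = invmx (D1 kt nu m) *m Psi z *m
                     invmx (Finf q kt k1 tm z) *m D1 kt nu m) /\
            (forall z, inside g z ->
               Y z = invmx (D1 kt nu m) *m Psi z *m
                     F0 q kt k1 tm z *m D2 q kt t0 nu m))),
      (* (b) *)
      (forall n : int, n < 0 ->
         ~ (exists Psi, RHP_II g A m n Psi) /\ ~ (exists Y, RHP_III g w n Y)),
      (* (c) *)
      is_the_solution g (RHP_III g w 0)
        (fun z => mat2 1 (- cauchy_op g w z) 0 1)
    & (* (d) *)
      (forall n : nat, (0 < n)%N ->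
         ((exists Y, RHP_III g w n%:Z Y) <-> hankel_det g w n != 0) /\
         (hankel_det g w n != 0 ->
          is_the_solution g (RHP_III g w n%:Z)
            (fun z => (hankel_det g w n)^-1 *:
               mat2 (orth_poly g w n z)
                    (- cauchy_op g (fun x => orth_poly g w n x * w x) z)
                    (orth_poly g w n.-1 z)
                    (- cauchy_op g (fun x => orth_poly g w n.-1 x * w x) z)))) /\
      (forall l n : nat,
         ointegral g (fun z => orth_poly g w l z * orth_poly g w n z * w z) =
         hankel_det g w n * hankel_det g w n.+1 * (l == n)%:R)].

Proof.
have q0 : q != 0 by rewrite -normr_gt0.
have q1 : cabs q < 1 by move: q_lt1; rewrite cabsE ltcR.
move=> A; split; first exact: reducible_connection_in.
move=> m g tm w; have [[gj gr gpos g0] gadm _] := adm m.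
have gg : good_curve g := good_curve_rectifiable gj gr.
have [_ g01 _] := gj.
have wd x : trace g x -> sdiff setT w x.
  by move=> gx; 
  exact: (weight_sdiff c q0 q1 k0_neq0 kt_neq0 k1_neq0 kinf_neq0 t0_neq0 nu_neq0 gj gr g0 gadm gx).
have II_III n Psi : RHP_II g A m n Psi -> RHP_III g w n
    (diagonal_transform g (lfac kt nu m) (pout q kt k1 t0 nu m) (pins q kt k1 t0 nu m) Psi).
  by move=> h; exact: (RHP_II_to_III q0 q1 kt_neq0 k1_neq0 t0_neq0 nu_neq0 gj gr g0 gadm h).
have zero := RHP_III_0 gg g01 gpos wd.
split.
- move=> n; split.
    split=> [[Psi h]|[Y h]]; first by eexists; exact: II_III h.
    by eexists; exact: (RHP_III_to_II q0 q1 kt_neq0 k1_neq0 t0_neq0 nu_neq0 gj gr g0 gadm h).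
  move=> Psi Y hPsi hY.
  (* The relation is claimed for any pair of solutions: the transform of Psi solves the same problem
     as Y, so the two agree off the curve. *)
  have E := RHP_III_unique gg hY (II_III _ _ hPsi).
  have DE := diagonal_transformE q0 q1 kt_neq0 k1_neq0 t0_neq0 nu_neq0 gj gr g0 gadm Psi.
  by split=> z hz; rewrite (E z hz.1); [exact: (DE z hz.1).1|exact: (DE z hz.1).2].
- move=> n n0; split=> [[Psi /II_III]|[Y]]; exact: (RHP_III_neg gg n0).
- split=> [|Y hY z gz]; first exact: zero.
  exact: (RHP_III_unique gg hY zero gz).
split.
  move=> [//|n] _; split.
    split=> [[Y]|d0]; first exact: (RHP_III_hankel gg g01 gpos wd).
    by eexists; exact: (RHP_III_pos gg g01 gpos wd d0).
  move=> d0; have h := RHP_III_pos gg g01 gpos wd d0.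
  split=> [|Y hY z gz]; first exact: h.
  exact: (RHP_III_unique gg hY h gz).
move=> l n; rewrite -(pairing_orthM gg wd) /pairing !orth_polyE.
by congr (ointegral g _); apply/funext => x; rewrite hornerM.
Qed.
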